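(* \textsc{Tournament Value Maximization} is NP-hard, even when restricted to instances whose game-value function $v$ takes values only in $\{0,1\}$.
   Context: Players form a finite set $N\subset\mathbb{N}$ with $|N|=n=2^{n'}$ for some $n'\in\mathbb{N}$; player $i$ beats player $j$ whenever $i>j$ (so the larger number is the stronger player). A seeding is a bijection $\sigma:N\to[n]$, where $[n]=\{1,\dots,n\}$. The knockout tournament under $\sigma$ proceeds in rounds $r=1,\dots,n'$: for each block of seed positions $B_{r,k}=\{(k-1)2^r+1,\dots,k2^r\}$, the winner of the block is the stronger of the winners of its first half $\{(k-1)2^r+1,\dots,(k-1)2^r+2^{r-1}\}$ and its second half (a block of a single position is won by the player seeded there); in round $r$ the winner $a$ of the first half plays the winner $b$ of the second half, and this game has value $v(a,b,r)$, where $v:N\times N\times\mathbb{N}\to\mathbb{Z}$ is the game-value function. The tournament value $V_\sigma$ is the sum of the values of all $n-1$ games played. \textsc{Tournament Value Maximization}: given $N$, $v$ and an integer $V$, decide whether there is a seeding $\sigma$ with $V_\sigma\ge V$. *)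

(* Defs.v *)
From mathcomp Require Import all_boot all_algebra.
Set Implicit Arguments.
Unset Strict Implicit.
Unset Printing Implicit Defensive.
Import GRing.Theory.

(* tape symbols: None = blank, Some b = bit b *)
Definition sym := option bool.

Inductive move := MLeft | MRight | MStay.

(* states are 'I_(nst.+1); the start state is ord0 *)
Record TM := {
  nst : nat;
  delta : 'I_nst.+1 -> sym -> 'I_nst.+1 * sym * move;
  halting : 'I_nst.+1 -> bool;
  accepting : 'I_nst.+1 -> bool
}.

(* configuration: state, cells to the left of the head (nearest first),
   scanned cell, cells to the right (nearest first); the tape is blank
   beyond the stored cells *)
Record config (M : TM) := Config {
  cstate : 'I_(nst M).+1;
  cleft : seq sym;
  chead : sym;
  cright : seq sym
}.

Definition step (M : TM) (c : config M) : config M :=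
  let: Config q l h r := c in
  if halting q then c else
  let: (q', w, m) := delta q h in
  match m with
  | MStay => Config q' l w r
  | MLeft => match l with
             | [::] => Config q' [::] None (w :: r)
             | a :: l' => Config q' l' a (w :: r)
             end
  | MRight => match r with
              | [::] => Config q' (w :: l) None [::]
              | a :: r' => Config q' (w :: l) a r'
              end
  end.

Definition run (M : TM) (t : nat) (c : config M) : config M := iter t (@step M) c.

Definition init (M : TM) (x : seq bool) : config M :=
  match map Some x with
  | [::] => Config (ord0 : 'I_(nst M).+1) [::] None [::]
  | a :: r => Config (ord0 : 'I_(nst M).+1) [::] a r
  end.

Fixpoint out_word (s : seq sym) : seq bool :=
  match s with
  | Some b :: s' => b :: out_word s'
  | _ => [::]
  end.

Definition output (M : TM) (c : config M) : seq bool := out_word (chead c :: cright c).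

Definition pbound (c k n : nat) : nat := c * n ^ k + c.

Definition language := seq bool -> Prop.

Definition decides_poly (M : TM) (L : language) : Prop :=
  exists c k, forall x,
    let cf := run (pbound c k (size x)) (init M x) in
    halting (cstate cf) /\ (accepting (cstate cf) <-> L x).

Definition in_P (L : language) : Prop := exists M, decides_poly M L.

Definition poly_computable (f : seq bool -> seq bool) : Prop :=
  exists M c k, forall x,
    let cf := run (pbound c k (size x)) (init M x) in
    halting (cstate cf) /\ output cf = f x.

(* self-delimiting pairing of bit strings *)
Definition sd (s : seq bool) : seq bool :=
  flatten (map (fun b => [:: b; b]) s) ++ [:: false; true].

Definition pair_enc (x w : seq bool) : seq bool := sd x ++ w.

Definition in_NP (L : language) : Prop :=
  exists (L' : language) c k, in_P L' /\
    forall x, L x <-> exists w, size w <= pbound c k (size x) /\ L' (pair_enc x w).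

Record tvm_instance := TVMInstance {
  players : seq nat;          (* the set N (as a duplicate-free list) *)
  nexp : nat;                 (* n' with |N| = 2^n' *)
  gval : nat -> nat -> nat -> int;
  target : int
}.

Definition wf_instance (I : tvm_instance) : Prop :=
  uniq (players I) /\ size (players I) = 2 ^ nexp I.

Definition zero_one (I : tvm_instance) : Prop :=
  forall a b r, a \in players I -> b \in players I ->
    gval I a b r = 0%R \/ gval I a b r = 1%R.

Definition is_seeding (I : tvm_instance) (sigma : nat -> nat) : Prop :=
  {in players I &, injective sigma} /\
  (forall i, i \in players I -> 1 <= sigma i <= size (players I)) /\
  (forall p, 1 <= p <= size (players I) ->
     exists2 i, i \in players I & sigma i = p).

Definition player_at (I : tvm_instance) (sigma : nat -> nat) (p : nat) : nat :=
  nth 0 [seq i <- players I | sigma i == p] 0.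

(* winner of block B_{r,k}; player i beats j iff i > j *)
Fixpoint block_winner (I : tvm_instance) (sigma : nat -> nat) (r k : nat) : nat :=
  match r with
  | 0 => player_at I sigma k
  | r'.+1 => maxn (block_winner I sigma r' (2 * k - 1)) (block_winner I sigma r' (2 * k))
  end.

Definition tournament_value (I : tvm_instance) (sigma : nat -> nat) : int :=
  (\sum_(1 <= r < (nexp I).+1)
     \sum_(1 <= k < (size (players I) %/ 2 ^ r).+1)
       gval I (block_winner I sigma r.-1 (2 * k - 1))
              (block_winner I sigma r.-1 (2 * k)) r)%R.

Definition tvm_yes (I : tvm_instance) : Prop :=
  exists sigma, is_seeding I sigma /\ (target I <= tournament_value I sigma)%R.

Fixpoint binf (fuel n : nat) : seq bool :=
  match fuel with
  | 0 => [::]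
  | f.+1 => if n == 0 then [::] else odd n :: binf f n./2
  end.
Definition bin (n : nat) : seq bool := binf n n.   (* LSB first *)

Definition enc_nat (n : nat) : seq bool := sd (bin n).
Definition enc_int (z : int) : seq bool :=
  match z with
  | Posz n => sd (false :: bin n)
  | Negz n => sd (true :: bin n)
  end.

Definition enc_instance (I : tvm_instance) : seq bool :=
  enc_nat (nexp I) ++ enc_nat (size (players I)) ++
  flatten (map enc_nat (players I)) ++
  flatten (map (fun a => flatten (map (fun b =>
     flatten (map (fun r => enc_int (gval I a b r)) (iota 1 (nexp I))))
     (players I))) (players I)) ++
  enc_int (target I).

(* Main.v *)
(* Cook-Levin, carried straight to tournaments.  A polynomial-time verifier is
   unrolled into a space-time tableau on an [N * N] torus, [N] a power of two.
   A tile at a cell guesses the contents of the cell and of its two neighbours;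
   local consistency means that certain bits of a cell equal certain bits of
   its right or upper neighbour.  In the tournament every cell owns one player
   per tile, one guard fewer than it has tiles, and two element players (bit 0
   and bit 1) per constraint.  Guards score by knocking out tiles of their cell
   in round 1, so exactly one tile per cell survives; a surviving tile scores
   in later rounds against the elements its bits cover.  As a player loses at
   most once, the target is reached iff every guard and every element is
   credited, and both elements of a constraint are covered iff the bits agree.

   The instance is written by nested loops over positions with local tests, for
   which a small loop language is compiled to a one-tape machine.  Loop
   variables are marks on an array of blocks, and array doubling while the input
   is read makes the number of blocks a power of two.  Two such programs are
   composed: the first pads the input to a template of the initial row (input
   bits, free witness cells, blanks), the second prints the tournament. *)
Require Import Defs.
From mathcomp Require Import all_boot all_algebra zify.
From Stdlib Require Import FunctionalExtensionality.
Set Implicit Arguments.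
Unset Strict Implicit.
Unset Printing Implicit Defensive.

(** * A structured language for one-tape machines *)

(** The value matrix has to be printed for all pairs of players and all rounds by programs that only
    compare loop positions and read marks. The number of players is a power of two and the target a
    constant times a power of two, so their numerals are runs of zeros closed by a constant word. A
    player's number has two one-hot words for its cell as low digits and a constant word for kind
    and index as high digits; the high digits also put guards above tiles, tiles above elements and
    elements above fillers. Only the number of rounds needs a counter. It grows by two whenever the
    array doubles, so its numeral is kept in the array and incremented during loading.

    A scoring game is credited to a winning guard but to a losing element. This asymmetry gives the
    upper bound on the value: guards score in round 1 only, elements lose once. It also forces a
    tile beaten by a guard never to score, because that tile leaves in round 1.

    On the torus the last row is followed by the initial one; there both bits of every vertical
    constraint are constantly false, so the seam imposes nothing. *)

Definition stream := nat -> sym.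
Definition scons (a : sym) (s : stream) : stream :=
  fun n => if n is n'.+1 then s n' else a.
Definition stail (s : stream) : stream := fun n => s n.+1.
Definition blanks : stream := fun=> None.
Definition sapp (l : seq sym) (s : stream) : stream := foldr scons s l.

(* The cells left of the head (nearest first), and the scanned cell followed by
   the cells right of it. *)
Definition tape := (stream * stream)%type.

Definition tscan (t : tape) : sym := t.2 0.
Definition tmove (d : move) (t : tape) : tape :=
  match d with
  | MLeft => (stail t.1, scons (t.1 0) t.2)
  | MRight => (scons (t.2 0) t.1, stail t.2)
  | MStay => t
  end.
Definition twrite (a : sym) (t : tape) : tape := (t.1, scons a (stail t.2)).

Lemma scons_eta (s : stream) : scons (s 0) (stail s) = s.
Proof. by apply: functional_extensionality; case. Qed.

Lemma stail_scons a s : stail (scons a s) = s.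
Proof. exact: functional_extensionality. Qed.

Lemma sapp_nth l n : sapp l blanks n = nth None l n.
Proof. by elim: l n => [|a l IH] [|n] //=. Qed.

Lemma scons_None_blanks : scons None blanks = blanks.
Proof. by apply: functional_extensionality; case. Qed.

Lemma stail_blanks : stail blanks = blanks.
Proof. exact: functional_extensionality. Qed.

Inductive prog :=
| Nop
| Mv of move
| Wr of sym
| Sq of prog & prog
| If of (sym -> bool) & prog & prog
| Wh of (sym -> bool) & prog.

(** The last index counts exactly the steps of the compiled code: a true branch pays for the test
    and for the jump over the other branch, a false branch only for the test, and a turn of a loop
    for the test and the jump back. *)
Inductive exec : prog -> tape -> tape -> nat -> Prop :=
| exec_nop t : exec Nop t t 0
| exec_mv d t : exec (Mv d) t (tmove d t) 1
| exec_wr a t : exec (Wr a) t (twrite a t) 1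
| exec_sq p q t t1 t2 n1 n2 :
    exec p t t1 n1 -> exec q t1 t2 n2 -> exec (Sq p q) t t2 (n1 + n2)
| exec_ift (c : sym -> bool) p q t t1 n :
    c (tscan t) -> exec p t t1 n -> exec (If c p q) t t1 (n + 2)
| exec_iff (c : sym -> bool) p q t t1 n :
    c (tscan t) = false -> exec q t t1 n -> exec (If c p q) t t1 (n + 1)
| exec_wht (c : sym -> bool) p t t1 t2 n1 n2 :
    c (tscan t) -> exec p t t1 n1 -> exec (Wh c p) t1 t2 n2 ->
    exec (Wh c p) t t2 (n1 + n2 + 2)
| exec_whf (c : sym -> bool) p t : c (tscan t) = false -> exec (Wh c p) t t 1.

Definition instr := sym -> nat * sym * move.

Fixpoint csize (p : prog) : nat :=
  match p with
  | Nop => 0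
  | Mv _ | Wr _ => 1
  | Sq p q => csize p + csize q
  | If _ p q => (csize p + csize q).+2
  | Wh _ p => (csize p).+2
  end.

Definition goto (n : nat) : instr := fun s => (n, s, MStay).

Fixpoint compile (p : prog) (o : nat) : seq instr :=
  match p with
  | Nop => [::]
  | Mv d => [:: fun s => (o.+1, s, d)]
  | Wr a => [:: fun=> (o.+1, a, MStay)]
  | Sq p q => compile p o ++ compile q (o + csize p)
  | If c p q =>
      (fun s => (if c s then o.+1 else o + (csize p).+2, s, MStay)) ::
      compile p o.+1 ++
      goto (o + (csize p + csize q).+2) :: compile q (o + (csize p).+2)
  | Wh c p =>
      (fun s => (if c s then o.+1 else o + (csize p).+2, s, MStay)) ::
      compile p o.+1 ++ [:: goto o]
  end.

Lemma size_compile p o : size (compile p o) = csize p.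
Proof.
elim: p o => //= [p IHp q IHq|c p IHp q IHq|c p IHp] o.
- by rewrite size_cat IHp IHq.
- by rewrite size_cat /= IHp IHq; lia.
- by rewrite size_cat /= IHp; lia.
Qed.

Definition code_at (code : seq instr) (o : nat) (c : seq instr) : Prop :=
  o + size c <= size code /\
  forall i, i < size c -> nth (goto 0) code (o + i) = nth (goto 0) c i.

Lemma code_at_cat code o c1 c2 :
  code_at code o (c1 ++ c2) ->
  code_at code o c1 /\ code_at code (o + size c1) c2.
Proof.
rewrite /code_at size_cat => -[Hs Hn]; split; split; try lia.
- by move=> i Hi; rewrite Hn ?nth_cat ?Hi //; lia.
- move=> i Hi; rewrite -addnA Hn; last lia.
  by rewrite nth_cat ltnNge leq_addr /= addKn.
Qed.

Lemma code_at_cons code o a c :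
  code_at code o (a :: c) ->
  [/\ o < size code, nth (goto 0) code o = a & code_at code o.+1 c].
Proof.
case=> /= Hs Hn; split; first lia.
- by rewrite -(addn0 o) Hn.
- split=> [|i Hi]; first lia.
  by rewrite addSnnS (Hn i.+1).
Qed.

(** The address just past the code is the halting one. Clamping jumps to it makes the program
    counters coincide with the states of [TM_of]. *)
Definition mstep (code : seq instr) (s : nat * tape) : nat * tape :=
  if s.1 < size code then
    let: (pc, a, d) := nth (goto 0) code s.1 (tscan s.2) in
    (minn pc (size code), tmove d (twrite a s.2))
  else s.

Lemma twrite_tscan t : twrite (tscan t) t = t.
Proof. by case: t => l r; rewrite /twrite /tscan /= scons_eta. Qed.

Lemma compile_correct p t t' n code o :
  exec p t t' n -> code_at code o (compile p o) ->
  iter n (mstep code) (o, t) = (o + csize p, t').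
Proof.
move=> H; elim: H o => {p t t' n}.
- by move=> t o _; rewrite addn0.
- move=> d t o /code_at_cons[Ho Hn _] /=.
  by rewrite /mstep /= Ho Hn twrite_tscan addn1 (minn_idPl _).
- move=> a t o /code_at_cons[Ho Hn _] /=.
  by rewrite /mstep /= Ho Hn addn1 (minn_idPl _).
- move=> p q t t1 t2 n1 n2 _ IH1 _ IH2 o /= /code_at_cat[H1 H2].
  rewrite addnC iterD IH1 //.
  by rewrite size_compile in H2; rewrite IH2 // addnA.
- move=> c p q t t1 n Hc _ IH o.
  move=> /code_at_cons[Ho Hn /code_at_cat[H1 /code_at_cons[Ho2 Hn2 [H3 _]]]].
  rewrite size_compile in Ho2 Hn2 H3; rewrite size_compile in H3.
  have S1 : mstep code (o, t) = (o.+1, t).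
    by rewrite /mstep /= Ho Hn Hc twrite_tscan (minn_idPl _).
  rewrite addn2 iterS iterSr S1 IH // /mstep /= Ho2 Hn2 /goto twrite_tscan.
  by congr pair; lia.
- move=> c p q t t1 n Hc _ IH o.
  move=> /code_at_cons[Ho Hn /code_at_cat[H1 /code_at_cons[Ho2 Hn2 H3]]].
  rewrite size_compile in Ho2 Hn2 H3.
  have S1 : mstep code (o, t) = (o + (csize p).+2, t).
    rewrite /mstep /= Ho Hn Hc twrite_tscan (minn_idPl _) //.
    by case: H3; rewrite size_compile; lia.
  rewrite (_ : (o.+1 + csize p).+1 = o + (csize p).+2) in H3; last lia.
  by rewrite (addn1 n) iterSr S1 IH //; congr pair; rewrite /=; lia.
- move=> c p t t1 t2 n1 n2 Hc _ IH1 _ IH2 o Hall.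
  have /code_at_cons[Ho Hn /code_at_cat[H1 /code_at_cons[Ho2 Hn2 _]]] := Hall.
  rewrite size_compile in Ho2 Hn2.
  have S1 : mstep code (o, t) = (o.+1, t).
    by rewrite /mstep /= Ho Hn Hc twrite_tscan (minn_idPl _).
  have S2 : mstep code (o.+1 + csize p, t1) = (o, t1).
    by rewrite /mstep /= Ho2 Hn2 /goto twrite_tscan (minn_idPl (ltnW Ho)).
  rewrite (_ : n1 + n2 + 2 = n2.+1 + n1.+1); last lia.
  by rewrite iterD (iterSr n1) S1 IH1 // iterSr S2 IH2.
- move=> c p t Hc o.
  move=> /code_at_cons[Ho Hn /code_at_cat[H1 /code_at_cons[Ho2 Hn2 _]]].
  rewrite size_compile in Ho2 Hn2.
  by rewrite /iter /mstep /= Ho Hn Hc twrite_tscan (minn_idPl _) //; lia.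
Qed.

Definition TM_of (code : seq instr) : TM :=
  {| nst := size code;
     delta := fun q s =>
       let: (pc, a, d) := nth (goto 0) code q s in
       (inord (minn pc (size code)), a, d);
     halting := fun q => (size code <= q)%N;
     accepting := fun=> false |}.

(** Configurations that differ only in stored trailing blanks become equal as streams, so programs
    never have to distinguish a stored blank from the end of a list. *)
Definition tape_of (M : TM) (c : config M) : tape :=
  (sapp (cleft c) blanks, sapp (chead c :: cright c) blanks).

Lemma step_mstep code (c : config (TM_of code)) :
  let c' := step c in
  (nat_of_ord (cstate c'), tape_of c') =
  mstep code (nat_of_ord (cstate c), tape_of c).
Proof.
case: c => q l h r /=; rewrite /mstep /=.
case: ltnP => //= Hq; rewrite /tscan /=.
case: (nth (goto 0) code q h) => [[pc a] d] /=.
have Hin : nat_of_ord (inord (minn pc (size code)) : 'I_(size code).+1)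
           = minn pc (size code) by rewrite inordK // ltnS geq_minr.
rewrite /twrite /tape_of /= stail_scons.
case: d => /=.
- by case: l => [|b l] /=; rewrite Hin ?stail_scons //=.
- by case: r => [|b r] /=; rewrite Hin //= !stail_scons ?stail_blanks
    ?scons_None_blanks.
- by rewrite Hin.
Qed.

Lemma run_mstep code n (c : config (TM_of code)) :
  let c' := run n c in
  (nat_of_ord (cstate c'), tape_of c') =
  iter n (mstep code) (nat_of_ord (cstate c), tape_of c).
Proof. by elim: n => //= n <-; rewrite step_mstep. Qed.

Lemma tape_of_init M x : tape_of (init M x) = (blanks, sapp (map Some x) blanks).
Proof. by case: x => [|a x] //=; rewrite /tape_of /= scons_None_blanks. Qed.

(** [out_word] stops at the first blank, hence cannot see how many trailing blanks are stored. *)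
Lemma out_word_blanks l1 l2 :
  sapp l1 blanks = sapp l2 blanks -> out_word l1 = out_word l2.
Proof.
elim: l1 l2 => [|a l1 IH] [|b l2] //= E.
- by have /= := congr1 (fun f => f 0) E; rewrite /blanks /= => <-.
- by have /= := congr1 (fun f => f 0) E; rewrite /blanks /= => ->.
- have /= ab := congr1 (fun f => f 0) E; rewrite -{}ab in E *.
  case: a E => //= a E; congr cons; apply: IH.
  by have := congr1 stail E; rewrite !stail_scons.
Qed.

Lemma out_word_Some s : out_word (map Some s) = s.
Proof. by elim: s => //= a s ->. Qed.

Definition word_tape (x : seq bool) : tape := (blanks, sapp (map Some x) blanks).

Lemma exec_poly_computable (f : seq bool -> seq bool) (p : prog) (c k : nat) :
  (forall x, exists t' n, [/\ exec p (word_tape x) t' n,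
     n <= pbound c k (size x) & t'.2 = sapp (map Some (f x)) blanks]) ->
  poly_computable f.
Proof.
move=> H; exists (TM_of (compile p 0)), c, k => x /=.
have [t' [n [He Hn Ht]]] := H x.
set cf := run _ _.
have := run_mstep (code := compile p 0) (pbound c k (size x)) (init (TM_of (compile p 0)) x).
rewrite /= -/cf tape_of_init.
have -> : nat_of_ord (cstate (init (TM_of (compile p 0)) x)) = 0 by case: (x).
rewrite -(subnK Hn) iterD (compile_correct He); last by split.
rewrite add0n; set s := (csize p, t').
(* Past the end of the code the machine idles, so the steps left over from the polynomial bound
   change nothing. *)
have -> : forall m, iter m (mstep (compile p 0)) s = s.
  by elim=> //= m ->; rewrite /mstep /s /= size_compile ltnn.
rewrite /s => -[E1 E2]; rewrite E1 size_compile leqnn; split=> //.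
rewrite /output (@out_word_blanks _ (map Some (f x))) ?out_word_Some //.
by rewrite -Ht -E2.
Qed.

(** * Executions with upper bounds on their time *)

Definition runs (p : prog) (t t' : tape) (b : nat) : Prop :=
  exists2 n, n <= b & exec p t t' n.

Lemma runs_le p t t' b b' : b <= b' -> runs p t t' b -> runs p t t' b'.
Proof. by move=> Hb [n Hn He]; exists n => //; lia. Qed.

Lemma runs_mv d t : runs (Mv d) t (tmove d t) 1.
Proof. by exists 1 => //; constructor. Qed.

Lemma runs_wr a t : runs (Wr a) t (twrite a t) 1.
Proof. by exists 1 => //; constructor. Qed.

Lemma runs_sq p q t t1 t2 b1 b2 :
  runs p t t1 b1 -> runs q t1 t2 b2 -> runs (Sq p q) t t2 (b1 + b2).
Proof.
move=> [n1 H1 E1] [n2 H2 E2]; exists (n1 + n2); first lia.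
by apply: exec_sq E1 E2.
Qed.

Lemma runs_if (c : sym -> bool) p q t t' b :
  (c (tscan t) -> runs p t t' b) -> (c (tscan t) = false -> runs q t t' b) ->
  runs (If c p q) t t' (b + 2).
Proof.
case E: (c (tscan t)) => Hp Hq.
- have [n Hn He] := Hp isT; exists (n + 2); first lia.
  exact: exec_ift.
- have [n Hn He] := Hq erefl; exists (n + 1); first lia.
  exact: exec_iff.
Qed.

Lemma runs_wh (st : nat -> tape) n (c : sym -> bool) p t t' b :
  st 0 = t -> st n = t' -> (forall j, j < n -> c (tscan (st j)) /\ runs p (st j) (st j.+1) b) ->
  c (tscan (st n)) = false ->
  runs (Wh c p) t t' (n * (b + 2) + 1).
Proof.
move=> <- <- {t t'}; elim: n st => [|n IH] st Hj Hn; first by exists 1 => //; constructor.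
have [H0 [n1 Hn1 E1]] := Hj 0 isT.
have [n2 Hn2 E2] := IH (fun j => st j.+1) (fun j => Hj j.+1) Hn.
exists (n1 + n2 + 2); last by apply: exec_wht E1 E2.
by rewrite mulSn; lia.
Qed.

Fixpoint rep (n : nat) (p : prog) : prog :=
  if n is n'.+1 then Sq p (rep n' p) else Nop.

Lemma runs_rep_mv n d t : runs (rep n (Mv d)) t (iter n (tmove d) t) n.
Proof.
elim: n t => [|n IH] t /=; first by exists 0 => //; constructor.
rewrite -iterS iterSr -(add1n n) /=.
exact: runs_sq (runs_mv _ _) (IH _).
Qed.

Lemma tmove_leftK t : tmove MRight (tmove MLeft t) = t.
Proof. by case: t => l r /=; rewrite stail_scons scons_eta. Qed.

Lemma iter_leftK n t : iter n (tmove MRight) (iter n (tmove MLeft) t) = t.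
Proof. by elim: n t => // n IH t; rewrite iterSr (iterS _ (tmove MLeft)) tmove_leftK. Qed.

Lemma tail_iter_left n t q : (iter n (tmove MLeft) t).1 q = t.1 (q + n).
Proof. by elim: n q => [|n IH] q; rewrite ?addn0 //= /stail IH addSnnS. Qed.

Lemma tscan_iter_left q t : tscan (iter q.+1 (tmove MLeft) t) = t.1 q.
Proof. by rewrite iterS /tscan /= tail_iter_left. Qed.

(** The head rests just to the right of a block, whose track [q] is the cell [q.+1] steps to the
    left. The head returns before either branch starts, so branches begin at the same place whatever
    was tested. *)
Definition IfAt (c : sym -> bool) (q : nat) (p1 p2 : prog) : prog :=
  Sq (rep q.+1 (Mv MLeft))
     (If c (Sq (rep q.+1 (Mv MRight)) p1) (Sq (rep q.+1 (Mv MRight)) p2)).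

Lemma runs_ifat (c : sym -> bool) q p1 p2 t t' b :
  (c (t.1 q) -> runs p1 t t' b) -> (c (t.1 q) = false -> runs p2 t t' b) ->
  runs (IfAt c q p1 p2) t t' (b + q.*2 + 4).
Proof.
move=> H1 H2.
apply: (@runs_le _ _ _ (q.+1 + (q.+1 + b + 2))); first lia.
apply: runs_sq (runs_rep_mv _ _ _) _.
have Hr := runs_rep_mv q.+1 MRight (iter q.+1 (tmove MLeft) t).
rewrite iter_leftK in Hr.
by apply: runs_if; rewrite tscan_iter_left => Hc; apply: runs_sq Hr _; auto.
Qed.

Definition WhAt (c : sym -> bool) (q : nat) (p : prog) : prog :=
  Sq (rep q.+1 (Mv MLeft))
     (Sq (Wh c (Sq (rep q.+1 (Mv MRight)) (Sq p (rep q.+1 (Mv MLeft)))))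
         (rep q.+1 (Mv MRight))).

Lemma runs_what (st : nat -> tape) n (c : sym -> bool) q p t t' b :
  st 0 = t -> st n = t' -> (forall j, j < n -> c ((st j).1 q) /\ runs p (st j) (st j.+1) b) ->
  c ((st n).1 q) = false ->
  runs (WhAt c q p) t t' (n * (b + q.*2 + 4) + q.*2 + 3).
Proof.
move=> <- <- {t t'} Hj Hn.
apply: (@runs_le _ _ _ (q.+1 + ((n * (q.+1 + (b + q.+1) + 2) + 1) + q.+1))); first nia.
apply: runs_sq (runs_rep_mv _ _ _) _.
have Hr s : runs (rep q.+1 (Mv MRight)) (iter q.+1 (tmove MLeft) s) s q.+1.
  by have := runs_rep_mv q.+1 MRight (iter q.+1 (tmove MLeft) s); rewrite iter_leftK.
apply: runs_sq (Hr _).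
apply: (@runs_wh (fun j => iter q.+1 (tmove MLeft) (st j))) => //.
- move=> j /Hj[H1 H2]; rewrite tscan_iter_left; split=> //.
  by apply: runs_sq (Hr _) _; apply: runs_sq H2 (runs_rep_mv _ _ _).
- by rewrite tscan_iter_left.
Qed.

(** * A bit array to the left of a blank separator *)

(* Cell [0] of the array is adjacent to the separator; [k] cells have been
   passed by the head, and [R] lies to the right of the separator. *)
Definition Z (cell : nat -> bool) (M k : nat) (R : stream) : tape :=
  (fun n => if k + n < M then Some (cell (k + n)) else None,
   fun n => if n < k then Some (cell (k - n.+1))
            else if n == k then None else R (n - k.+1)).

Definition upd (T : Type) (f : nat -> T) (i : nat) (v : T) : nat -> T :=
  fun j => if j == i then v else f j.

Lemma Z_left cell M k R : k < M -> tmove MLeft (Z cell M k R) = Z cell M k.+1 R.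
Proof.
move=> Hk; congr pair; apply: functional_extensionality => n.
- by rewrite /stail /= addnS addSn.
- case: n => [|n] /=; first by rewrite addn0 Hk subn1.
  by rewrite ltnS eqSS !subSS.
Qed.

Lemma Z_right cell M k R : k < M -> tmove MRight (Z cell M k.+1 R) = Z cell M k R.
Proof. by move=> Hk; rewrite -Z_left // tmove_leftK. Qed.

Lemma Z_ext cell cell' M k R :
  k <= M -> (forall i, i < M -> cell i = cell' i) -> Z cell M k R = Z cell' M k R.
Proof.
move=> Hk He; congr pair; apply: functional_extensionality => n.
- by case: ifP => // H; rewrite He.
- by case: ifP => // H; rewrite He //; lia.
Qed.

Lemma Z_write cell M k R v : k < M ->
  twrite (Some v) (Z cell M k.+1 R) = Z (upd cell k v) M k.+1 R.
Proof.
move=> Hk; congr pair; apply: functional_extensionality => n.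
- by rewrite /= /upd; case: ifP => // _; case: eqP => //; lia.
- case: n => [|n] /=; first by rewrite subn1 /= /upd eqxx.
  rewrite /stail /upd; case: ifP => // H; case: eqP => //; lia.
Qed.

Lemma Z_append cell M R v :
  twrite (Some v) (tmove MLeft (Z cell M M R)) = Z (upd cell M v) M.+1 M.+1 R.
Proof.
congr pair; apply: functional_extensionality => n.
- by rewrite /= /stail !ifF //; lia.
- case: n => [|n] /=; first by rewrite /upd; case: eqP => //; lia.
  rewrite /stail /= ltnS eqSS /upd; case: ifP => // H; case: eqP => //; lia.
Qed.

Lemma iter_Z_left n cell M k R : k + n <= M ->
  iter n (tmove MLeft) (Z cell M k R) = Z cell M (k + n) R.
Proof.
elim: n => [|n IH] H; first by rewrite addn0.
by rewrite iterS IH ?Z_left ?addnS //; lia.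
Qed.

Lemma iter_Z_right n cell M k R : k + n <= M ->
  iter n (tmove MRight) (Z cell M (k + n) R) = Z cell M k R.
Proof. by move=> H; rewrite -iter_Z_left // iter_leftK. Qed.

Lemma runs_Z_left n cell M k R : k + n <= M ->
  runs (rep n (Mv MLeft)) (Z cell M k R) (Z cell M (k + n) R) n.
Proof. by move=> H; rewrite -iter_Z_left //; apply: runs_rep_mv. Qed.

Lemma runs_Z_right n cell M k R : k + n <= M ->
  runs (rep n (Mv MRight)) (Z cell M (k + n) R) (Z cell M k R) n.
Proof.
move=> H; have := runs_rep_mv n MRight (Z cell M (k + n) R).
by rewrite iter_Z_right.
Qed.

Definition SetAt (q : nat) (v : bool) : prog :=
  Sq (rep q.+1 (Mv MLeft)) (Sq (Wr (Some v)) (rep q.+1 (Mv MRight))).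

Lemma runs_setat q v cell M k R : k + q < M ->
  runs (SetAt q v) (Z cell M k R) (Z (upd cell (k + q) v) M k R) (q.*2 + 3).
Proof.
move=> H; apply: (@runs_le _ _ _ (q.+1 + (1 + q.+1))); first lia.
apply: runs_sq (runs_rep_mv _ _ _) _.
rewrite iter_Z_left ?addnS //.
apply: runs_sq (runs_wr _ _) _.
by rewrite Z_write // -addnS; apply: runs_Z_right; rewrite addnS.
Qed.

Definition Home : prog := Wh isSome (Mv MRight).

Lemma runs_home cell M k R : k <= M ->
  runs Home (Z cell M k R) (Z cell M 0 R) (3 * M + 1).
Proof.
move=> Hk; apply: (@runs_le _ _ _ (k * (1 + 2) + 1)); first lia.
apply: (@runs_wh (fun j => Z cell M (k - j) R)) => [||j Hj|].
- by rewrite subn0.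
- by rewrite subnn.
- rewrite /tscan /= subn_gt0 Hj; split=> //.
  have -> : k - j = (k - j.+1).+1 by lia.
  rewrite -(@Z_right _ _ (k - j.+1)); last lia.
  exact: runs_mv.
- by rewrite subnn.
Qed.

Definition GoEnd : prog := WhAt isSome 0 (Mv MLeft).

Lemma runs_goend cell M k R : k <= M ->
  runs GoEnd (Z cell M k R) (Z cell M M R) (5 * M + 3).
Proof.
move=> Hk; apply: (@runs_le _ _ _ ((M - k) * (1 + 0.*2 + 4) + 0.*2 + 3)); first lia.
apply: (@runs_what (fun j => Z cell M (k + j) R)) => [||j Hj|].
- by rewrite addn0.
- by rewrite subnKC.
- rewrite /= addn0 ifT; last lia; split=> //.
  by rewrite addnS -Z_left; [exact: runs_mv | lia].
- by rewrite /= addn0 ifF //; lia.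
Qed.

(** The output grows to the right of the separator. Being blank, the separator stops the walk back,
    and the cost is linear in the output written so far. *)
Definition Emit1 (b : bool) : prog :=
  Sq (Mv MRight) (Sq (Wh isSome (Mv MRight)) (Sq (Wr (Some b))
    (Sq (Mv MLeft) (Wh isSome (Mv MLeft))))).

Definition bits (s : seq bool) : stream := sapp (map Some s) blanks.

Lemma bits_nth s n : bits s n = if n < size s then Some (nth false s n) else None.
Proof.
rewrite /bits sapp_nth; case: ltnP => H; first by rewrite (nth_map false).
by rewrite nth_default // size_map.
Qed.

Lemma iter_right_tail n t q : (iter n (tmove MRight) t).2 q = t.2 (q + n).
Proof. by elim: n q => [|n IH] q; rewrite ?addn0 //= /stail IH addSnnS. Qed.

Lemma left_iter_right m t n :
  n <= m -> (iter m.+1 (tmove MRight) t).1 n = t.2 (m - n).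
Proof.
elim: m n => [|m IH] n Hn; first by case: n Hn.
have U := iter_right_tail m.+1 t 0; rewrite iterS.
move: (iter m.+1 _ _) IH U => u IH U; case: n Hn => [|n] Hn /=; first by rewrite U.
by rewrite IH // subSS.
Qed.

Lemma iter_right_write n t v :
  iter n (tmove MLeft) (twrite v (iter n (tmove MRight) t)) =
  (t.1, upd t.2 n v).
Proof.
elim: n t => [|n IH] [l r].
  by congr pair; apply: functional_extensionality; case.
rewrite iterS iterSr IH /=; congr pair.
by apply: functional_extensionality; case.
Qed.

Lemma runs_emit1 b cell M s :
  runs (Emit1 b) (Z cell M 0 (bits s)) (Z cell M 0 (bits (rcons s b)))
    (6 * size s + 6).
Proof.
pose t0 := Z cell M 0 (bits s).
pose t1 := iter (size s).+1 (tmove MRight) t0.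
have E1 q : t1.2 q = bits s (q + size s).
  by rewrite iter_right_tail /t0 /= addnS /= subn1.
apply: (@runs_le _ _ _ (1 + ((size s * (1 + 2) + 1) + (1 + (1 + (size s * (1 + 2) + 1)))))).
  lia.
apply: runs_sq (runs_mv _ _) _.
apply: (runs_sq (t1 := t1)).
  rewrite /t1 iterSr.
  apply: (@runs_wh (fun j => iter j (tmove MRight) (tmove MRight t0))) => //.
  - move=> j Hj; split; last exact: runs_mv.
    by rewrite /tscan -iterSr iter_right_tail /t0 /= subn1 /= bits_nth Hj.
  - by rewrite /tscan -iterSr iter_right_tail /t0 /= subn1 /= bits_nth ltnn.
apply: runs_sq (runs_wr _ _) _.
pose t2 := twrite (Some b) t1.
have E2 : iter (size s).+1 (tmove MLeft) t2 = Z cell M 0 (bits (rcons s b)).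
  rewrite /t2 /t1 iter_right_write; congr pair; apply: functional_extensionality => n.
  rewrite /upd /=; case: n => [|n] //; rewrite eqSS /= !subn1 /= !bits_nth size_rcons nth_rcons.
  by rewrite ltnS; case: ltngtP => // _.
apply: runs_sq (runs_mv _ _) _.
have E3 j q : (iter j (tmove MLeft) (tmove MLeft t2)).2 q =
    if q < j.+1 then t2.1 (j - q) else t2.2 (q - j.+1).
  rewrite -iterSr; elim: j q => [|j IH] q.
    by case: q => [|q] //=; rewrite ?subn1 ?subn0.
  have U := tail_iter_left j.+1 t2 0; rewrite iterS.
  move: (iter j.+1 _ _) IH U => u IH U; case: q => [|q] /=; first by rewrite U.
  by rewrite IH ltnS subSS.
rewrite -E2 iterSr.
have E4 n : n <= size s -> t2.1 n = (Z cell M 0 (bits s)).2 (size s - n).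
  exact: left_iter_right.
apply: (@runs_wh (fun j => iter j (tmove MLeft) (tmove MLeft t2))) => //.
- move=> j Hj; split; last exact: runs_mv.
  rewrite /tscan E3 ltn0Sn subn0 E4 1?ltnW //.
  rewrite /= eqn0Ngt subn_gt0 Hj /= bits_nth ifT //; lia.
- rewrite /tscan E3 ltn0Sn subn0 E4 //.
  by rewrite /= subnn.
Qed.

Fixpoint EmitW (s : seq bool) : prog :=
  if s is b :: s' then Sq (Emit1 b) (EmitW s') else Nop.

Lemma runs_emitw s cell M o :
  runs (EmitW s) (Z cell M 0 (bits o)) (Z cell M 0 (bits (o ++ s)))
    (size s * (6 * (size o + size s) + 6)).
Proof.
elim: s o => [|b s IH] o /=; first by rewrite cats0; exists 0 => //; constructor.
apply: (@runs_le _ _ _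
  ((6 * size o + 6) + size s * (6 * (size (rcons o b) + size s) + 6))).
  by rewrite size_rcons mulSn addSn -addnS; lia.
by apply: runs_sq (runs_emit1 _ _ _ _) _; rewrite -cat_rcons.
Qed.

Fixpoint Append (s : seq bool) : prog :=
  if s is b :: s' then Sq (Mv MLeft) (Sq (Wr (Some b)) (Append s')) else Nop.

Lemma runs_append s cell M R :
  exists2 cell', runs (Append s) (Z cell M M R)
                   (Z cell' (M + size s) (M + size s) R) (2 * size s) &
    forall i, cell' i = if i < M then cell i else
                        if i < M + size s then nth false s (i - M) else cell i.
Proof.
elim: s cell M => [|b s IH] cell M /=.
  exists cell => [|i]; first by rewrite addn0; exists 0 => //; constructor.
  by rewrite addn0; case: ltnP.
have [cell' H1 H2] := IH (upd cell M b) M.+1.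
exists cell' => [|i].
  apply: (@runs_le _ _ _ (1 + (1 + 2 * size s))); first lia.
  apply: runs_sq (runs_mv _ _) _; apply: runs_sq (runs_wr _ _) _.
  by rewrite Z_append -addSnnS.
rewrite H2 /upd addSnnS ltnS; case: (ltngtP i M) => [H|H|->].
- by [].
- by case: ifP => // _; rewrite -(subnSK H).
- by rewrite subnn ifT //; lia.
Qed.

(** * Comprehension programs *)

(* Variables are de Bruijn levels and range over the [N] blocks of the array;
   variable [j] is stored as a single mark on track [j].  The test
   [LIf j s q] looks at track [q] in the block of variable [j], or in its
   cyclic successor when [s] holds. *)
Inductive lprog :=
| LSkip
| LEmit of seq bool
| LSeq of lprog & lprog
| LIf of nat & bool & nat & lprog & lprog
| LFor of lprog.

Fixpoint lok (d w l : nat) (p : lprog) : bool :=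
  match p with
  | LSkip | LEmit _ => true
  | LSeq p1 p2 => lok d w l p1 && lok d w l p2
  | LIf j _ q p1 p2 => [&& j < l, q < w, lok d w l p1 & lok d w l p2]
  | LFor p1 => (l < d) && lok d w l.+1 p1
  end.

Definition nxt (N : nat) (s : bool) (p : nat) : nat :=
  if s then (if p.+1 == N then 0 else p.+1) else p.
Arguments nxt : simpl never.

(** Testing a variable track compares two variables; together with the cyclic successor in [LIf],
    this expresses equality and adjacency of positions. *)
Definition trk (d : nat) (st : nat -> nat -> bool) (env : nat -> nat) (q p : nat) : bool :=
  if q < d then env q == p else st q p.

Fixpoint lsem (d N : nat) (st : nat -> nat -> bool) (l : nat) (env : nat -> nat)
    (p : lprog) : seq bool :=
  match p with
  | LSkip => [::]
  | LEmit s => s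
  | LSeq p1 p2 => lsem d N st l env p1 ++ lsem d N st l env p2
  | LIf j s q p1 p2 =>
      if trk d st env q (nxt N s (env j)) then lsem d N st l env p1
      else lsem d N st l env p2
  | LFor p1 => flatten [seq lsem d N st l.+1 (upd env l v) p1 | v <- iota 0 N]
  end.

Definition Next (w : nat) : prog := rep w (Mv MLeft).
Definition Back (w : nat) : prog := rep w (Mv MRight).
Definition Find (w q : nat) (v : bool) : prog := WhAt (pred1 (Some (~~ v))) q (Next w).

(** The mark of a variable not in scope stands on block 0, so a loop runs its body once before any
    mark is moved. After each turn the head looks at the block behind the mark; a blank there is the
    end of the array. On exit the mark goes back to block 0, which lets the same track serve later
    loops. *)
Fixpoint lcomp (w l : nat) (p : lprog) : prog :=
  match p with
  | LSkip => Nop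
  | LEmit s => EmitW s
  | LSeq p1 p2 => Sq (lcomp w l p1) (lcomp w l p2)
  | LIf j s q p1 p2 =>
      Sq (Find w j true)
     (Sq (if s then Sq (Next w) (IfAt isSome 0 Nop Home) else Nop)
         (IfAt (pred1 (Some true)) q (Sq Home (lcomp w l p1)) (Sq Home (lcomp w l p2))))
  | LFor p1 =>
      let body := Sq (lcomp w l.+1 p1) (Sq (Find w l true) (Next w)) in
      Sq body
     (Sq (WhAt isSome 0
           (Sq (Sq (Back w) (Sq (SetAt l false) (Sq (Next w) (Sq (SetAt l true) Home))))
               body))
         (Sq (Back w) (Sq (SetAt l false) (Sq Home (SetAt l true)))))
  end.

Fixpoint lcost (S N O : nat) (p : lprog) : nat :=
  match p with
  | LSkip => 0
  | LEmit s => size s * (6 * O + 6)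
  | LSeq p1 p2 => lcost S N O p1 + lcost S N O p2
  | LIf _ _ _ p1 p2 => lcost S N O p1 + lcost S N O p2 + 30 * S
  | LFor p1 => N * (lcost S N O p1 + 40 * S) + 40 * S
  end.

Lemma lfor_cost c s w n : 0 < w -> w <= s ->
  (c + (5 * s + w)) + ((n * (((w + (5 * s + (w + (5 * s + 3 * s)))) + (c + (5 * s + w)))
     + 0.*2 + 4) + 0.*2 + 3) + (w + (5 * s + (3 * s + 5 * s))))
  <= n.+1 * (c + 40 * s) + 40 * s.
Proof.
move=> w0 ws.
have : n * (((w + (5 * s + (w + (5 * s + 3 * s)))) + (c + (5 * s + w))) + 0.*2 + 4)
       <= n * (c + 40 * s) by rewrite leq_mul2l; apply/orP; right; lia.
by rewrite mulSn; lia.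
Qed.

Section Blocks.

Variables (w N : nat).
Hypothesis w_gt0 : 0 < w.
Let M := N * w.
Let S := N.+1 * w.

Lemma runs_next p cell R : p < N ->
  runs (Next w) (Z cell M (p * w) R) (Z cell M (p.+1 * w) R) w.
Proof.
by move=> Hp; rewrite mulSnr; apply: runs_Z_left; rewrite -mulSnr leq_mul2r Hp orbT.
Qed.

Lemma runs_back p cell R : p < N ->
  runs (Back w) (Z cell M (p.+1 * w) R) (Z cell M (p * w) R) w.
Proof.
by move=> Hp; rewrite mulSnr; apply: runs_Z_right; rewrite -mulSnr leq_mul2r Hp orbT.
Qed.

Lemma Z_peek cell p q R : p <= N -> q < w ->
  (Z cell M (p * w) R).1 q = if p < N then Some (cell (p * w + q)) else None.
Proof.
move=> Hp Hq /=; case: ltnP => H1; case: ltnP => H2 //; rewrite /M in H1; nia.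
Qed.

Lemma runs_find q v p0 p1 cell R : q < w -> p0 <= p1 -> p1 <= N ->
  (forall p, p0 <= p < p1 -> cell (p * w + q) = ~~ v) ->
  (p1 < N -> cell (p1 * w + q) = v) ->
  runs (Find w q v) (Z cell M (p0 * w) R) (Z cell M (p1 * w) R) (5 * S).
Proof.
move=> Hq H01 H1 Hb Hv.
apply: (@runs_le _ _ _ ((p1 - p0) * (w + q.*2 + 4) + q.*2 + 3)).
  by rewrite /S; nia.
apply: (@runs_what (fun j => Z cell M ((p0 + j) * w) R)) => [||j Hj|].
- by rewrite addn0.
- by rewrite subnKC.
- rewrite Z_peek //; last lia.
  rewrite ifT ?Hb /=; try lia; split=> //; rewrite addnS; apply: runs_next; lia.
- rewrite subnKC // Z_peek // /pred1 /=; case: ifP => // /Hv ->.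
  by case: (v).
Qed.

Lemma runs_home_block p cell R : p <= N ->
  runs Home (Z cell M (p * w) R) (Z cell M 0 R) (3 * S).
Proof.
move=> Hp; apply: (@runs_le _ _ _ (3 * M + 1)); first by rewrite /M /S; nia.
by apply: runs_home; rewrite leq_mul2r Hp orbT.
Qed.

Lemma runs_set p q v cell R : p < N -> q < w ->
  runs (SetAt q v) (Z cell M (p * w) R) (Z (upd cell (p * w + q) v) M (p * w) R) (5 * S).
Proof.
move=> Hp Hq; apply: (@runs_le _ _ _ (q.*2 + 3)); first by rewrite /S; nia.
by apply: runs_setat; rewrite /M; nia.
Qed.

Lemma block_cell_eq p q p' q' : q < w -> q' < w ->
  (p * w + q == p' * w + q') = (p == p') && (q == q').
Proof.
move=> Hq Hq'; apply/eqP/andP => [E|[/eqP-> /eqP->]] //.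
have := congr1 (fun n => n %% w) E; rewrite !modnMDl !modn_small // => Eq.
by move: E; rewrite Eq => /addIn/eqP; rewrite eqn_pmul2r // => ->; rewrite eqxx.
Qed.

Lemma block_cells (f g : nat -> bool) :
  (forall p q, p < N -> q < w -> f (p * w + q) = g (p * w + q)) ->
  forall i, i < M -> f i = g i.
Proof.
move=> H i Hi; rewrite (divn_eq i w); apply: H; last exact: ltn_pmod.
by rewrite ltn_divLR.
Qed.

Variables (d : nat) (st : nat -> nat -> bool).
Hypotheses (d_le_w : d <= w) (N_gt0 : 0 < N).

Definition cellof (env : nat -> nat) : nat -> bool :=
  fun i => trk d st env (i %% w) (i %/ w).

Lemma cellofE env p q : q < w -> cellof env (p * w + q) = trk d st env q p.
Proof. by move=> Hq; rewrite /cellof modnMDl divnMDl // modn_small // divn_small // addn0. Qed.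

Lemma lcomp_correct p l env out O :
  lok d w l p -> l <= d -> (forall j, j < l -> env j < N) -> (forall j, l <= j -> env j = 0) ->
  size out + size (lsem d N st l env p) <= O ->
  runs (lcomp w l p) (Z (cellof env) M 0 (bits out))
    (Z (cellof env) M 0 (bits (out ++ lsem d N st l env p))) (lcost S N O p).
Proof.
have S_ge : w <= S by rewrite /S; nia.
elim: p l env out => [|s|p1 IH1 p2 IH2|j s q p1 IH1 p2 IH2|p IH] l env out /=.
- by move=> *; rewrite cats0; exists 0 => //; constructor.
- move=> _ _ _ _ HO; apply: runs_le (runs_emitw _ _ _ _).
  by rewrite leq_mul2l; apply/orP; right; lia.
- rewrite size_cat => /andP[ok1 ok2] Hl He He0 HO; apply: runs_sq.
    by apply: IH1 => //; lia.
  by rewrite catA; apply: IH2 => //; rewrite size_cat; lia.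
- case/and4P=> Hj Hq ok1 ok2 Hl He He0 HO.
  have Hjd : j < d by lia.
  have Hjw : j < w by lia.
  set p0 := nxt N s (env j).
  have Hp0 : p0 < N.
    by have := He _ Hj; rewrite /p0 /nxt; case: (s) => //; case: eqP => //; lia.
  apply: (@runs_le _ _ _ (5 * S + ((w + (3 * S + 0.*2 + 4)) +
    ((3 * S + (lcost S N O p1 + lcost S N O p2)) + q.*2 + 4)))); first lia.
  have Z0 c R : Z c M 0 R = Z c M (0 * w) R by rewrite mul0n.
  apply: (runs_sq (t1 := Z (cellof env) M (env j * w) (bits out))).
    rewrite Z0; apply: runs_find => //; try lia; try exact: ltnW (He _ Hj).
      by move=> p Hp; rewrite cellofE // /trk Hjd; apply/negbTE/eqP; lia.
    by move=> _; rewrite cellofE // /trk Hjd eqxx.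
  apply: (runs_sq (t1 := Z (cellof env) M (p0 * w) (bits out))).
    rewrite /p0 /nxt; case: (s); last by exists 0 => //; constructor.
    apply: runs_sq (runs_next _ _ (He _ Hj)) _.
    (* Cyclic successor: behind the last block the head sees the blank beyond the array and goes
       home, which is block 0. *)
    apply: runs_ifat; rewrite Z_peek ?He //.
      case: ltnP => // H _; rewrite ifF; last lia.
      by exists 0 => //; constructor.
    case: ltnP => // H _; have -> : (env j).+1 = N by have := He _ Hj; lia.
    by rewrite eqxx -Z0; apply: runs_home_block.
  apply: runs_ifat; rewrite Z_peek ?Hp0 //= 1?ltnW // cellofE // => Ht.
    have {}Ht : trk d st env q p0 by case: (trk _ _ _ _ _) Ht.
    rewrite Ht in HO *; apply: runs_sq; first exact: runs_home_block (ltnW Hp0).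
    by apply: (@runs_le _ _ _ (lcost S N O p1)); [lia|apply: IH1].
  have {}Ht : trk d st env q p0 = false by case: (trk _ _ _ _ _) Ht.
  rewrite Ht in HO *; apply: runs_sq; first exact: runs_home_block (ltnW Hp0).
  by apply: (@runs_le _ _ _ (lcost S N O p2)); [lia|apply: IH2].
case/andP=> Hld ok Hl He He0 HO.
have Z0 c R : Z c M 0 R = Z c M (0 * w) R by rewrite mul0n.
pose sm v := lsem d N st l.+1 (upd env l v) p.
pose o v := out ++ flatten [seq sm v | v <- iota 0 v].
have oS v : o v.+1 = o v ++ sm v.
  by rewrite /o -addn1 iotaD map_cat flatten_cat /= cats0 catA.
pose E v := cellof (upd env l v).
have Hlw : l < w by lia.
have Hbody v : v < N -> runs (Sq (lcomp w l.+1 p) (Sq (Find w l true) (Next w)))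
    (Z (E v) M 0 (bits (o v))) (Z (E v) M (v.+1 * w) (bits (o v.+1)))
    (lcost S N O p + (5 * S + w)).
  move=> Hv; apply: (runs_sq (t1 := Z (E v) M 0 (bits (o v.+1)))).
    rewrite oS; apply: IH => //.
    - by move=> j Hj; rewrite /upd; case: eqP => // /eqP Hne; apply: He; lia.
    - by move=> j Hj; rewrite /upd; case: eqP => [?|_]; [lia|apply: He0; lia].
    (* The output after any turn is a prefix of the final one, so the bound [O] covers all turns. *)
    - apply: leq_trans HO; rewrite -[X in _ <= X]size_cat -/sm.
      rewrite -/(o N) -size_cat -/(sm v) -oS -(subnKC Hv) /o iotaD map_cat flatten_cat.
      by rewrite catA [X in _ <= X]size_cat leq_addr.
  apply: runs_sq (runs_next _ _ Hv); rewrite Z0.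
  apply: runs_find => //; try lia.
    by move=> v' Hv'; rewrite /E cellofE // /trk Hld /upd eqxx; apply/negbTE/eqP; lia.
  by move=> _; rewrite /E cellofE // /trk Hld /upd !eqxx.
have E0 : E 0 = cellof env.
  rewrite /E (_ : upd env l 0 = env) //; apply: functional_extensionality => j.
  by rewrite /upd; case: eqP => // ->; rewrite He0.
have o0 : o 0 = out by rewrite /o /= cats0.
(* The old mark is cleared before the new one is set; this order is right even when [v' = v], as
   happens on leaving a loop over a single block. *)
have clearE v : v < N -> forall v', v' < N -> forall k R, k <= M ->
  Z (upd (upd (E v) (v * w + l) false) (v' * w + l) true) M k R = Z (E v') M k R.
  move=> Hv v' Hv' k R Hk; apply: Z_ext => //; apply: block_cells => p1 q Hp1 Hq.
  rewrite /upd !block_cell_eq // /E !cellofE // /trk /upd.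
  case: (q =P l) => [->|_]; rewrite ?andbT ?andbF //.
  by rewrite Hld; case: (p1 =P v') => ?; case: (p1 =P v) => ?; lia.
apply: (@runs_le _ _ _ ((lcost S N O p + (5 * S + w)) +
  (((N.-1) * (((w + (5 * S + (w + (5 * S + 3 * S)))) + (lcost S N O p + (5 * S + w)))
     + 0.*2 + 4) + 0.*2 + 3) + (w + (5 * S + (3 * S + 5 * S)))))).
  have := @lfor_cost (lcost S N O p) S w N.-1 w_gt0 S_ge.
  by rewrite (prednK N_gt0).
apply: (runs_sq (t1 := Z (E 0) M (1 * w) (bits (o 1)))).
  by rewrite -{1}o0 -E0; apply: Hbody.
apply: (runs_sq (t1 := Z (E N.-1) M (N * w) (bits (o N)))).
  apply: (@runs_what (fun v => Z (E v) M (v.+1 * w) (bits (o v.+1)))) => [||v Hv|] //.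
  - by rewrite prednK.
  - have Hv1 : v.+1 < N by lia.
    rewrite (Z_peek _ _ (ltnW Hv1) w_gt0) Hv1; split=> //.
    apply: (runs_sq (t1 := Z (E v.+1) M 0 (bits (o v.+1)))); last exact: Hbody.
    apply: runs_sq (runs_back _ _ (ltnW Hv1)) _.
    apply: runs_sq (runs_set _ _ _ (ltnW Hv1) Hlw) _.
    apply: runs_sq (runs_next _ _ (ltnW Hv1)) _.
    apply: runs_sq (runs_set _ _ _ Hv1 Hlw) _.
    have HM : v.+1 * w <= M by rewrite leq_mul2r (ltnW Hv1) orbT.
    by rewrite (clearE _ (ltnW Hv1) _ Hv1 _ _ HM); apply: runs_home_block; apply: ltnW.
  - by rewrite prednK // Z_peek // ltnn.
have HN1 : N.-1 < N by rewrite prednK.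
have Hb := runs_back (E N.-1) (bits (o N)) HN1; rewrite (prednK N_gt0) in Hb.
apply: runs_sq Hb _.
apply: runs_sq (runs_set _ _ _ HN1 Hlw) _.
apply: runs_sq (runs_home_block _ _ (ltnW HN1)) _.
rewrite -E0 -(clearE _ HN1 0 N_gt0 0) // Z0.
exact: runs_set.
Qed.

End Blocks.

(** * Polynomial bounds *)

(** With the positive base [n.+1] exponents can be raised at will, which makes the closure under
    sums, products and composition immediate. *)
Definition polyb (f : nat -> nat) : Prop :=
  exists c k, forall n, f n <= c * n.+1 ^ k.

Lemma polyb_const c : polyb (fun=> c).
Proof. by exists c, 0 => n; rewrite muln1. Qed.

Lemma polyb_id : polyb id.
Proof. by exists 1, 1 => n; rewrite mul1n expn1. Qed.

Lemma polyb_add f g : polyb f -> polyb g -> polyb (fun n => f n + g n).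
Proof.
move=> [c1 [k1 H1]] [c2 [k2 H2]]; exists (c1 + c2), (k1 + k2) => n.
apply: leq_trans (leq_add (H1 n) (H2 n)) _; rewrite mulnDl.
by apply: leq_add; rewrite leq_mul2l leq_pexp2l ?orbT //; lia.
Qed.

Lemma polyb_mul f g : polyb f -> polyb g -> polyb (fun n => f n * g n).
Proof.
move=> [c1 [k1 H1]] [c2 [k2 H2]]; exists (c1 * c2), (k1 + k2) => n.
by apply: leq_trans (leq_mul (H1 n) (H2 n)) _; rewrite mulnACA expnD.
Qed.

Lemma polyb_comp f g : polyb f -> polyb g -> polyb (fun n => f (g n)).
Proof.
move=> [c1 [k1 H1]] [c2 [k2 H2]]; exists (c1 * c2.+1 ^ k1), (k2 * k1) => n.
apply: leq_trans (H1 _) _; rewrite -mulnA leq_mul2l; apply/orP; right.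
case: k1 {H1} => [|k1]; first by rewrite muln0.
rewrite expnM -expnMn leq_exp2r //.
have := H2 n; have : 0 < n.+1 ^ k2 by rewrite expn_gt0.
by rewrite mulSn; lia.
Qed.

Lemma polyb_le f g : (forall n, f n <= g n) -> polyb g -> polyb f.
Proof. by move=> H [c [k Hg]]; exists c, k => n; apply: leq_trans (H n) (Hg n). Qed.

Lemma polyb_exp f e : polyb f -> polyb (fun n => f n ^ e).
Proof.
move=> Hf; elim: e => [|e IH]; first exact: polyb_const 1.
by apply: (@polyb_le _ (fun n => f n * f n ^ e)) => [n|]; [rewrite expnS|exact: polyb_mul].
Qed.

Lemma polyb_pbound c k : polyb (pbound c k).
Proof.
apply: polyb_add (polyb_const c).
exact: polyb_mul (polyb_const c) (polyb_exp _ polyb_id).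
Qed.

(** For positive [n] one has [n.+1 <= 2 * n], whence the factor [2 ^ k]; the additive constant of
    [pbound] serves the case [n = 0]. *)
Lemma polyb_leq_pbound f : polyb f -> exists c k, forall n, f n <= pbound c k n.
Proof.
move=> [c [k H]]; exists (c * 2 ^ k), k => n; apply: leq_trans (H n) _.
rewrite /pbound -[X in _ + X]muln1 -mulnDr -mulnA leq_mul2l; apply/orP; right.
case: n {H} => [|n]; first by rewrite exp1n muln_gt0 expn_gt0 addn1.
rewrite mulnDr muln1; apply: leq_trans (leq_addr _ _).
case: k => // k; rewrite -expnMn leq_exp2r //; lia.
Qed.

Lemma binf_fuel f n : n <= f -> binf f n = binf n n.
Proof.
have [k] := ubnP f; elim: k f n => // k IH [|f] [|n] //= Hk Hn.
by rewrite (IH f) ?(IH n) //; lia.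
Qed.

Lemma bin_rec n : 0 < n -> bin n = odd n :: bin n./2.
Proof. by case: n => // n _; rewrite /bin /= binf_fuel //; lia. Qed.

Lemma size_bin n : size (bin n) <= n.
Proof.
elim/ltn_ind: n => -[|n] IH //; rewrite bin_rec //=.
by apply: leq_trans (IH _ _) _; lia.
Qed.

(** * Loading the input *)

(* Tracks of a block: [d] variables, then presence of an input symbol, a prefix
   of length [kap] (there are [2 ^ kap] blocks), the ones and the zeros of a
   binary numeral, a mark on block 0, a scratch flag, and the [g] bits of the
   input symbol. *)
Definition stat (d kap : nat) (ds : seq (seq bool)) (dg : seq bool) (q p : nat) : bool :=
  if q == d then p < size ds
  else if q == d.+1 then p < kap
  else if q == d.+2 then nth false dg p
  else if q == d.+3 then (p < size dg) && ~~ nth false dg p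
  else if q == d.+4 then p == 0
  else if q == d + 5 then false
  else nth false (nth [::] ds p) (q - (d + 6)).

Section Capacity.

Variable d0 : nat.

(** The logarithm of the capacity after [n] symbols: the array doubles exactly when a new symbol
    finds all blocks taken. The start value leaves room for the numeral kept in the array. *)
Fixpoint kap (n : nat) : nat :=
  if n is n'.+1 then (if n' == 2 ^ kap n' then (kap n').+1 else kap n') else d0 + 4.

Lemma kap_ge n : d0 + 4 <= kap n.
Proof. by elim: n => //= n IH; case: ifP => _; lia. Qed.

Lemma leq_exp_kap n : n <= 2 ^ kap n.
Proof. by elim: n => //= n IH; case: eqP => H; rewrite ?expnS; lia. Qed.

Lemma exp_kap_leq n : 2 ^ kap n <= 2 ^ (d0 + 4) + n.*2.
Proof. by elim: n => [|n IH] /=; [|case: eqP => H; rewrite ?expnS]; lia. Qed.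

(** A numeral is never longer than its value, so this crude bound on the value already fits the
    numeral into the blocks. It reduces to [3 * k <= 2 ^ k], true from [k = 4] on. *)
Lemma numeral_fits k : d0 + 4 <= k -> k.*2 + d0 <= 2 ^ k.
Proof.
move=> Hk; suff : 3 * k <= 2 ^ k by lia.
have : 4 <= k by lia.
elim: k {Hk} => // k IH; rewrite leq_eqVlt => /orP[/eqP<- //|Hk].
by rewrite expnS; have := IH Hk; lia.
Qed.

End Capacity.

(** * The binary counter and the doubling of the array *)

Fixpoint binc (s : seq bool) : seq bool :=
  match s with
  | [::] => [:: true]
  | false :: s' => true :: s'
  | true :: s' => false :: binc s'
  end.

(** The carry clears the leading ones and sets the first zero or a new digit; this is the form in
    which [DInc] performs it on the tape. *)
Lemma binc_find s : binc s =
  nseq (find negb s) false ++ true :: drop (find negb s).+1 s.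
Proof. by elim: s => [|[] s IH] //=; rewrite ?IH ?drop0. Qed.

Lemma binc_bin n : binc (bin n) = bin n.+1.
Proof.
elim/ltn_ind: n => -[|n] IH //; rewrite bin_rec // [RHS]bin_rec //=.
case: (boolP (odd n)) => //= Ho.
- by congr cons; congr bin; lia.
- by rewrite IH; [congr cons; congr bin; lia|lia].
Qed.

Section Prep.

Variables (d g : nat).
Let w := d + 6 + g.
Let S N := N.+1 * w.

Definition cellT (T : nat -> nat -> bool) : nat -> bool :=
  fun i => T (i %% w) (i %/ w).
Definition ZT T N p R := Z (cellT T) (N * w) (p * w) R.
Definition updT (T : nat -> nat -> bool) q p v : nat -> nat -> bool :=
  fun q' p' => if (q' == q) && (p' == p) then v else T q' p'.

Lemma w_gt0 : 0 < w. Proof. by rewrite /w; lia. Qed.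
Hint Resolve w_gt0 : core.

Lemma cellTE T p q : q < w -> cellT T (p * w + q) = T q p.
Proof. by move=> Hq; rewrite /cellT modnMDl divnMDl // modn_small // divn_small // addn0. Qed.

Lemma ZT_ext T T' N p R : p <= N ->
  (forall q p', q < w -> p' < N -> T q p' = T' q p') -> ZT T N p R = ZT T' N p R.
Proof.
move=> Hp H; apply: Z_ext; first by rewrite leq_mul2r Hp orbT.
by apply: block_cells => // p1 q Hp1 Hq; rewrite !cellTE // H.
Qed.

Lemma runs_setT T N p q v R : p < N -> q < w ->
  runs (SetAt q v) (ZT T N p R) (ZT (updT T q p v) N p R) (5 * S N).
Proof.
move=> Hp Hq; have := runs_set w_gt0 v (cellT T) R Hp Hq.
suff -> : ZT (updT T q p v) N p R = Z (upd (cellT T) (p * w + q) v) (N * w) (p * w) R by [].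
apply: Z_ext; first by rewrite leq_mul2r (ltnW Hp) orbT.
apply: block_cells => // p1 q1 Hp1 Hq1.
by rewrite /upd block_cell_eq // !cellTE // /updT andbC.
Qed.

Lemma runs_findT T N q v p0 p1 R : q < w -> p0 <= p1 -> p1 <= N ->
  (forall p, p0 <= p < p1 -> T q p = ~~ v) -> (p1 < N -> T q p1 = v) ->
  runs (Find w q v) (ZT T N p0 R) (ZT T N p1 R) (5 * S N).
Proof.
move=> Hq H01 H1 Hb Hv; apply: runs_find => // [p Hp|Hp]; rewrite cellTE //; auto.
Qed.

Lemma runs_homeT T N p R : p <= N -> runs Home (ZT T N p R) (ZT T N 0 R) (3 * S N).
Proof. by move=> Hp; apply: runs_home_block. Qed.

Lemma runs_goendT T N p R : p <= N -> runs GoEnd (ZT T N p R) (ZT T N N R) (5 * S N).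
Proof.
move=> Hp; apply: runs_le (runs_goend _ _ _); last by rewrite leq_mul2r Hp orbT.
by have := w_gt0; rewrite /S mulSn; rewrite /w; lia.
Qed.

Lemma ZT_peek T N p q R : p <= N -> q < w ->
  (ZT T N p R).1 q = if p < N then Some (T q p) else None.
Proof. by move=> Hp Hq; rewrite Z_peek // cellTE. Qed.

Lemma runs_appendT T T' N bs R : size bs = w ->
  (forall q p, q < w -> p < N -> T' q p = T q p) ->
  (forall q, q < w -> T' q N = nth false bs q) ->
  runs (Append bs) (ZT T N N R) (ZT T' N.+1 N.+1 R) (2 * w).
Proof.
move=> Hs H1 H2; have [c Hc Hcell] := runs_append bs (cellT T) (N * w) R.
rewrite Hs -mulSnr in Hc.
suff -> : ZT T' N.+1 N.+1 R = Z c (N.+1 * w) (N.+1 * w) R by [].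
apply: Z_ext => //; apply: block_cells => // p q Hp Hq; rewrite Hcell cellTE // Hs.
move: Hp; rewrite ltnS leq_eqVlt => /orP[/eqP->|Hp].
  by rewrite ltnNge leq_addr /= ltn_add2l Hq addKn H2.
by rewrite ifT ?cellTE ?H1 //; nia.
Qed.

Fixpoint SetBits (q : nat) (bs : seq bool) : prog :=
  if bs is b :: s then Sq (SetAt q b) (SetBits q.+1 s) else Nop.

Lemma runs_setbits bs T N p q R : p < N -> q + size bs <= w ->
  exists2 T', runs (SetBits q bs) (ZT T N p R) (ZT T' N p R) (size bs * (5 * S N)) &
    forall q' p', T' q' p' =
      if (p' == p) && (q <= q' < q + size bs) then nth false bs (q' - q) else T q' p'.
Proof.
move=> Hp; elim: bs T q => [|b s IH] T q /= Hq.
  exists T => [|q' p']; first by exists 0 => //; constructor.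
  by rewrite addn0 ifF // andbC; apply/andP; lia.
have [T' H1 H2] := IH (updT T q p b) q.+1 ltac:(lia).
exists T' => [|q' p'].
  by rewrite mulSn; apply: runs_sq H1; apply: runs_setT; lia.
rewrite H2 /updT addSnnS; case: (p' == p) => //=; rewrite ?andbF ?andbT //.
case: (ltngtP q q') => //= [Hlt|->].
  by case: ifP => // _; rewrite -(subnSK Hlt).
by rewrite subnn ifT //; lia.
Qed.

Definition TS kap ds dg := trk d (stat d kap ds dg) (fun=> 0).

Lemma TS_prefix kap ds dg p : TS kap ds dg d.+1 p = (p < kap).
Proof. by rewrite /TS /trk /stat; do ?case: ifP => //; lia. Qed.

Lemma TS_present kap ds dg p : TS kap ds dg d p = (p < size ds).
Proof. by rewrite /TS /trk /stat ltnn eqxx. Qed.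

Lemma TS_one kap ds dg p : TS kap ds dg d.+2 p = nth false dg p.
Proof. by rewrite /TS /trk /stat; do ?case: ifP => //; lia. Qed.

Lemma TS_zero kap ds dg p :
  TS kap ds dg d.+3 p = (p < size dg) && ~~ nth false dg p.
Proof. by rewrite /TS /trk /stat; do ?case: ifP => //; lia. Qed.

Lemma TS_flag kap ds dg p : TS kap ds dg (d + 5) p = false.
Proof. by rewrite /TS /trk /stat; do ?case: ifP => //; lia. Qed.

Definition IncK : prog := Sq (Find w d.+1 false) (Sq (SetAt d.+1 true) Home).

Lemma runs_inck kap ds dg N R : kap < N ->
  runs IncK (ZT (TS kap ds dg) N 0 R) (ZT (TS kap.+1 ds dg) N 0 R) (13 * S N).
Proof.
move=> Hk; apply: (@runs_le _ _ _ (5 * S N + (5 * S N + 3 * S N))); first lia.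
have Hq : d.+1 < w by rewrite /w; lia.
apply: (runs_sq (t1 := ZT (TS kap ds dg) N kap R)).
  apply: runs_findT => // [|p Hp|_]; rewrite ?TS_prefix; lia.
apply: runs_sq (runs_setT _ _ _ _ _) _ => //.
rewrite (@ZT_ext _ (TS kap.+1 ds dg)) => [||q p Hq1 Hp]; last first.
- rewrite /updT; case: eqP => [->|Hne] /=; rewrite ?TS_prefix; first by case: eqP; lia.
  by rewrite /TS /trk /stat; do ?case: ifP => //; lia.
- exact: ltnW.
exact: runs_homeT (ltnW Hk).
Qed.

(** Zeros have a track of their own because the numeral must end visibly: a block with neither mark
    lies beyond the last digit. A digit is therefore changed on both tracks. *)
Definition DInc : prog :=
  Sq (WhAt (pred1 (Some true)) d.+2
        (Sq (SetAt d.+2 false) (Sq (SetAt d.+3 true) (Next w))))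
     (Sq (SetAt d.+2 true) (Sq (SetAt d.+3 false) Home)).

Lemma TS_setdigit kap ds dg dg' N p b R : p < N ->
  size dg' = maxn (size dg) p.+1 -> p <= size dg ->
  (forall p', nth false dg' p' = if p' == p then b else nth false dg p') ->
  ZT (updT (updT (TS kap ds dg) d.+2 p b) d.+3 p (~~ b)) N p R =
  ZT (TS kap ds dg') N p R.
Proof.
move=> Hp Hs Hle Hn; apply: ZT_ext => [|q p1 Hq Hp1]; first exact: ltnW.
rewrite /updT; case: (q =P d.+3) => [->|H3] /=.
  rewrite !TS_zero Hs Hn (_ : d.+3 == d.+2 = false); last lia.
  case: (p1 =P p) => [->|H] /=; first by rewrite leq_max leqnn orbT.
  rewrite leq_max; case: (ltnP p1 (size dg)) => //= H1.
  by rewrite ltnS leq_eqVlt (introF eqP H) ltnNge (leq_trans Hle H1).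
case: (q =P d.+2) => [->|H2] /=; first by rewrite !TS_one Hn.
by rewrite /TS /trk /stat; do ?case: ifP => //; lia.
Qed.

Lemma runs_dinc kap ds dg N R : size (binc dg) <= N ->
  runs DInc (ZT (TS kap ds dg) N 0 R) (ZT (TS kap ds (binc dg)) N 0 R) (40 * (N.+1 * S N)).
Proof.
move=> HN; set c := find negb dg.
have Hc : c <= size dg by exact: find_size.
have HcN : c < N.
  by move: HN; rewrite binc_find size_cat size_nseq /= -/c; lia.
(* The numeral after [j] steps of the carry. *)
pose dgj j := nseq j false ++ drop j dg.
have szj j : j <= size dg -> size (dgj j) = size dg.
  by move=> Hj; rewrite size_cat size_nseq size_drop subnKC.
have nthj j p : nth false (dgj j) p = if p < j then false else nth false dg p.
  rewrite nth_cat size_nseq nth_nseq; case: ltnP => // H.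
  by rewrite nth_drop subnKC.
have Hq2 : d.+2 < w by rewrite /w; lia.
have Hq3 : d.+3 < w by rewrite /w; lia.
have Sw : w <= S N by rewrite /S; nia.
apply: (@runs_le _ _ _ ((c * ((5 * S N + (5 * S N + w)) + (d.+2).*2 + 4) + (d.+2).*2 + 3)
   + (5 * S N + (5 * S N + 3 * S N)))).
  have : c * ((5 * S N + (5 * S N + w)) + (d.+2).*2 + 4) <= N * (20 * S N).
    by apply: leq_mul; [exact: ltnW|lia].
  rewrite mulSn; have : N * (20 * S N) = 20 * (N * S N) by rewrite mulnCA.
  lia.
apply: (runs_sq (t1 := ZT (TS kap ds (dgj c)) N c R)).
  apply: (@runs_what (fun j => ZT (TS kap ds (dgj j)) N j R)) => [||j Hj|].
  - by rewrite /dgj /= drop0.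
  - by [].
  - have HjN : j < N by lia.
    have Hdj : nth false dg j by have := before_find false Hj => /negbFE.
    rewrite (ZT_peek _ _ (ltnW HjN) Hq2) HjN TS_one nthj ltnn Hdj; split=> //.
    apply: runs_sq (runs_setT _ _ _ _ _) _ => //.
    apply: runs_sq (runs_setT _ _ _ _ _) _ => //.
    rewrite (@TS_setdigit _ _ _ (dgj j.+1) _ _ false); first exact: runs_next.
    + by [].
    + rewrite !szj; lia.
    + by rewrite szj; lia.
    + by move=> p; rewrite !nthj ltnS; case: ltngtP.
  - rewrite (ZT_peek _ _ (ltnW HcN) Hq2) HcN TS_one nthj ltnn.
    move: Hc; rewrite leq_eqVlt => /orP[/eqP->|Hc]; first by rewrite nth_default.
    by have := @nth_find _ false negb dg; rewrite has_find -/c Hc => /(_ isT); case: (nth _ _ _).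
apply: runs_sq (runs_setT _ _ _ _ _) _ => //.
apply: runs_sq (runs_setT _ _ _ _ _) _ => //.
rewrite (@TS_setdigit _ _ _ (binc dg) _ _ true) //; first exact: runs_homeT (ltnW HcN).
- rewrite binc_find -/c size_cat /= size_nseq size_drop szj //; lia.
- by rewrite szj.
- move=> p; rewrite binc_find -/c nth_cat size_nseq nth_nseq nthj.
  case: ltngtP => [H|H|->]; rewrite ?subnn //.
  by rewrite -(subnSK H) /= nth_drop subnKC.
Qed.

Definition zblock : seq bool := mkseq (fun q => q == d + 5) w.

(** Each turn flags one old block and appends one new block. New blocks are born flagged, so the
    search for an unflagged block fails after exactly as many turns as there were old blocks. A last
    sweep removes all flags. *)
Definition Double : prog :=
  Sq (Find w (d + 5) false)
 (Sq (WhAt isSome 0 (Sq (SetAt (d + 5) true)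
        (Sq GoEnd (Sq (Append zblock) (Sq Home (Find w (d + 5) false))))))
 (Sq Home
 (Sq (WhAt isSome 0 (Sq (SetAt (d + 5) false) (Next w))) Home))).

Lemma TS_outside kap ds dg N q p : 0 < N -> kap <= N -> size ds <= N -> size dg <= N ->
  N <= p -> TS kap ds dg q p = false.
Proof.
move=> H0 Hk Hds Hdg Hp; rewrite /TS /trk /stat.
case: ifP => _; first by lia.
rewrite nth_default; last lia.
rewrite nth_default; last by rewrite nth_default //; lia.
by do ?case: ifP => _ //; lia.
Qed.

Lemma runs_double kap ds dg N R : 0 < N -> kap <= N -> size ds <= N -> size dg <= N ->
  runs Double (ZT (TS kap ds dg) N 0 R) (ZT (TS kap ds dg) (N + N) 0 R)
    (100 * (N.+1 * S (N + N))).
Proof.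
move=> H0 Hk Hds Hdg; set T0 := TS kap ds dg; set S2 := S (N + N).
have out q p : N <= p -> T0 q p = false by apply: TS_outside.
have fl p : T0 (d + 5) p = false by apply: TS_flag.
have Hq : d + 5 < w by rewrite /w; lia.
have Sle n : n <= N + N -> S n <= S2 by move=> Hn; rewrite /S2 /S leq_mul2r ltnS Hn orbT.
have wS : w <= S2 by rewrite /S2 /S; nia.
(* [F1 j] describes the tracks after [j] copies, [F2 j] those after [j] flags have been removed, and
   [pos j] is the first unflagged block, or the end of the array once there is none. *)
pose F1 j q p := if q == d + 5 then (p < j) || (N <= p) else T0 q p.
pose F2 j q p := if q == d + 5 then j <= p else T0 q p.
pose pos j := if j < N then j else N + N.
pose b1 := 5 * S2 + (5 * S2 + (2 * w + (3 * S2 + 5 * S2))).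
apply: (@runs_le _ _ _ (5 * S2 + ((N * (b1 + 0.*2 + 4) + 0.*2 + 3) +
  (3 * S2 + (((N + N) * ((5 * S2 + w) + 0.*2 + 4) + 0.*2 + 3) + 3 * S2))))).
  rewrite /b1 mulnDl.
  have : N * (5 * S2 + (5 * S2 + (2 * w + (3 * S2 + 5 * S2))) + 0.*2 + 4) <= N * (30 * S2).
    by rewrite leq_mul2l; apply/orP; right; lia.
  have : N * ((5 * S2 + w) + 0.*2 + 4) <= N * (15 * S2).
    by rewrite leq_mul2l; apply/orP; right; lia.
  rewrite [N * (30 * _)]mulnCA [N * (15 * _)]mulnCA mulSn; lia.
apply: (runs_sq (t1 := ZT T0 N 0 R)).
  apply: (@runs_le _ _ _ (5 * S N)); first by have := Sle N; lia.
  by apply: runs_findT => // _; rewrite fl.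
apply: (runs_sq (t1 := ZT (F1 N) (N + N) (N + N) R)).
  apply: (@runs_what (fun j => ZT (F1 j) (N + j) (pos j) R)) => [||j Hj|].
  - rewrite addn0 /pos H0; apply: ZT_ext => // q p _ Hp.
    by rewrite /F1; case: eqP => // ->; rewrite fl /=; lia.
  - by rewrite /pos ltnn.
  - have Hp : pos j = j by rewrite /pos Hj.
    have HS1 := Sle (N + j) ltac:(lia); have HS2 := Sle (N + j.+1) ltac:(lia).
    rewrite Hp ZT_peek //; last lia.
    rewrite ifT; last lia; split=> //.
    apply: (runs_sq (t1 := ZT (F1 j.+1) (N + j) j R)).
      apply: (@runs_le _ _ _ (5 * S (N + j))); first lia.
      have <- : ZT (updT (F1 j) (d + 5) j true) (N + j) j R = ZT (F1 j.+1) (N + j) j R.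
        apply: ZT_ext => [|q p _ Hp1]; first lia.
        by rewrite /updT /F1; case: (q =P d + 5) => //= _; case: (p =P j); lia.
      by apply: runs_setT; lia.
    apply: (runs_sq (t1 := ZT (F1 j.+1) (N + j) (N + j) R)).
      apply: (@runs_le _ _ _ (5 * S (N + j))); first lia.
      by apply: runs_goendT; lia.
    apply: (runs_sq (t1 := ZT (F1 j.+1) (N + j.+1) (N + j.+1) R)).
      rewrite addnS; apply: runs_appendT => //; first by rewrite size_mkseq.
      move=> q Hq1; rewrite nth_mkseq // /F1; case: eqP => // _; last by rewrite out //; lia.
      lia.
    apply: (runs_sq (t1 := ZT (F1 j.+1) (N + j.+1) 0 R)).
      apply: (@runs_le _ _ _ (3 * S (N + j.+1))); first lia.
      exact: runs_homeT.
    apply: (@runs_le _ _ _ (5 * S (N + j.+1))); first lia.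
    apply: runs_findT => //; rewrite /pos /F1 ?eqxx; case: ifP; lia.
  - by rewrite /pos ltnn ZT_peek // ltnn.
apply: (runs_sq (t1 := ZT (F2 0) (N + N) 0 R)).
  have E : ZT (F1 N) (N + N) (N + N) R = ZT (F2 0) (N + N) (N + N) R.
    by apply: ZT_ext => // q p _ Hp; rewrite /F1 /F2; case: eqP => // _; lia.
  by rewrite E; apply: runs_homeT.
apply: (runs_sq (t1 := ZT T0 (N + N) (N + N) R)); last exact: runs_homeT.
apply: (@runs_what (fun j => ZT (F2 j) (N + N) j R)) => [||j Hj|] //.
- apply: ZT_ext => // q p _ Hp; rewrite /F2; case: eqP => // ->; rewrite fl; lia.
- rewrite (ZT_peek _ _ (ltnW Hj) w_gt0) Hj; split=> //.
  apply: (runs_sq (t1 := ZT (F2 j.+1) (N + N) j R)); last exact: runs_next.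
  have <- : ZT (updT (F2 j) (d + 5) j false) (N + N) j R = ZT (F2 j.+1) (N + N) j R.
    apply: ZT_ext => [|q p _ Hp1]; first exact: ltnW.
    by rewrite /updT /F2; case: (q =P d + 5) => //= _; case: (p =P j); lia.
  exact: runs_setT.
- by rewrite ZT_peek // ltnn.
Qed.

Definition HS d0 ds R :=
  let k := kap d0 (size ds) in ZT (TS k ds (bin (k.*2 + d0))) (2 ^ k) 0 R.

Definition Place v : prog :=
  Sq (Find w d false) (Sq (SetAt d true) (Sq (SetBits (d + 6) v) Home)).

(** A failed search for a free block ends beyond the array and triggers the doubling. This raises
    [kap] by one, hence the numeral of [kap.*2 + d0] by two: two increments. *)
Definition Process v : prog :=
  Sq (Find w d false)
 (Sq (IfAt isSome 0 Home (Sq Home (Sq Double (Sq IncK (Sq DInc DInc))))) (Place v)).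

Lemma runs_place kp ds dg N v R : size ds < N -> size v = g ->
  runs (Place v) (ZT (TS kp ds dg) N 0 R) (ZT (TS kp (rcons ds v) dg) N 0 R)
    ((13 + 5 * g) * S N).
Proof.
move=> Hs Hv; have Hq : d < w by rewrite /w; lia.
apply: (@runs_le _ _ _ (5 * S N + (5 * S N + (g * (5 * S N) + 3 * S N)))).
  by rewrite mulnDl -mulnA [5 * (g * _)]mulnCA; lia.
apply: (runs_sq (t1 := ZT (TS kp ds dg) N (size ds) R)).
  apply: runs_findT => // [|p Hp|_]; rewrite ?TS_present; lia.
apply: runs_sq (runs_setT _ _ _ _ _) _ => //.
have [|T' H1 H2] := @runs_setbits v (updT (TS kp ds dg) d (size ds) true) N (size ds) (d + 6) R Hs.
  by rewrite Hv.
apply: runs_sq; first by rewrite -Hv; apply: H1.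
have -> : ZT T' N (size ds) R = ZT (TS kp (rcons ds v) dg) N (size ds) R.
  apply: ZT_ext => [|q p Hq1 Hp]; first exact: ltnW.
  rewrite /w in Hq1.
  rewrite H2 /updT Hv; case: (q =P d) => [->|Hne] /=.
    by rewrite ifF ?TS_present ?size_rcons; [case: eqP|]; lia.
  rewrite /TS /trk /stat nth_rcons; do ?case: ifP => // ?; try lia.
  by rewrite (@nth_default _ [::]) //; lia.
exact: runs_homeT (ltnW Hs).
Qed.

Definition pcost N := (600 + 5 * g) * ((N + N).+1 * S (N + N)).

Lemma runs_process d0 ds v R : size v = g ->
  runs (Process v) (HS d0 ds R) (HS d0 (rcons ds v) R) (pcost (2 ^ kap d0 (size ds))).
Proof.
move=> Hv; rewrite /HS size_rcons /=; set k := kap d0 (size ds); set N := 2 ^ k.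
have Hq : d < w by rewrite /w; lia.
have HN : size ds <= N := leq_exp_kap _ _.
have Hk := kap_ge d0 (size ds); rewrite -/k in Hk.
have HkN : k < N by apply: ltn_expl.
have fit := numeral_fits Hk; rewrite -/N in fit.
set S2 := S (N + N).
have SN : S N <= S2 by rewrite leq_mul2r ltnS leq_addr orbT.
have S2N : S2 <= (N + N).+1 * S2 by rewrite leq_pmull.
have S2N' : N.+1 * S2 <= (N + N).+1 * S2 by rewrite leq_mul2r ltnS leq_addr orbT.
have w0 : 0 < S2 by rewrite muln_gt0 w_gt0.
set big := (N + N).+1 * S2 in S2N S2N' *.
apply: (@runs_le _ _ _ (5 * S N + (((3 * S N + 500 * big) + 0.*2 + 4) + (13 + 5 * g) * S2))).
  have : (13 + 5 * g) * S2 <= (13 + 5 * g) * big by rewrite leq_mul2l S2N orbT.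
  by rewrite /pcost -/S2 -/big !mulnDl; lia.
apply: (runs_sq (t1 := ZT (TS k ds (bin (k.*2 + d0))) N (size ds) R)).
  by apply: runs_findT => // [p Hp|_]; rewrite ?TS_present; lia.
have [Hfull|Hnf] := eqVneq (size ds) N.
- apply: (runs_sq (t1 := ZT (TS k.+1 ds (bin (k.+1.*2 + d0))) (N + N) 0 R)).
  + apply: runs_ifat; rewrite ZT_peek // Hfull ltnn // => _.
    apply: runs_sq; first exact: runs_homeT.
    apply: (@runs_le _ _ _ (100 * (N.+1 * S2) + (13 * S2 + (40 * big + 40 * big)))); first lia.
    apply: (runs_sq (t1 := ZT (TS k ds (bin (k.*2 + d0))) (N + N) 0 R)).
      apply: runs_double; try lia.
      by apply: leq_trans (size_bin _) _.
    apply: (runs_sq (t1 := ZT (TS k.+1 ds (bin (k.*2 + d0))) (N + N) 0 R)).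
      by apply: runs_inck; lia.
    have Hd n : n <= k.*2 + d0 + 1 -> runs DInc (ZT (TS k.+1 ds (bin n)) (N + N) 0 R)
        (ZT (TS k.+1 ds (bin n.+1)) (N + N) 0 R) (40 * big).
      move=> Hn; rewrite -binc_bin; apply: runs_dinc; rewrite binc_bin.
      by apply: leq_trans (size_bin _) _; lia.
    by apply: runs_sq (Hd _ _) _; first lia; rewrite doubleS !addSn; apply: Hd; lia.
  + rewrite expnS mul2n -(addnn N); have Hlt : size ds < N + N by lia.
    exact: runs_place Hlt Hv.
- have Hlt : size ds < N by rewrite ltn_neqAle Hnf.
  apply: (runs_sq (t1 := ZT (TS k ds (bin (k.*2 + d0))) N 0 R)).
    apply: runs_ifat; rewrite (ZT_peek _ _ HN w_gt0) Hlt // => _.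
    by apply: (@runs_le _ _ _ (3 * S N)); [lia|apply: runs_homeT].
  apply: (@runs_le _ _ _ ((13 + 5 * g) * S N)); first by rewrite leq_mul2l SN orbT.
  exact: runs_place.
Qed.

End Prep.

(** * Reading and erasing the input *)

Definition gap (a : nat) (s : seq bool) : stream := sapp (nseq a None) (bits s).

Lemma gap_nth a s n : gap a s n = if n < a then None else bits s (n - a).
Proof.
elim: a n => [|a IH] n; first by rewrite subn0.
by case: n => [|n] //; rewrite ltnS subSS -IH.
Qed.

Lemma gap_nil a : gap a [::] = bits [::].
Proof.
by apply: functional_extensionality => n; rewrite gap_nth !bits_nth /=; case: ifP.
Qed.

Lemma gap_erase a b s : upd (gap a (b :: s)) a None = gap a.+1 s.
Proof.
apply: functional_extensionality => n; rewrite /upd !gap_nth !bits_nth [n < a.+1]ltnS.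
by case: ltngtP => // H; rewrite -(subnSK H) /= ltnS.
Qed.

Lemma write_iter_right n t v :
  twrite v (iter n (tmove MRight) t) = iter n (tmove MRight) (t.1, upd t.2 n v).
Proof.
elim: n t => [|n IH] [l r].
  by congr pair; apply: functional_extensionality; case.
rewrite iterSr IH iterSr; congr iter; congr pair.
Qed.

Lemma Z_upd_right cell M R a v :
  ((Z cell M 0 R).1, upd (Z cell M 0 R).2 a.+1 v) = Z cell M 0 (upd R a v).
Proof.
congr pair; apply: functional_extensionality => -[|n] //.
by rewrite /upd /= eqSS !subn1.
Qed.

Definition GoRaw : prog := Sq (Mv MRight) (Wh (negb \o isSome) (Mv MRight)).
(** The erased cells and the separator are equally blank, so the head walks on to the nearest array
    cell and steps back; this is where the array must be nonempty. *)
Definition GoHome : prog :=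
  Sq (Mv MLeft) (Sq (Wh (negb \o isSome) (Mv MLeft)) (Mv MRight)).

Lemma scan_gap cell M a s j :
  tscan (iter j (tmove MRight) (Z cell M 0 (gap a s))) =
  if j <= a then None else bits s (j - a.+1).
Proof.
rewrite /tscan iter_right_tail /=; case: j => // j.
by rewrite /= subn1 /= gap_nth subSS.
Qed.

Lemma runs_goraw cell M a b s :
  runs GoRaw (Z cell M 0 (gap a (b :: s)))
    (iter a.+1 (tmove MRight) (Z cell M 0 (gap a (b :: s)))) (3 * a + 2).
Proof.
apply: (@runs_le _ _ _ (1 + (a * (1 + 2) + 1))); first lia.
apply: runs_sq (runs_mv _ _) _.
apply: (@runs_wh (fun j => iter j.+1 (tmove MRight) (Z cell M 0 (gap a (b :: s))))) => //.
- by move=> j Hj; rewrite scan_gap Hj; split=> //; apply: runs_mv.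
- by rewrite scan_gap ltnn subnn bits_nth.
Qed.

Lemma runs_gohome cell M a s : 0 < M ->
  runs GoHome (iter a.+1 (tmove MRight) (Z cell M 0 (gap a s)))
    (Z cell M 0 (gap a s)) (3 * a + 6).
Proof.
move=> HM; set X := Z cell M 0 (gap a s).
have leftR t : tmove MLeft (tmove MRight t) = t.
  by case: t => l r /=; rewrite stail_scons scons_eta.
apply: (@runs_le _ _ _ (1 + ((a.+1 * (1 + 2) + 1) + 1))); first lia.
apply: runs_sq (runs_mv _ _) _; rewrite iterS leftR.
apply: (runs_sq (t1 := Z cell M 1 (gap a s))); last first.
  by rewrite -[X in runs _ _ X](@Z_right cell M 0) //; apply: runs_mv.
apply: (@runs_wh (fun j => if j <= a then iter (a - j) (tmove MRight) X
                           else Z cell M 1 (gap a s))) => [||j|].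
- by rewrite subn0.
- by rewrite ltnn.
- rewrite ltnS => Hj; rewrite Hj; split.
    by rewrite scan_gap /= leq_subr.
  case: ltnP => Hj2.
    rewrite -(subnSK Hj2) iterS; set u := iter _ _ X.
    by have := runs_mv MLeft (tmove MRight u); rewrite leftR.
  have -> : a - j = 0 by lia.
  by rewrite /= -Z_left //; apply: runs_mv.
- by rewrite ltnn.
Qed.

Section Loading.

Variables (d g d0 : nat).
Hypothesis g_gt0 : 0 < g.
Let w := d + 6 + g.

(** Whether more input follows is tested before going home: with no symbol left, [GoRaw] would never
    stop. After the last symbol the head stays on the blank separator, which ends the loading
    loop. *)
Definition Store v : prog :=
  If isSome (Sq GoHome (Sq (Process d g v) GoRaw)) (Sq GoHome (Process d g v)).

(** The bits of a symbol are remembered in the control: the program branches on each bit, and every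
    leaf has its own constant [acc] to store. *)
Fixpoint Read (n : nat) (acc : seq bool) : prog :=
  if n is n'.+1 then
    If (pred1 (Some true))
      (Sq (Wr None) (Sq (Mv MRight) (Read n' (rcons acc true))))
      (Sq (Wr None) (Sq (Mv MRight) (Read n' (rcons acc false))))
  else Store acc.

Lemma runs_read bs acc a s cell M t b :
  runs (Store (acc ++ bs))
    (iter (a + size bs).+1 (tmove MRight) (Z cell M 0 (gap (a + size bs) s))) t b ->
  runs (Read (size bs) acc)
    (iter a.+1 (tmove MRight) (Z cell M 0 (gap a (bs ++ s)))) t (b + 4 * size bs).
Proof.
elim: bs acc a => [|c bs IH] acc a H; first by rewrite cats0 !addn0 in H *.
rewrite cat_cons.
apply: (@runs_le _ _ _ ((1 + (1 + (b + 4 * size bs))) + 2)); first by rewrite [size (_ :: _)]/=; lia.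
have E : runs (Sq (Wr None) (Sq (Mv MRight) (Read (size bs) (rcons acc c))))
   (iter a.+1 (tmove MRight) (Z cell M 0 (gap a (c :: bs ++ s)))) t
   (1 + (1 + (b + 4 * size bs))).
  apply: runs_sq (runs_wr _ _) _; apply: runs_sq (runs_mv _ _) _.
  rewrite write_iter_right Z_upd_right gap_erase.
  by rewrite -iterS; apply: (IH (rcons acc c) a.+1); rewrite cat_rcons addSnnS.
by apply: runs_if; rewrite scan_gap ltnn subnn bits_nth; case: (c) E.
Qed.

Definition Tinit := TS d (d0 + 4) [::] (bin ((d0 + 4).*2 + d0)).

Definition LoadInput : prog :=
  Sq (Mv MLeft) (Sq (Append (mkseq (cellT d g Tinit) (2 ^ (d0 + 4) * w)))
 (Sq Home (Sq (Mv MRight) (If isSome (Wh isSome (Read g [::])) (Mv MLeft))))).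

Definition loadcost n :=
  20 + 10 * (2 ^ (d0 + 4) * w) +
  n * (pcost d g (2 ^ (d0 + 4) + n.*2) + 6 * (g * n.+1) + 4 * g + 20).

Lemma pcost_mono N N' : N <= N' -> pcost d g N <= pcost d g N'.
Proof.
move=> H; rewrite /pcost leq_mul2l; apply/orP; right.
by apply: leq_mul; [lia|rewrite leq_mul2r; apply/orP; right; lia].
Qed.

Lemma HS_Z ds : exists c M, 0 < M /\ forall R, HS d g d0 ds R = Z c M 0 R.
Proof.
rewrite /HS /ZT; set T := TS _ _ _ _; exists (cellT d g T), (2 ^ kap d0 (size ds) * (d + 6 + g)).
by rewrite muln_gt0 expn_gt0 /=; split; first by lia.
Qed.

Lemma runs_load ds : all (fun v => size v == g) ds ->
  runs LoadInput (word_tape (flatten ds)) (HS d g d0 ds (bits [::])) (loadcost (size ds)).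
Proof.
move=> Hall; set n := size ds.
pose raw j := flatten (drop j ds).
pose home j := HS d g d0 (take j ds) (gap (g * j) (raw j)).
have szd j v : j < n -> v = nth [::] ds j -> size v = g.
  by move=> Hj ->; apply/eqP; apply: (allP Hall); apply: mem_nth.
apply: (@runs_le _ _ _ (1 + (2 * (2 ^ (d0 + 4) * w) + ((3 * (2 ^ (d0 + 4) * w) + 1) + (1 +
   ((n * ((pcost d g (2 ^ (d0 + 4) + n.*2) + 6 * (g * n.+1) + 4 * g + 18) + 2) + 1) + 2)))))).
  by rewrite /loadcost -/n; lia.
apply: runs_sq (runs_mv _ _) _.
have -> : tmove MLeft (word_tape (flatten ds)) = Z (fun=> false) 0 0 (bits (flatten ds)).
  congr pair.
  by apply: functional_extensionality => -[|k] //=; rewrite subn1.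
have [c Hc Hcell] := runs_append (mkseq (cellT d g Tinit) (2 ^ (d0 + 4) * w)) (fun=> false) 0
   (bits (flatten ds)).
rewrite size_mkseq add0n in Hc; apply: runs_sq Hc _.
apply: runs_sq; first exact: runs_home.
have home0 : Z c (2 ^ (d0 + 4) * w) 0 (bits (flatten ds)) = home 0.
  rewrite /home take0 muln0 /raw drop0 /HS /= /ZT -/Tinit; apply: Z_ext => // i Hi.
  by rewrite Hcell /= add0n size_mkseq Hi subn0 nth_mkseq.
rewrite home0; apply: runs_sq (runs_mv _ _) _.
have rawS j : j < n -> raw j = nth [::] ds j ++ raw j.+1.
  by move=> Hj; rewrite /raw (drop_nth [::] Hj).
have rawne j : j < n -> exists b s, raw j = b :: s.
  move=> Hj; rewrite (rawS _ Hj); have := szd _ _ Hj erefl.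
  by case: (nth _ _ _) => [|b s] /=; [lia|exists b, (s ++ raw j.+1)].
pose fin := HS d g d0 ds (bits [::]).
have homen : home n = fin by rewrite /home take_size /raw drop_size gap_nil.
pose st j := if j < n then iter (g * j).+1 (tmove MRight) (home j) else fin.
have finh : tscan fin = None by have [c' [M' [_ E]]] := HS_Z ds; rewrite /fin E.
have [n0|n_gt0] := posnP n.
  apply: runs_if.
    have [c' [M' [_ E]]] := HS_Z (take 0 ds).
    rewrite /home E /raw; have -> : drop 0 ds = [::] by apply: size0nil; rewrite size_drop; lia.
    by rewrite gap_nil.
  move=> _; apply: (@runs_le _ _ _ 1); first lia.
  rewrite -/fin -homen n0.
  have := runs_mv MLeft (tmove MRight (home 0)).
  by case: (home 0) => l r /=; rewrite stail_scons scons_eta.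
have scanst j : j < n -> isSome (tscan (st j)).
  move=> Hj; rewrite /st Hj; have [c' [M' [_ E]]] := HS_Z (take j ds).
  by rewrite /home E scan_gap ltnn subnn; have [b [s ->]] := rawne _ Hj; rewrite bits_nth.
have st0 : st 0 = tmove MRight (home 0) by rewrite /st n_gt0 muln0.
apply: runs_if; rewrite -st0; last by rewrite scanst.
move=> _; apply: (@runs_wh st) => [||j Hj|] //.
- by rewrite /st ltnn.
- split; first exact: scanst.
  have Hv := szd _ _ Hj erefl; set v := nth [::] ds j in Hv.
  have [c1 [M1 [HM1 E1]]] := HS_Z (take j ds).
  have [c2 [M2 [HM2 E2]]] := HS_Z (take j.+1 ds).
  have szj : size (take j ds) = j by rewrite size_takel // ltnW.
  rewrite {1}/st Hj /home E1 (rawS _ Hj) -/v.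
  pose bp := pcost d g (2 ^ (d0 + 4) + n.*2).
  have Hg1 : g * j.+1 <= g * n by rewrite leq_mul2l Hj orbT.
  have Hg2 : g * n.+1 = g * n + g by rewrite mulnSr.
  apply: (@runs_le _ _ _ ((((3 * (g * j.+1) + 6) + (bp + (3 * (g * j.+1) + 2))) + 2) + 4 * size v)).
    by rewrite Hv /bp; lia.
  rewrite -{1}Hv; apply: runs_read; rewrite Hv -mulnSr cat0s.
  have Hproc : runs (Process d g v) (Z c1 M1 0 (gap (g * j.+1) (raw j.+1)))
      (home j.+1) bp.
    rewrite -E1 /home (take_nth [::] Hj) -/v.
    apply: (@runs_le _ _ _ (pcost d g (2 ^ kap d0 (size (take j ds))))); last exact: runs_process.
    apply: pcost_mono; apply: leq_trans (exp_kap_leq _ _) _; rewrite szj.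
    by rewrite leq_add2l leq_double ltnW.
  apply: runs_if; rewrite scan_gap ltnn subnn.
    move=> Hsome; have Hj2 : j.+1 < n.
      case: (ltngtP j.+1 n) Hj => // Ej _; move: Hsome.
      by rewrite Ej /raw drop_size bits_nth.
    apply: runs_sq; first exact: runs_gohome.
    apply: runs_sq Hproc _; have [b [s Es]] := rawne _ Hj2.
    by rewrite /st Hj2 /home E2 Es; apply: runs_goraw.
  move=> Hnone; have Ej : j.+1 = n.
    case: (ltngtP j.+1 n) Hj => // Hj2 _; have [b [s Es]] := rawne _ Hj2.
    by move: Hnone; rewrite Es bits_nth.
  apply: runs_sq; first exact: runs_gohome.
  apply: (@runs_le _ _ _ bp); first lia.
  by rewrite /st Ej ltnn -homen -Ej.
- by rewrite /st ltnn finh.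
Qed.

End Loading.

(** Erasing the array leaves precisely a word tape, so passes can be chained. The walk to the output
    stops at its first symbol, which is why passes are required to have nonempty output. *)
Definition Clean : prog :=
  Sq (Mv MLeft) (Sq (Wh isSome (Sq (Wr None) (Mv MLeft))) (Wh (negb \o isSome) (Mv MRight))).

Lemma runs_clean cell M b s :
  runs Clean (Z cell M 0 (bits (b :: s))) (word_tape (b :: s)) (7 * M + 9).
Proof.
set R := bits (b :: s).
pose Y j : tape := (fun n => if j + n < M then Some (cell (j + n)) else None,
                    fun n => if n <= j then None else R (n - j.+1)).
apply: (@runs_le _ _ _ (1 + ((M * (2 + 2) + 1) + (M.+2 * (1 + 2) + 1)))); first lia.
have -> : Z cell M 0 R = Y 0.
  by congr pair; apply: functional_extensionality => -[|n].
apply: runs_sq (runs_mv _ _) _.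
apply: (runs_sq (t1 := tmove MLeft (Y M))).
  apply: (@runs_wh (fun j => tmove MLeft (Y j))) => // [j Hj|].
    split; first by rewrite /tscan /= addn0 Hj.
    apply: (runs_sq (b1 := 1) (b2 := 1)); first exact: runs_wr.
    have -> : twrite None (tmove MLeft (Y j)) = Y j.+1.
      congr pair; apply: functional_extensionality => n.
        by rewrite /= /stail addnS addSn.
      by case: n => [|n] //=; rewrite /stail /= ltnS subSS.
    exact: runs_mv.
  by rewrite /tscan /= addn0 ltnn.
have head j : (tmove MLeft (Y M)).2 j = if j < M.+2 then None else R (j - M.+2).
  case: j => [|j] /=; first by rewrite addn0 ltnn.
  by rewrite !ltnS subSS.
apply: (@runs_wh (fun j => iter j (tmove MRight) (tmove MLeft (Y M)))) => //.
- rewrite [LHS]surjective_pairing; congr pair; apply: functional_extensionality => n; last first.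
    by rewrite iter_right_tail head ltnNge leq_addl /= addnK.
  have [Hn|Hn] := leqP n M.+1; first by rewrite left_iter_right // head ifT //; lia.
  have out k t m : (iter k (tmove MRight) t).1 (m + k) = t.1 m.
    by elim: k m => [|k IH] m; rewrite ?addn0 // addnS /= IH.
  by rewrite -(subnK Hn) out /stail /= /stail /= ifF //; lia.
- move=> j Hj; split; last exact: runs_mv.
  by rewrite /tscan iter_right_tail head add0n Hj.
- by rewrite /tscan iter_right_tail head add0n ltnn subnn /R bits_nth.
Qed.

Lemma lcost_polyb p f h o : polyb f -> polyb h -> polyb o ->
  polyb (fun n => lcost (f n) (h n) (o n) p).
Proof.
move=> Hf Hh Ho; elim: p => [|s|p1 IH1 p2 IH2|j s q p1 IH1 p2 IH2|p IH] /=.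
- exact: polyb_const.
- apply: polyb_mul (polyb_const _) _; apply: polyb_add (polyb_const _).
  exact: polyb_mul (polyb_const _) Ho.
- exact: polyb_add.
- by apply: polyb_add (polyb_add IH1 IH2) _; apply: polyb_mul (polyb_const _) Hf.
- have H40 := polyb_mul (polyb_const 40) Hf.
  exact: polyb_add (polyb_mul Hh (polyb_add IH H40)) H40.
Qed.

Lemma lcost_mono p f f' h h' o o' : f <= f' -> h <= h' -> o <= o' ->
  lcost f h o p <= lcost f' h' o' p.
Proof.
move=> Hf Hh Ho; elim: p => [|s|p1 IH1 p2 IH2|j s q p1 IH1 p2 IH2|p IH] //=; try lia.
- by rewrite leq_mul2l; apply/orP; right; lia.
- by apply: leq_add; [apply: leq_mul; lia|lia].
Qed.

Definition Transducer d g d0 p : prog :=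
  Sq (LoadInput d g d0) (Sq (lcomp (d + 6 + g) 0 p) Clean).

Definition transduced d d0 p ds : seq bool :=
  let k := kap d0 (size ds) in
  lsem d (2 ^ k) (stat d k ds (bin (k.*2 + d0))) 0 (fun=> 0) p.

(** Every emitted bit costs a walk along the output, so the time is bounded in terms of the lengths
    of input and output together. *)
Lemma runs_transducer d g d0 p : 0 < g -> lok d (d + 6 + g) 0 p ->
  exists2 f, polyb f & forall ds, all (fun v => size v == g) ds ->
    transduced d d0 p ds != [::] ->
    runs (Transducer d g d0 p) (word_tape (flatten ds)) (word_tape (transduced d d0 p ds))
      (f (size ds + size (transduced d d0 p ds))).
Proof.
move=> Hg Hok; set w := d + 6 + g.
pose NN n := 2 ^ (d0 + 4) + n.*2.
exists (fun n => loadcost d g d0 n + (lcost ((NN n).+1 * w) (NN n) n p + (7 * (NN n * w) + 9))).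
  have p2 : polyb (fun n => n.*2).
    apply: (@polyb_le _ (fun n => 2 * n)) => [n|]; first by rewrite mul2n.
    exact: polyb_mul (polyb_const _) polyb_id.
  have pNN : polyb NN := polyb_add (polyb_const _) p2.
  have pS f : polyb f -> polyb (fun n => (f n).+1).
    move=> Hf; apply: (@polyb_le _ (fun n => f n + 1)) => [n|]; first by rewrite addn1.
    exact: polyb_add Hf (polyb_const _).
  have pM f c : polyb f -> polyb (fun n => f n * c) by move=> Hf; apply: polyb_mul Hf (polyb_const _).
  have pM' f c : polyb f -> polyb (fun n => c * f n) by move=> Hf; apply: polyb_mul (polyb_const _) Hf.
  apply: polyb_add; last first.
    apply: polyb_add; last by apply: polyb_add (polyb_const _); apply/pM'/pM.
    by apply: lcost_polyb => //; [apply/pM/pS|exact: polyb_id].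
  apply: polyb_add (polyb_const _) _; apply: polyb_mul polyb_id _.
  apply: polyb_add (polyb_const _); apply: polyb_add (polyb_const _).
  apply: polyb_add; last by apply/pM'/pM'/pS/polyb_id.
  have pNN2 := polyb_add pNN pNN.
  by apply/pM'/polyb_mul; [apply: pS|apply/pM/pS].
move=> ds Hall; set out := transduced d d0 p ds => Hne; set n := size ds.
set k := kap d0 n; set X := n + size out.
have Hn : n <= X by rewrite leq_addr.
have HkN : 2 ^ k <= NN X.
  by apply: leq_trans (exp_kap_leq _ _) _; rewrite leq_add2l leq_double.
apply: runs_sq.
  apply: (runs_le _ (@runs_load d g d0 Hg ds Hall)).
  rewrite /loadcost leq_add2l; apply: leq_mul => //; rewrite !leq_add2r.
  apply: leq_add; last by rewrite !leq_mul2l ltnS Hn !orbT.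
  by apply: pcost_mono; lia.
pose c := cellof w d (stat d k ds (bin (k.*2 + d0))) (fun=> 0).
apply: (runs_sq (t1 := Z c (2 ^ k * w) 0 (bits out))).
  have w_gt0 : 0 < w by rewrite /w; lia.
  have dw : d <= w by rewrite /w; lia.
  have N0 : 0 < 2 ^ k by rewrite expn_gt0.
  have L : runs (lcomp w 0 p) (Z c (2 ^ k * w) 0 (bits [::])) (Z c (2 ^ k * w) 0 (bits out))
      (lcost ((2 ^ k).+1 * w) (2 ^ k) X p).
    have := @lcomp_correct w (2 ^ k) w_gt0 d (stat d k ds (bin (k.*2 + d0))) dw N0 p 0
      (fun=> 0) [::] X Hok isT (fun j (H : j < 0) => N0) (fun _ _ => erefl).
    by apply; rewrite add0n leq_addl.
  have -> : HS d g d0 ds (bits [::]) = Z c (2 ^ k * w) 0 (bits [::]) by [].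
  apply: (runs_le _ L); apply: lcost_mono => //.
  by rewrite leq_mul2r ltnS HkN orbT.
apply: (@runs_le _ _ _ (7 * (2 ^ k * w) + 9)).
  by rewrite leq_add2r leq_mul2l leq_mul2r HkN !orbT.
by move: Hne; rewrite -/out; case: (out) => // b s _; apply: runs_clean.
Qed.

(** * Tournaments as lists *)

Definition maxs (s : seq nat) : nat := \max_(x <- s) x.

Lemma maxs_cat s1 s2 : maxs (s1 ++ s2) = maxn (maxs s1) (maxs s2).
Proof. by rewrite /maxs big_cat. Qed.

Lemma maxs_mem s : s != [::] -> maxs s \in s.
Proof.
elim: s => // a [|b s] IH _; first by rewrite /maxs big_seq1 mem_head.
rewrite /maxs big_cons -/(maxs (b :: s)) inE; case: leqP => H; last by rewrite eqxx.
by rewrite IH ?orbT.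
Qed.

Section Log.

Variable sc : nat -> nat -> nat -> bool.

(** The scoring games of the bracket whose players, in seed order, are [s]. Recursing on halves,
    unlike summing by rounds, suits inductions over sub-brackets. *)
Fixpoint glog (r : nat) (s : seq nat) : seq (nat * nat * nat) :=
  if r is r'.+1 then
    let s1 := take (2 ^ r') s in let s2 := drop (2 ^ r') s in
    glog r' s1 ++ glog r' s2 ++
    (if sc (maxs s1) (maxs s2) r then [:: (maxs s1, maxs s2, r)] else [::])
  else [::].

Definition slice (p : seq nat) r k := take (2 ^ r) (drop (k * 2 ^ r) p).

Lemma slice_split p r k :
  take (2 ^ r) (slice p r.+1 k) = slice p r k.*2 /\
  drop (2 ^ r) (slice p r.+1 k) = slice p r k.*2.+1.
Proof.
have E1 : k * 2 ^ r.+1 = k.*2 * 2 ^ r by rewrite expnS -mul2n; lia.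
have E2 : 2 ^ r.+1 = 2 ^ r + 2 ^ r by rewrite expnS; lia.
split; first by rewrite /slice E1 E2 take_takel // leq_addr.
by rewrite /slice E1 E2 -take_drop drop_drop -mulSn.
Qed.

Lemma sum_pairs (F : nat -> nat) n :
  \sum_(0 <= k < n.*2) F k = \sum_(0 <= k < n) (F k.*2 + F k.*2.+1).
Proof.
elim: n => [|n IH]; first by rewrite !big_geq.
by rewrite doubleS !big_nat_recr //= IH !addnA.
Qed.

Variables (I : tvm_instance) (sigma : nat -> nat) (p : seq nat).
Hypothesis gvalE : forall a b r, gval I a b r = Posz (sc a b r).
Hypothesis size_p : size (players I) = 2 ^ nexp I.
Hypothesis playerE : forall k, k < 2 ^ nexp I -> player_at I sigma k.+1 = nth 0 p k.
Hypothesis size_p' : size p = 2 ^ nexp I.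

Lemma block_winnerE r k : k.+1 * 2 ^ r <= 2 ^ nexp I ->
  block_winner I sigma r k.+1 = maxs (slice p r k).
Proof.
elim: r k => [|r IH] k Hk.
  rewrite /= playerE; last by rewrite muln1 in Hk.
  rewrite /slice expn0 muln1 (drop_nth 0) /=; last by rewrite size_p'; lia.
  by rewrite take0 /maxs big_seq1.
have Hk2 : k.*2.+2 * 2 ^ r <= 2 ^ nexp I by move: Hk; rewrite expnS; lia.
rewrite /= (_ : 2 * k.+1 - 1 = k.*2.+1); last lia.
rewrite (_ : 2 * k.+1 = k.*2.+2); last lia.
rewrite !IH //; last by apply: leq_trans Hk2; rewrite leq_mul2r ltnS leqnSn orbT.
have [<- <-] := slice_split p r k.
by rewrite -maxs_cat cat_take_drop.
Qed.

(** The value is defined round by round, the log bracket by bracket; the two agree level by level,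
    since round [R.+1] merges the blocks of level [R] in pairs. *)
Lemma tournament_value_partial R : R <= nexp I ->
  (\sum_(1 <= r < R.+1) \sum_(1 <= k < (2 ^ nexp I %/ 2 ^ r).+1)
     sc (block_winner I sigma r.-1 (2 * k - 1)) (block_winner I sigma r.-1 (2 * k)) r)%N
  = (\sum_(0 <= k < 2 ^ (nexp I - R)) size (glog R (slice p R k)))%N.
Proof.
elim: R => [|R IH] HR; first by rewrite big_geq // big1.
rewrite big_nat_recr //= IH 1?ltnW //.
have E : 2 ^ (nexp I - R) = (2 ^ (nexp I - R.+1)).*2.
  by rewrite -mul2n -expnS -subSn // subSS.
rewrite E sum_pairs -expnB // big_add1 /= -big_split /=.
apply: eq_big_nat => k /= Hk.
have [-> ->] := slice_split p R k.
rewrite !size_cat -addnA; congr (_ + (_ + _)).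
have HR2 : k.+1 * 2 ^ R.+1 <= 2 ^ nexp I.
  have -> : 2 ^ nexp I = 2 ^ (nexp I - R.+1) * 2 ^ R.+1 by rewrite -expnD subnK.
  by rewrite leq_mul2r; apply/orP; right; lia.
rewrite expnS in HR2.
rewrite (_ : 2 * k.+1 - 1 = k.*2.+1); last lia.
rewrite (_ : 2 * k.+1 = k.*2.+2); last lia.
rewrite !block_winnerE; last by nia.
  by case: ifP.
by nia.
Qed.

Lemma tournament_valueE : tournament_value I sigma = Posz (size (glog (nexp I) p)).
Proof.
have := tournament_value_partial (leqnn _).
rewrite subnn expn0 big_nat1 /slice mul0n drop0 take_oversize ?size_p' // => <-.
rewrite /tournament_value size_p (big_morph Posz PoszD (erefl (Posz 0))).
apply: eq_bigr => r _; rewrite (big_morph Posz PoszD (erefl (Posz 0))).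
by apply: eq_bigr => k _; rewrite gvalE.
Qed.

End Log.

(* The score of a game is credited to the winner if it has kind 4, and to the
   loser otherwise; every player receives credit at most once. *)
Section Credit.

Variables (sc : nat -> nat -> nat -> bool) (kd : nat -> nat) (P : seq nat).
Hypothesis scP : forall a b r, sc a b r ->
  [/\ kd a = 4, kd b = 3 & r = 1] \/ (kd a = 3 /\ kd b = 2).
Hypothesis kd_lt : {in P &, forall a b, kd b < kd a -> b < a}.

Definition credit (e : nat * nat * nat) : nat := if kd e.1.1 == 4 then e.1.1 else e.1.2.
Definition loser (e : nat * nat * nat) : nat := e.1.2.

(** The fourth clause drives the induction: the winner of a block has not lost, and has been
    credited only if it is a guard. The fifth is what the decoding uses: a player whom a guard beats
    for a score wins no scoring game. *)
Definition log_inv (s : seq nat) (L : seq (nat * nat * nat)) : Prop :=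
  [/\ uniq (map credit L), uniq (map loser L),
      forall e, e \in L -> [/\ e.1.1 \in s, e.1.2 \in s & sc e.1.1 e.1.2 e.2],
      (maxs s \notin map loser L) /\ (maxs s \in map credit L -> kd (maxs s) = 4) &
      forall e e', e \in L -> e' \in L -> kd e.1.1 = 4 -> e'.1.1 != e.1.2].

Lemma credit_in s L : log_inv s L -> {subset map credit L <= s}.
Proof. by case=> _ _ H _ _ x /mapP[e /H[Ha Hb _] ->]; rewrite /credit; case: ifP. Qed.

Lemma loser_in s L : log_inv s L -> {subset map loser L <= s}.
Proof. by case=> _ _ H _ _ x /mapP[e /H[Ha Hb _] ->]. Qed.

Lemma log_inv_cat s1 s2 L1 L2 : uniq (s1 ++ s2) -> s1 != [::] -> s2 != [::] ->
  log_inv s1 L1 -> log_inv s2 L2 -> log_inv (s1 ++ s2) (L1 ++ L2).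
Proof.
move=> Hu n1 n2 I1 I2; have [c1 c2] := (credit_in I1, credit_in I2).
have [l1 l2] := (loser_in I1, loser_in I2).
move: Hu; rewrite cat_uniq => /and3P[u1 /hasPn dis u2].
have dis' x : x \in s1 -> x \in s2 -> False by move=> H1 /dis; rewrite /= H1.
have [m1 m2] := (maxs_mem n1, maxs_mem n2).
case: I1 I2 => [uc1 ul1 in1 [w1 w1'] t1] [uc2 ul2 in2 [w2 w2'] t2]; split.
- rewrite map_cat cat_uniq uc1 uc2 andbT /=; apply/hasPn => x /c2 Hx.
  by apply/negP => /c1 /dis' /(_ Hx).
- rewrite map_cat cat_uniq ul1 ul2 andbT /=; apply/hasPn => x /l2 Hx.
  by apply/negP => /l1 /dis' /(_ Hx).
- by move=> e; rewrite !mem_cat => /orP[/in1|/in2] [-> -> ->]; rewrite ?orbT.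
- rewrite maxs_cat !map_cat !mem_cat; case: leqP => _; split.
  + rewrite negb_or w2 andbT; apply/negP => /l1 /dis' /(_ m2) //.
  + by case/orP => [/c1 /dis' /(_ m2)|/w2'].
  + rewrite negb_or w1 /=; apply/negP => /l2; exact: dis'.
  + by case/orP => [/w1'|/c2 /(dis' _ m1)].
- move=> e e'; rewrite !mem_cat.
  move=> /orP[He|He] /orP[He'|He'] K; try by [apply: t1|apply: t2].
    have [_ Hb _] := in1 _ He; have [Ha _ _] := in2 _ He'.
    by apply/eqP => E; apply: (dis' _ Hb); rewrite -E.
  have [_ Hb _] := in2 _ He; have [Ha _ _] := in1 _ He'.
  by apply/eqP => E; apply: (dis' _ Ha); rewrite E.
Qed.

Lemma glog_inv r s : size s = 2 ^ r -> uniq s -> {subset s <= P} -> log_inv s (glog sc r s).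
Proof.
elim: r s => [|r IH] s Hs Hu HP; first by split.
have E2 : 2 ^ r.+1 = 2 ^ r + 2 ^ r by rewrite expnS; lia.
have r0 : 0 < 2 ^ r by rewrite expn_gt0.
rewrite /=; set s1 := take _ s; set s2 := drop _ s.
have Es : s = s1 ++ s2 by rewrite cat_take_drop.
have z1 : size s1 = 2 ^ r by rewrite size_takel // Hs E2 leq_addr.
have z2 : size s2 = 2 ^ r by rewrite size_drop Hs E2 addnK.
have n1 : s1 != [::] by rewrite -size_eq0 z1; lia.
have n2 : s2 != [::] by rewrite -size_eq0 z2; lia.
rewrite {}Es in Hu HP *.
have P1 : {subset s1 <= P} by move=> x Hx; apply: HP; rewrite mem_cat Hx.
have P2 : {subset s2 <= P} by move=> x Hx; apply: HP; rewrite mem_cat Hx orbT.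
have := Hu; rewrite cat_uniq => /and3P[u1 /hasPn dis u2].
have dis' x : x \in s1 -> x \in s2 -> False by move=> H1 /dis; rewrite /= H1.
have I1 := IH s1 z1 u1 P1; have I2 := IH s2 z2 u2 P2.
have I12 := log_inv_cat Hu n1 n2 I1 I2.
have [m1 m2] := (maxs_mem n1, maxs_mem n2).
case: ifP => [Hsc|_]; last by rewrite cats0.
set a := maxs s1 in Hsc m1 *; set b := maxs s2 in Hsc m2 *.
have ab : b < a.
  by apply: kd_lt; [exact: P1|exact: P2|case: (scP Hsc) => [[-> ->]|[-> ->]]].
have Hmax : maxs (s1 ++ s2) = a by rewrite maxs_cat; apply/maxn_idPl; apply: ltnW.
rewrite catA; case: (scP Hsc) => [[ka kb [r00]]|[ka kb]].
  (* A guard scores in round 1 only, where both halves are single players with empty logs. *)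
  rewrite r00 /= /log_inv Hmax /credit /loser /= ka eqxx; split=> //.
  + by move=> e; rewrite inE => /eqP-> /=; rewrite -r00 Hsc !mem_cat m1 m2 orbT.
  + by rewrite inE neq_ltn ab orbT.
  + by move=> e e'; rewrite !inE => /eqP-> /eqP-> /= _; rewrite neq_ltn ab orbT.
have [uc ul inn [wl wc] tt] := I12; rewrite Hmax in wl wc.
have [_ _ _ [wl1 wc1] _] := I1; have [_ _ _ [wl2 wc2] _] := I2.
split.
- rewrite map_cat cats1 rcons_uniq uc andbT /credit /= ka /= map_cat mem_cat negb_or.
  apply/andP; split; first by apply/negP => /(credit_in I1) /dis' /(_ m2).
  (* The element [b] won its half, and a winner credited so far would be a guard. *)
  by apply/negP => /wc2; rewrite kb.
- rewrite map_cat cats1 rcons_uniq ul andbT /loser /= map_cat mem_cat negb_or wl2 andbT.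
  by apply/negP => /(loser_in I1) /dis' /(_ m2).
- move=> e; rewrite (mem_cat e) => /orP[/inn //|]; rewrite inE => /eqP-> /=.
  by rewrite !mem_cat m1 m2 orbT Hsc.
- rewrite Hmax; set L := glog sc r s1 ++ glog sc r s2 in wl wc *; split.
    by rewrite (map_cat _ L) mem_cat negb_or wl /= inE /loser /= neq_ltn ab orbT.
  rewrite (map_cat _ L) mem_cat => /orP[/wc //|]; rewrite /= inE /credit /= ka /= => /eqP E.
  by move: ab; rewrite E ltnn.
- move=> e e'; rewrite !(mem_cat _ (glog sc r s1 ++ glog sc r s2)) => /orP[He|He] /orP[He'|He'] K.
  + exact: tt.
  + move: He'; rewrite inE => /eqP-> /=; apply: contra wl => /eqP->.
    exact: map_f.
  + by move: He K; rewrite inE => /eqP-> /=; rewrite ka.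
  + by move: He K; rewrite inE => /eqP-> /=; rewrite ka.
Qed.

(** Pigeonhole: the credited players are distinct and all of kind 4 or 2. A log as long as the list
    of these players credits each of them. *)
Lemma glog_full r p : size p = 2 ^ r -> perm_eq p P -> uniq P ->
  count (fun a => kd a == 4) P + count (fun a => kd a == 2) P <= size (glog sc r p) ->
  (forall a, a \in P -> kd a = 4 -> exists b, (a, b, 1) \in glog sc r p) /\
  (forall b, b \in P -> kd b = 2 -> exists a r', (a, b, r') \in glog sc r p /\ kd a = 3).
Proof.
move=> Hs Hp uP Hc; set L := glog sc r p in Hc *.
have I : log_inv p L.
  by apply: glog_inv => //; [rewrite (perm_uniq Hp)|move=> x; rewrite (perm_mem Hp)].
have [uc ul inn _ _] := I.
pose Q := [seq a <- P | (kd a == 4) || (kd a == 2)].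
have sub : {subset map credit L <= Q}.
  move=> x Hx; rewrite mem_filter -(perm_mem Hp) (credit_in I Hx) andbT.
  case/mapP: Hx => e /inn[_ _ /scP] H ->; rewrite /credit.
  by case: H => [[k1 _ _]|[k1 k2]]; rewrite k1 /= ?k1 ?k2.
have szQ : size Q <= size (map credit L).
  rewrite size_map; apply: leq_trans Hc; rewrite size_filter.
  rewrite -(count_predUI (fun a => kd a == 4) (fun a => kd a == 2) P).
  exact: leq_addr.
have [_ EQ] := uniq_min_size uc sub szQ.
have get a : a \in P -> (kd a == 4) || (kd a == 2) -> exists2 e, e \in L & a = credit e.
  by move=> Ha K; apply/mapP; rewrite EQ mem_filter K.
split=> [a Ha K|b Hb K].
  have [|[[a' b'] r'] He E] := get a Ha; first by rewrite K.
  have [_ _ /scP H] := inn _ He; rewrite /= in H.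
  by case: H E => [[k1 k2 k3]|[k1 k2]]; rewrite /credit /= k1 /= => E; subst;
    [exists b'|move: K; rewrite k2].
have [|[[a' b'] r'] He E] := get b Hb; first by rewrite K.
have [_ _ /scP H] := inn _ He; rewrite /= in H.
by case: H E => [[k1 k2 k3]|[k1 k2]]; rewrite /credit /= k1 /= => E; subst;
  [move: K; rewrite k1|exists a', r'].
Qed.

End Credit.

(** * Seedings as permutations of the player list *)

Lemma seeding_perm I sigma : uniq (players I) -> is_seeding I sigma ->
  perm_eq [seq player_at I sigma k | k <- iota 1 (size (players I))] (players I).
Proof.
move=> uP [inj [rng _]]; set p := map _ _.
have atE i : i \in players I -> player_at I sigma (sigma i) = i.
  move=> Hi; rewrite /player_at; set F := filter _ _.
  have HF : i \in F by rewrite mem_filter eqxx.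
  have : nth 0 F 0 \in F by apply: mem_nth; case: (F) HF.
  rewrite mem_filter => /andP[/eqP E Hj]; exact: inj.
have sub : {subset players I <= p}.
  move=> i Hi; apply/mapP; exists (sigma i); last by rewrite atE.
  by rewrite mem_iota add1n ltnS; apply: rng.
have sz : size p = size (players I) by rewrite size_map size_iota.
have szle : size p <= size (players I) by rewrite sz.
have [_ E] := uniq_min_size uP sub szle.
by apply: uniq_perm => //; exact: leq_size_uniq uP sub szle.
Qed.

Lemma perm_seeding I p : uniq (players I) -> perm_eq p (players I) ->
  let sigma i := (index i p).+1 in
  is_seeding I sigma /\
  forall k, k < size (players I) -> player_at I sigma k.+1 = nth 0 p k.
Proof.
move=> uP Hp sigma; have sz := perm_size Hp; have memE := perm_mem Hp.
have up : uniq p by rewrite (perm_uniq Hp).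
have inj : {in players I &, injective sigma}.
  move=> i j Hi Hj [E]; have := congr1 (nth 0 p) E.
  by rewrite !nth_index ?memE.
have sigE k : k < size p -> sigma (nth 0 p k) = k.+1.
  by move=> Hk; rewrite /sigma index_uniq.
split; first split=> //.
- split=> [i Hi|k Hk]; first by rewrite /sigma -sz index_mem memE.
  case/andP: Hk => Hk1 Hk2; have Hk : k.-1 < size p by rewrite prednK // sz.
  by exists (nth 0 p k.-1); [rewrite -memE mem_nth|rewrite sigE // prednK].
- move=> k Hk; rewrite -sz in Hk; rewrite /player_at; set F := filter _ _.
  have HF : nth 0 p k \in F by rewrite mem_filter sigE // eqxx -memE mem_nth.
  have : nth 0 F 0 \in F by apply: mem_nth; case: (F) HF.
  rewrite mem_filter => /andP[/eqP E Hj]; apply: inj => //; first by rewrite -memE mem_nth.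
  by rewrite E sigE.
Qed.

Lemma tvm_yesP (sc : nat -> nat -> nat -> bool) I tg : wf_instance I ->
  (forall a b r, gval I a b r = Posz (sc a b r)) -> target I = Posz tg ->
  tvm_yes I <->
  exists2 p, perm_eq p (players I) & tg <= size (glog sc (nexp I) p).
Proof.
move=> [uP sz] gE tE; split.
- move=> [sigma [Hs Hv]]; have Hp := seeding_perm uP Hs.
  exists [seq player_at I sigma k | k <- iota 1 (size (players I))] => //.
  move: Hv; rewrite tE (tournament_valueE (sc := sc) (p := [seq player_at I sigma k | k <- iota 1 (size (players I))])) //.
    by move=> k Hk; rewrite (nth_map 0) ?size_iota ?sz // nth_iota.
  by rewrite size_map size_iota.
- move=> [p Hp Hl]; have [Hs Hat] := perm_seeding uP Hp.
  exists (fun i => (index i p).+1); split=> //; rewrite tE.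
  rewrite (tournament_valueE (sc := sc) (p := p)) //; last by rewrite (perm_size Hp).
  by move=> k Hk; apply: Hat; rewrite sz.
Qed.

(** * Binary numerals *)

Definition valb (s : seq bool) : nat := foldr (fun (b : bool) n => b + n.*2) 0 s.

Lemma valb_cat s h : valb (s ++ h) = valb s + 2 ^ size s * valb h.
Proof. by elim: s => [|b s IH] /=; rewrite ?mul1n // IH expnS; lia. Qed.

Lemma valb_lt s : valb s < 2 ^ size s.
Proof. by elim: s => //= b s IH; rewrite expnS; case: b; lia. Qed.

Lemma valb_gt0 s : last false s -> 0 < valb s.
Proof.
elim: s => //= b [|c s] IH /=; first by case: b.
by move=> H; have := IH H; rewrite /=; lia.
Qed.

(** Numerals have no leading zero, that is, no final [false]; the default [true] admits the empty
    numeral of 0. *)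
Lemma bin_valb s : last true s -> bin (valb s) = s.
Proof.
elim: s => // b s IH Hl.
have [E|ne] := eqVneq s [::]; first by rewrite {s IH}E in Hl *; case: b Hl.
have H0 : 0 < valb s by apply: valb_gt0; case: s ne Hl {IH}.
rewrite bin_rec /=; last lia.
rewrite (_ : odd _ = b); last by case: b {Hl}; lia.
rewrite (_ : _./2 = valb s); last by case: b {Hl}; lia.
by rewrite IH //; case: s ne Hl {IH H0}.
Qed.

Lemma valb_bin n : valb (bin n) = n.
Proof.
elim/ltn_ind: n => -[|n] IH //; rewrite bin_rec // [LHS]/= -/(valb _) IH; lia.
Qed.

Lemma last_bin n : last true (bin n).
Proof.
elim/ltn_ind: n => -[|[|n]] IH //; rewrite bin_rec //.
have h0 : 0 < n.+2./2 by lia.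
by have := IH n.+2./2 ltac:(lia); rewrite (bin_rec h0).
Qed.

Lemma last_bin_gt0 a n : 0 < n -> last a (bin n).
Proof. by move=> Hn; have := last_bin n; rewrite bin_rec. Qed.

Lemma bin_shift k v : 0 < v -> bin (2 ^ k * v) = nseq k false ++ bin v.
Proof.
move=> Hv; rewrite -[RHS]bin_valb.
  rewrite valb_cat size_nseq valb_bin (_ : valb (nseq k false) = 0) //.
  by elim: k => //= k ->.
by rewrite last_cat last_bin_gt0.
Qed.

(** * The tournament of a local constraint system *)

Lemma uniq_map_inj_in (T1 T2 : eqType) (f : T1 -> T2) (s : seq T1) :
  uniq (map f s) -> {in s &, injective f}.
Proof.
elim: s => //= a s IH /andP[Ha Hu] x y; rewrite !inE => /orP[/eqP->|Hx] /orP[/eqP->|Hy] E //.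
- by rewrite E map_f in Ha.
- by rewrite -E map_f in Ha.
- exact: IH.
Qed.

Definition onehot (n k : nat) : seq bool := [seq k == j | j <- iota 0 n].

Lemma onehot_inj n k k' : k < n -> onehot n k = onehot n k' -> k = k'.
Proof.
move=> Hk E; have := congr1 (fun s => nth false s k) E.
rewrite !(nth_map 0) ?size_iota // nth_iota // add0n eqxx => /esym/eqP ->.
by [].
Qed.

Lemma size_onehot n k : size (onehot n k) = n.
Proof. by rewrite size_map size_iota. Qed.

Lemma leq_sumn_map (T : eqType) (f : T -> nat) n s :
  (forall x, x \in s -> n <= f x) -> size s * n <= sumn (map f s).
Proof.
elim: s => //= x s IH H; rewrite mulSn; apply: leq_add; first by rewrite H ?mem_head.
by apply: IH => y Hy; apply: H; rewrite inE Hy orbT.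
Qed.

Lemma exp_gap a b : 2 ^ a + b <= 2 ^ (a + b).
Proof.
have H : b < 2 ^ b by apply: ltn_expl.
have Ha : 0 < 2 ^ a by rewrite expn_gt0.
by rewrite expnD; nia.
Qed.

(** Used to find the group of a filler, the groups being consecutive intervals. *)
Lemma discrete_ivt (f : nat -> nat) k u : f 0 <= u < f k -> exists2 s, s < k & f s <= u < f s.+1.
Proof.
elim: k => [|k IH] /andP[H1 H2]; first by lia.
have [H|H] := leqP (f k) u; first by exists k; rewrite ?H.
by have [|s Hs Hf] := IH; [rewrite H1|exists s => //; lia].
Qed.

Lemma take_flatten_uniform (T : Type) w n (bl : seq (seq T)) :
  all (fun b => size b == w) bl -> n <= size bl ->
  take (n * w) (flatten bl) = flatten (take n bl) /\
  drop (n * w) (flatten bl) = flatten (drop n bl).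
Proof.
elim: n bl => [|n IH] [|b bl] //=; first by rewrite take0 drop0.
case/andP=> /eqP Hb Hall Hn; have [E1 E2] := IH bl Hall Hn.
by rewrite mulSn -Hb take_cat drop_cat ltnNge leq_addr /= addKn Hb E1 E2.
Qed.

Lemma glog_prefix (sc : nat -> nat -> nat -> bool) r k s : size s = 2 ^ (r + k) ->
  size (glog sc r (take (2 ^ r) s)) <= size (glog sc (r + k) s).
Proof.
elim: k s => [|k IH] s Hs; first by rewrite addn0 in Hs *; rewrite take_oversize ?Hs.
rewrite addnS /= !size_cat; apply: leq_trans (leq_addr _ _).
rewrite -(take_takel s (_ : 2 ^ r <= 2 ^ (r + k))) ?leq_exp2l ?leq_addr //.
by apply: IH; rewrite size_takel // Hs addnS leq_exp2l.
Qed.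

Lemma glog_blocks (sc : nat -> nat -> nat -> bool) m k bl :
  all (fun b => size b == 2 ^ m) bl -> size bl = 2 ^ k ->
  sumn [seq size (glog sc m b) | b <- bl] <= size (glog sc (m + k) (flatten bl)).
Proof.
elim: k bl => [|k IH] bl Hall Hs.
  case: bl Hs {Hall} => [|b [|c bl]] //= _.
  by rewrite addn0 cats0 addn0.
rewrite addnS /= !size_cat.
have Hk : 2 ^ k <= size bl by rewrite Hs leq_exp2l.
have [E1 E2] := take_flatten_uniform Hall Hk.
have -> : 2 ^ (m + k) = 2 ^ k * 2 ^ m by rewrite addnC expnD.
rewrite E1 E2 -{1}(cat_take_drop (2 ^ k) bl) map_cat sumn_cat.
move: Hall; rewrite -{1}(cat_take_drop (2 ^ k) bl) all_cat => /andP[A1 A2].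
rewrite addnA; apply: leq_trans (leq_addr _ _).
apply: leq_add; apply: IH => //; first by rewrite size_takel.
by rewrite size_drop Hs expnS; lia.
Qed.

Lemma maxs_cons_lt x s : (forall y, y \in s -> y < x) -> maxs (x :: s) = x.
Proof.
move=> H; rewrite /maxs big_cons; apply/maxn_idPl.
by apply/bigmax_leqP_seq => y /H /ltnW.
Qed.

(** A bracket unfolded along its winner: [T] meets [el k] in round [k.+1], after [el k] has won a
    sub-bracket of [2 ^ k] players against the fillers [fil k]. *)
Definition star (T : nat) (el : nat -> nat) (fil : nat -> seq nat) (s : nat) : seq nat :=
  T :: flatten [seq el k :: fil k | k <- iota 0 s].

Lemma starS T el fil s : star T el fil s.+1 = star T el fil s ++ (el s :: fil s).
Proof. by rewrite /star -addn1 iotaD map_cat flatten_cat /= cats0. Qed.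

Lemma star_log (sc : nat -> nat -> nat -> bool) T el fil s :
  (forall k, k < s -> [/\ size (fil k) = (2 ^ k).-1, el k < T,
     forall y, y \in fil k -> y < el k & sc T (el k) k.+1]) ->
  [/\ size (star T el fil s) = 2 ^ s, maxs (star T el fil s) = T
    & s <= size (glog sc s (star T el fil s))].
Proof.
elim: s => [|s IH] H; first by rewrite /star /= /maxs big_seq1.
have [z1 m1 l1] := IH (fun k Hk => H k (ltnW Hk)).
have [z2 lt yl Hsc] := H s (leqnn _).
have m2 : maxs (el s :: fil s) = el s by apply: maxs_cons_lt.
have e0 : 0 < 2 ^ s by rewrite expn_gt0.
rewrite starS; move: (star T el fil s) z1 m1 l1 => X z1 m1 l1; split.
- by rewrite size_cat z1 /= z2 expnS; lia.
- by rewrite maxs_cat m1 m2; apply/maxn_idPl; apply: ltnW.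
- rewrite /= take_size_cat // drop_size_cat // m1 m2 Hsc !size_cat /=; lia.
Qed.

Definition prv (N x : nat) : nat := if x == 0 then N.-1 else x.-1.

Lemma prvK N x : x < N -> nxt N true (prv N x) = x.
Proof. by rewrite /nxt /prv => Hx; case: (x =P 0) => ?; case: eqP; lia. Qed.

Lemma nxtK N x : x < N -> prv N (nxt N true x) = x.
Proof. by rewrite /nxt /prv => Hx; case: (x.+1 =P N) => ? //=; lia. Qed.

Lemma prv_lt N x : x < N -> prv N x < N.
Proof. by rewrite /prv; case: ifP; lia. Qed.

Lemma nxt_lt N x : x < N -> nxt N true x < N.
Proof. by rewrite /nxt; case: ifP; lia. Qed.

(* Each of the [N * N] cells of a torus selects one of [C] tiles; constraint
   [c] demands that bit [ob c] of a cell equal bit [ib c] of its successor in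
   direction [dir c].  A player is [(t, i, u)] with [u < C * 2 ^ m], where
   [m = 2 D]: tiles are [u = j * 2 ^ m], guards are [u = j * 2 ^ m + 1] with
   [j > 0], elements are [0 < u <= m], and the others are fillers.  The element
   [u = 2 c + b + 1] stands for constraint [c] with bit [b].  A guard scores
   in round 1 against any tile of its cell, so that all tiles but one leave;
   the remaining tile meets in rounds [2 c + 1] and [2 c + 2] the elements that
   its bits [~~ ob c] and [ib c] cover.  All elements are covered iff the bits
   agree. *)
Section Instance.

Variables (N C D e : nat).
Variables (al : nat -> nat -> nat -> bool) (ob ib : nat -> nat -> nat -> nat -> bool).
Variable (dir : nat -> bool).

Definition rounds := D.*2.
Definition blk_size := 2 ^ rounds.
Definition cell_size := C * blk_size.

Definition isTile u := u %% blk_size == 0.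
Definition isGuard u := (u %% blk_size == 1) && (blk_size <= u).
Definition isElt u := 0 < u <= rounds.
Definition rk u := if isGuard u then 4 else if isTile u then 3 else if isElt u then 2 else 1.

Definition cells := [seq (t, i) | t <- iota 0 N, i <- iota 0 N].
Definition idx := [seq (c, u) | c <- cells, u <- iota 0 cell_size].
(** The least significant digit comes first, so the last word dominates and the rank decides before
    all else. Since [rk] is positive this word ends in a one, and the label is a genuine numeral.
    The one-hot words are printable by a loop with an equality test. *)
Definition label (x : nat * nat * nat) : seq bool :=
  onehot N x.1.1 ++ onehot N x.1.2 ++ bin (rk x.2 * cell_size + x.2).
Definition code x := valb (label x).
Definition plist := map code idx.
Definition dec a := nth (0, 0, 0) idx (index a plist).

Definition nextc (c : nat) (x : nat * nat) : nat * nat :=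
  if dir c then (nxt N true x.1, x.2) else (x.1, nxt N true x.2).

(** The slot [s] fixes a constraint and a side of it. In an even slot the tile at [(t, i)] covers an
    element of its own cell, in an odd slot an element of the predecessor cell, whose constraint
    points to [(t, i)]. *)
Definition cov (tau b s t i t' i' : nat) : bool :=
  [&& al t i tau, b./2 == s./2 &
      if odd s then (nextc s./2 (t', i') == (t, i)) && (odd b == ib s./2 t i tau)
      else ((t', i') == (t, i)) && (odd b == ~~ ob s./2 t i tau)].

Definition scores (x y : nat * nat * nat) (r : nat) : bool :=
  [&& isGuard x.2, isTile y.2, r == 1 & x.1 == y.1] ||
  [&& isTile x.2, isElt y.2, 0 < r <= rounds &
      cov (x.2 %/ blk_size) y.2.-1 r.-1 x.1.1 x.1.2 y.1.1 y.1.2].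

Definition sc a b r := scores (dec a) (dec b) r.

Definition inst : tvm_instance :=
  {| players := plist; nexp := e; gval := fun a b r => Posz (sc a b r);
     target := Posz (N * N * (C.-1 + rounds)) |}.

Definition csp (sel : nat -> nat -> nat) : Prop :=
  (forall t i, t < N -> i < N -> sel t i < C /\ al t i (sel t i)) /\
  (forall t i c, t < N -> i < N -> c < D ->
     ob c t i (sel t i) =
     ib c (nextc c (t, i)).1 (nextc c (t, i)).2
        (sel (nextc c (t, i)).1 (nextc c (t, i)).2)).

Hypotheses (D_gt0 : 0 < D) (C_gt0 : 0 < C) (sizeE : N * N * cell_size = 2 ^ e).

Lemma blk_size_gt : rounds < blk_size. Proof. exact: ltn_expl. Qed.

Lemma blk_size_gt1 : 1 < blk_size.
Proof. by have := blk_size_gt; rewrite /rounds; lia. Qed.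

Lemma mem_idx t i u : ((t, i, u) \in idx) = [&& t < N, i < N & u < cell_size].
Proof.
apply/allpairsP/idP => [[[[t1 i1] u1] /= [/allpairsP[[t2 i2] /= [Ht Hi [-> ->]]] Hu [-> -> ->]]]|].
  by move: Ht Hi Hu; rewrite !mem_iota /= => -> -> ->.
case/and3P=> Ht Hi Hu; exists ((t, i), u); split=> //=; last by rewrite mem_iota.
by apply/allpairsP; exists (t, i); rewrite !mem_iota.
Qed.

Lemma uniq_idx : uniq idx.
Proof.
apply: allpairs_uniq => [||[x u] [y v] _ _ [-> ->]] //; last exact: iota_uniq.
by apply: allpairs_uniq => [||[t i] [t' i'] _ _ [-> ->]] //; apply: iota_uniq.
Qed.

Lemma size_idx : size idx = 2 ^ e.
Proof. by rewrite !size_allpairs !size_iota sizeE. Qed.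

Lemma cell_size_gt0 : 0 < cell_size.
Proof. by rewrite muln_gt0 C_gt0 expn_gt0. Qed.

Lemma rk_gt0 u : 0 < rk u.
Proof. by rewrite /rk; do ?case: ifP. Qed.

Lemma last_label x : last true (label x).
Proof.
rewrite /label !last_cat last_bin_gt0 //.
by have := cell_size_gt0; have := rk_gt0 x.2; nia.
Qed.

Lemma bin_code x : bin (code x) = label x.
Proof. by rewrite bin_valb // last_label. Qed.

Lemma code_inj : {in idx &, injective code}.
Proof.
move=> [[t i] u] [[t' i'] u']; rewrite !mem_idx => /and3P[Ht Hi Hu] /and3P[Ht' Hi' Hu'] E.
have := congr1 bin E; rewrite !bin_code => /eqP.
rewrite /label /= eqseq_cat ?size_onehot // => /andP[/eqP Et].
rewrite eqseq_cat ?size_onehot // => /andP[/eqP Ei /eqP Eb].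
rewrite (onehot_inj Ht Et) (onehot_inj Hi Ei).
have := congr1 (fun s => valb s %% cell_size) Eb.
by rewrite !valb_bin !modnMDl !modn_small // => ->.
Qed.

Lemma uniq_plist : uniq plist.
Proof. by rewrite map_inj_in_uniq ?uniq_idx //; apply: code_inj. Qed.

Lemma wf_inst : wf_instance inst.
Proof. by split; [exact: uniq_plist|rewrite /= size_map size_idx]. Qed.

Lemma codeK x : x \in idx -> dec (code x) = x.
Proof.
move=> Hx; rewrite /dec; have Hi : index x idx < size idx by rewrite index_mem.
have -> : index (code x) plist = index x idx; last exact: nth_index.
by rewrite -{1}(nth_index (0,0,0) Hx) -(nth_map _ 0) // index_uniq ?uniq_plist // size_map.
Qed.

Lemma decP a : a \in plist -> dec a \in idx /\ code (dec a) = a.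
Proof. by case/mapP=> x Hx ->; rewrite codeK. Qed.

Definition kd a := rk (dec a).2.

Lemma isG_T u : isGuard u -> isTile u = false.
Proof. by rewrite /isGuard /isTile => /andP[/eqP-> _]. Qed.

Lemma isE_small u : isElt u -> u %% blk_size = u.
Proof. by case/andP=> H1 H2; rewrite modn_small //; apply: leq_ltn_trans blk_size_gt. Qed.

Lemma isE_GT u : isElt u -> isGuard u = false /\ isTile u = false.
Proof.
move=> H; rewrite /isGuard /isTile isE_small //; have := blk_size_gt; have := H; rewrite /isElt => /andP[? ?].
by split; lia.
Qed.

Lemma rkE u : [/\ isGuard u -> rk u = 4, isTile u -> rk u = 3 & isElt u -> rk u = 2].
Proof.
rewrite /rk; split; first by move=> ->.
- by move=> H; rewrite H; case: ifP => // /isG_T; rewrite H.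
- by move=> H; have [-> ->] := isE_GT H; rewrite H.
Qed.

Lemma rk_inv u : [/\ rk u = 4 -> isGuard u, rk u = 3 -> isTile u & rk u = 2 -> isElt u].
Proof. by rewrite /rk; do ?case: ifP. Qed.

Lemma sc_kinds a b r : sc a b r ->
  [/\ kd a = 4, kd b = 3 & r = 1] \/ (kd a = 3 /\ kd b = 2).
Proof.
rewrite /sc /scores /kd; case/orP => /and4P[H1 H2 H3 H4]; [left|right].
  by split; [apply: (let: And3 h _ _ := rkE _ in h _)|apply: (let: And3 _ h _ := rkE _ in h _)|apply/eqP].
by split; [apply: (let: And3 _ h _ := rkE _ in h _)|apply: (let: And3 _ _ h := rkE _ in h _)].
Qed.

Lemma code_lt x y : x \in idx -> y \in idx -> rk y.2 < rk x.2 -> code y < code x.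
Proof.
case: x y => [[t i] u] [[t' i'] u']; rewrite !mem_idx => /and3P[Ht Hi Hu] /and3P[Ht' Hi' Hu'] /= Hr.
rewrite /code /label /= !catA !(valb_cat (_ ++ _)) !size_cat !size_onehot !valb_bin.
set s' := onehot N t' ++ _; have : valb s' < 2 ^ (N + N).
  by have := valb_lt s'; rewrite size_cat !size_onehot.
have : rk u' * cell_size + u' < rk u * cell_size + u.
  by apply: (@leq_trans ((rk u').+1 * cell_size)); [rewrite mulSn; lia|nia].
set A := rk u' * cell_size + u'; set A2 := rk u * cell_size + u; set E := 2 ^ (N + N).
move=> HA Hv; have HE : E * A.+1 <= E * A2 by rewrite leq_mul2l HA orbT.
by rewrite mulnS in HE; lia.
Qed.

Lemma kd_lt : {in plist &, forall a b, kd b < kd a -> b < a}.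
Proof.
move=> a b /decP[Ha Ea] /decP[Hb Eb]; rewrite /kd => H.
by rewrite -Ea -Eb; apply: code_lt.
Qed.

Lemma count_idx (a : pred nat) :
  count (fun x => a x.2) idx = N * N * count a (iota 0 cell_size).
Proof.
have -> : N * N = size cells by rewrite size_allpairs size_iota.
rewrite /idx; elim: cells => //= c cs IH; rewrite count_cat IH mulSn; congr addn.
by rewrite count_map; apply: eq_count.
Qed.

Lemma count_kd k : count (fun a => kd a == k) plist = N * N * count (fun u => rk u == k) (iota 0 cell_size).
Proof.
rewrite count_map -count_idx; apply: eq_in_count => x Hx /=.
by rewrite /kd codeK.
Qed.

Lemma count_guards : count (fun u => rk u == 4) (iota 0 cell_size) <= C.-1.
Proof.
rewrite -size_filter.
have -> : C.-1 = size [seq j * blk_size + 1 | j <- iota 1 C.-1] by rewrite size_map size_iota.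
apply: uniq_leq_size; first by rewrite filter_uniq // iota_uniq.
move=> u; rewrite mem_filter mem_iota add0n => /andP[/eqP Hr Hu].
have [/(_ Hr) /andP[/eqP Hm HB] _ _] := rk_inv u.
apply/mapP; exists (u %/ blk_size); last by rewrite -Hm -divn_eq.
have B0 : 0 < blk_size by rewrite expn_gt0.
by rewrite mem_iota add1n prednK // divn_gt0 // HB ltn_divLR.
Qed.

Lemma count_elements : count (fun u => rk u == 2) (iota 0 cell_size) <= rounds.
Proof.
rewrite -size_filter -(size_iota 1 rounds).
apply: uniq_leq_size; first by rewrite filter_uniq // iota_uniq.
move=> u; rewrite mem_filter => /andP[/eqP Hr _].
have [_ _ /(_ Hr)] := rk_inv u; rewrite /isElt mem_iota; lia.
Qed.

Lemma score_target : count (fun a => kd a == 4) plist + count (fun a => kd a == 2) plist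
  <= N * N * (C.-1 + rounds).
Proof.
rewrite !count_kd -mulnDr leq_mul2l; apply/orP; right.
exact: leq_add count_guards count_elements.
Qed.

Lemma isT_mul j : isTile (j * blk_size).
Proof. by rewrite /isTile modnMl. Qed.

Lemma isG_mul j : 0 < j -> isGuard (j * blk_size + 1).
Proof.
move=> Hj; rewrite /isGuard modnMDl modn_small ?blk_size_gt1 //=.
by apply: leq_trans (leq_addr _ _); rewrite leq_pmull.
Qed.

Lemma tile_lt j : j < C -> j * blk_size < cell_size.
Proof. by move=> Hj; rewrite ltn_mul2r Hj expn_gt0. Qed.

Lemma inst_csp : tvm_yes inst -> exists sel, csp sel.
Proof.
case/(tvm_yesP (sc := sc) wf_inst (fun _ _ _ => erefl) erefl) => p Hp Hl.
have szp : size p = 2 ^ e by rewrite (perm_size Hp) /= size_map size_idx.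
set L := glog sc e p in Hl.
have pP : {subset p <= plist} by move=> x; rewrite (perm_mem Hp).
have up : uniq p by rewrite (perm_uniq Hp) uniq_plist.
have [uc ul inn _ tt] := glog_inv sc_kinds kd_lt szp up pP; rewrite -/L in uc ul inn tt.
have [HG HE] := glog_full sc_kinds kd_lt szp Hp uniq_plist (leq_trans score_target Hl).
rewrite -/L in HG HE.
pose T t i tau := code (t, i, tau * blk_size).
pose G t i j := code (t, i, j * blk_size + 1).
(* A tile counts as chosen when it wins a scoring game. *)
pose Cv t i tau := tau < C /\ exists b r, (T t i tau, b, r) \in L.
have Tin t i tau : t < N -> i < N -> tau < C -> (t, i, tau * blk_size) \in idx.
  by move=> Ht Hi Hta; rewrite mem_idx Ht Hi tile_lt.
have Gin t i j : t < N -> i < N -> 0 < j < C -> (t, i, j * blk_size + 1) \in idx.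
  move=> Ht Hi /andP[_ Hj]; rewrite mem_idx Ht Hi /cell_size; have := blk_size_gt1; nia.
have kdc x : x \in idx -> kd (code x) = rk x.2 by move=> Hx; rewrite /kd codeK.
have kdG t i j : t < N -> i < N -> 0 < j < C -> kd (G t i j) = 4.
  move=> Ht Hi Hj; rewrite kdc ?Gin //=; have [H _ _] := rkE (j * blk_size + 1); apply: H.
  by apply: isG_mul; case/andP: Hj.
have beat t i j : t < N -> i < N -> 0 < j < C ->
    exists2 tau, tau < C & (G t i j, T t i tau, 1) \in L.
  move=> Ht Hi Hj; have [b Hb] := HG (G t i j) (map_f _ (Gin _ _ _ Ht Hi Hj)) (kdG _ _ _ Ht Hi Hj).
  have [_ /= Hbp Hsc] := inn _ Hb; have [Hd Eb] := decP (pP _ Hbp).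
  have j0 : 0 < j by case/andP: Hj.
  move: Hsc; rewrite /sc /scores codeK ?Gin //= (isG_T (isG_mul j0)) /= orbF; case: (dec b) Hd Eb => [[t' i'] u'] Hd Eb /=.
  case/and3P=> _ HT /eqP[E1 E2]; subst t' i'.
  move: Hd; rewrite mem_idx => /and3P[_ _ Hu].
  have Eu : u' = u' %/ blk_size * blk_size by rewrite {1}(divn_eq u' blk_size) (eqP HT) addn0.
  exists (u' %/ blk_size); first by rewrite ltn_divLR ?expn_gt0.
  by rewrite /T -Eu Eb.
(* The [C.-1] guards of a cell beat distinct tiles, as a loser occurs once in the log, and none of
   these tiles scores. Two chosen tiles would make [C.+1] tiles in all. *)
have uniqCv t i tau tau' : t < N -> i < N -> Cv t i tau -> Cv t i tau' -> tau = tau'.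
  move=> Ht Hi [Hta [b [r He]]] [Hta' [b' [r' He']]]; apply/eqP; apply/negPn/negP => ne.
  pose tj j := find (fun x => (G t i j, T t i x, 1) \in L) (iota 0 C).
  have tjP j : 0 < j < C -> tj j < C /\ (G t i j, T t i (tj j), 1) \in L.
    move=> Hj; have [x Hx Hin] := beat t i j Ht Hi Hj.
    have Hh : has (fun x => (G t i j, T t i x, 1) \in L) (iota 0 C).
      by apply/hasP; exists x => //; rewrite mem_iota.
    have Hlt : tj j < C by rewrite -[C](size_iota 0) /tj -has_find.
    by split=> //; have := nth_find 0 Hh; rewrite -/(tj j) nth_iota.
  pose s1 := [seq tj j | j <- iota 1 C.-1].
  have Hj j : j \in iota 1 C.-1 -> 0 < j < C by rewrite mem_iota; lia.
  have us1 : uniq s1.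
    rewrite map_inj_in_uniq ?iota_uniq // => j j' /Hj Hj1 /Hj Hj2 Ej.
    have [_ e1] := tjP _ Hj1; have [_ e2] := tjP _ Hj2; rewrite -Ej in e2.
    have [Eg] := uniq_map_inj_in ul e1 e2 erefl.
    have [] := code_inj (Gin _ _ _ Ht Hi Hj1) (Gin _ _ _ Ht Hi Hj2) Eg.
    by move/addIn/eqP; rewrite eqn_pmul2r ?expn_gt0 // => /eqP.
  have nin x b0 r0 : (T t i x, b0, r0) \in L -> x \notin s1.
    move=> Hx; apply/negP => /mapP[j /Hj Hj1 Ex].
    have [_ e1] := tjP _ Hj1; rewrite -Ex in e1.
    by have := tt _ _ e1 Hx (kdG _ _ _ Ht Hi Hj1); rewrite eqxx.
  have U : uniq [:: tau, tau' & s1] by rewrite /= inE negb_or ne us1 (nin _ _ _ He) (nin _ _ _ He').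
  have Sb : {subset [:: tau, tau' & s1] <= iota 0 C}.
    move=> x; rewrite !inE mem_iota /= => /or3P[/eqP->|/eqP->|/mapP[j /Hj /tjP[H _] ->]] //.
  by have := uniq_leq_size U Sb; rewrite /= size_map !size_iota; lia.
have cover t i c (b : bool) : t < N -> i < N -> c < D ->
   (exists tau, [/\ Cv t i tau, al t i tau & b = ~~ ob c t i tau]) \/
   (exists tau, let c2 := nextc c (t, i) in
      [/\ Cv c2.1 c2.2 tau, al c2.1 c2.2 tau & b = ib c c2.1 c2.2 tau]).
  move=> Ht Hi Hc; pose u := (c.*2 + b).+1.
  have Eu : isElt u by rewrite /isElt /u /rounds; case: (b); lia.
  have Hu : (t, i, u) \in idx.
    rewrite mem_idx Ht Hi; move: Eu; rewrite /isElt /cell_size => /andP[_ Hum]; have := blk_size_gt; nia.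
  have [||a [r [He ka]]] := HE (code (t, i, u)); first exact: map_f.
    by rewrite kdc //=; have [_ _ H] := rkE u; apply: H.
  have [/= Hap _ Hsc] := inn _ He; have [Hd Ea] := decP (pP _ Hap).
  move: Hsc; rewrite /sc /scores (codeK Hu) /= (proj2 (isE_GT Eu)) andbF /=.
  case: (dec a) Hd Ea => [[t2 i2] u2] Hd Ea /=; rewrite Eu /=.
  case/and3P=> HT Hr /and3P[Hal /eqP Ec Hif].
  have Ec' : (c.*2 + b)./2 = c by rewrite addnC half_bit_double.
  have Eb : odd (c.*2 + b) = b by rewrite oddD odd_double oddb.
  rewrite -Ec Ec' Eb in Hif.
  move: Hd; rewrite mem_idx => /and3P[_ _ Hu2].
  have E2 : u2 = u2 %/ blk_size * blk_size by rewrite {1}(divn_eq u2 blk_size) (eqP HT) addn0.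
  have Hcv : Cv t2 i2 (u2 %/ blk_size).
    split; first by rewrite ltn_divLR ?expn_gt0.
    by exists (code (t, i, u)), r; rewrite /T -E2 Ea.
  case: ifP Hif => _ /andP[/eqP En /eqP Eo].
    by right; exists (u2 %/ blk_size); rewrite En.
  by left; exists (u2 %/ blk_size); case: En => -> ->.
pose sel t i := find (fun x => has (fun e => e.1.1 == T t i x) L) (iota 0 C).
have selE t i tau : t < N -> i < N -> Cv t i tau -> sel t i = tau.
  move=> Ht Hi HC; have [Hta [b [r He]]] := HC; apply: uniqCv HC => //.
  set P := fun x => has (fun e => e.1.1 == T t i x) L.
  have Hh : has P (iota 0 C).
    apply/hasP; exists tau; first by rewrite mem_iota.
    by apply/hasP; exists (T t i tau, b, r) => //=.
  have Hlt : sel t i < C by rewrite -[C](size_iota 0) /sel -has_find.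
  split=> //; have := nth_find 0 Hh; rewrite -/(sel t i) nth_iota //.
  by case/hasP=> [[[a b1] r1]] H /= /eqP <-; exists b1, r1.
have next_lt c t i : t < N -> i < N ->
    (nextc c (t, i)).1 < N /\ (nextc c (t, i)).2 < N.
  by rewrite /nextc /nxt; case: (dir c) => /= Ht Hi; split=> //; case: ifP; lia.
have both t i c : t < N -> i < N -> c < D -> let c2 := nextc c (t, i) in
   [/\ sel t i < C, al t i (sel t i) &
    ob c t i (sel t i) = ib c c2.1 c2.2 (sel c2.1 c2.2)].
  move=> Ht Hi Hc c2; have [Hn1 Hn2] := next_lt c t i Ht Hi.
  case: (cover t i c true Ht Hi Hc) => -[x [Cx ax Ex]];
    case: (cover t i c false Ht Hi Hc) => -[y [Cy ay Ey]].
  (* One tile covers only one of the two elements on its side of the constraint. So the elements are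
     covered from different cells, once from the own and once from the successor cell, and the bits
     agree. *)
  - by have Exy := uniqCv _ _ _ _ Ht Hi Cx Cy; move: Ex Ey; rewrite Exy => <-.
  - rewrite (selE _ _ _ Ht Hi Cx) (selE _ _ _ Hn1 Hn2 Cy); split=> //; first by case: Cx.
    by rewrite -Ey; apply/negbTE; rewrite -Ex.
  - rewrite (selE _ _ _ Ht Hi Cy) (selE _ _ _ Hn1 Hn2 Cx); split=> //; first by case: Cy.
    by rewrite -Ex; apply/negbFE; rewrite -Ey.
  - by have Exy := uniqCv _ _ _ _ Hn1 Hn2 Cx Cy; move: Ex Ey; rewrite Exy => <-.
exists sel; split=> [t i Ht Hi|t i c Ht Hi Hc].
  by have [] := both t i 0 Ht Hi D_gt0.
by have [] := both t i c Ht Hi Hc.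
Qed.

Definition prevc (c : nat) (x : nat * nat) : nat * nat :=
  if dir c then (prv N x.1, x.2) else (x.1, prv N x.2).

Lemma csp_inst sel : csp sel -> tvm_yes inst.
Proof.
move=> [Hsel Hcsp].
pose elt t i s :=
  let c := s./2 in
  if odd s then code (prevc c (t, i), (c.*2 + ib c t i (sel t i)).+1)
  else code (t, i, (c.*2 + ~~ ob c t i (sel t i)).+1).
(* Fillers start at [rounds + 1], and the slots before [s] use up [2 ^ s - 1 - s] of them. The
   groups of all slots end exactly at [blk_size]. *)
pose fil t i s := [seq code (t, i, q) | q <- iota (rounds + 2 ^ s - s) (2 ^ s).-1].
pose A t i := star (code (t, i, sel t i * blk_size)) (elt t i) (fil t i) rounds.
(* Guard [j] meets tile [j], but the selected tile must survive: its guard takes tile 0, which has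
   no guard of its own. *)
pose ppi t i j := if j == sel t i then 0 else j.
pose blk t i j := [:: code (t, i, j * blk_size + 1), code (t, i, ppi t i j * blk_size) &
                   [seq code (t, i, j * blk_size + q) | q <- iota 2 (blk_size - 2)]].
pose lay (c : nat * nat) := A c.1 c.2 :: [seq blk c.1 c.2 j | j <- iota 1 C.-1].
pose bl := flatten [seq lay c | c <- cells].
have B2 := blk_size_gt1; have Bm := blk_size_gt.
have cellP c : c \in cells -> c.1 < N /\ c.2 < N.
  by case/allpairsP=> [[t i] /= [Ht Hi ->]] /=; move: Ht Hi; rewrite !mem_iota.
have cellI t i : t < N -> i < N -> (t, i) \in cells.
  by move=> Ht Hi; apply/allpairsP; exists (t, i); rewrite !mem_iota.
have codeL t i u t' i' u' : (t, i, u) \in idx -> (t', i', u') \in idx -> rk u' < rk u ->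
    code (t', i', u') < code (t, i, u) by move=> *; apply: code_lt.
have rkT j : rk (j * blk_size) = 3 by have [_ H _] := rkE (j * blk_size); apply/H/isT_mul.
have rkE' u : isElt u -> rk u = 2 by have [_ _ H] := rkE u.
have rkG j : 0 < j -> rk (j * blk_size + 1) = 4 by move=> Hj; have [H _ _] := rkE (j * blk_size + 1); apply/H/isG_mul.
have small u : u < blk_size -> u < cell_size by move=> Hu; rewrite /cell_size; nia.
have Es c (b : bool) : c < D -> isElt (c.*2 + b).+1 by rewrite /isElt /rounds; case: b; lia.
have eltP t i s : t < N -> i < N -> s < rounds ->
    exists t' i' u', [/\ elt t i s = code (t', i', u'), isElt u', (t', i', u') \in idx
      & cov (sel t i) u'.-1 s t i t' i'].
  move=> Ht Hi Hs; have Hc : s./2 < D by move: Hs; rewrite /rounds; lia.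
  have [_ Hal] := Hsel _ _ Ht Hi.
  have lE u : isElt u -> u < cell_size by case/andP=> _ H; apply: small; apply: leq_ltn_trans H Bm.
  rewrite /elt /cov Hal /=; case: ifP => _.
    exists (prevc s./2 (t, i)).1, (prevc s./2 (t, i)).2, (s./2.*2 + ib s./2 t i (sel t i)).+1.
    split; [by case: (prevc _ _)|exact: Es| |].
      rewrite mem_idx lE ?Es // andbT /prevc.
      by case: (dir _) => /=; rewrite ?Ht ?Hi ?prv_lt.
    rewrite [_.+1.-1]/= addnC half_bit_double oddD odd_double oddb addbF !eqxx /= andbT.
    by rewrite /nextc /prevc; case: (dir _); rewrite /= prvK ?eqxx.
  exists t, i, (s./2.*2 + ~~ ob s./2 t i (sel t i)).+1; split; rewrite ?Es //.
    by rewrite mem_idx Ht Hi lE ?Es.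
  by rewrite [_.+1.-1]/= addnC half_bit_double oddD odd_double oddb addbF !eqxx.
have Tin t i tau : t < N -> i < N -> tau < C -> (t, i, tau * blk_size) \in idx.
  by move=> Ht Hi Hta; rewrite mem_idx Ht Hi tile_lt.
have filP t i s q : t < N -> i < N -> s < rounds -> q \in iota (rounds + 2 ^ s - s) (2 ^ s).-1 ->
    (t, i, q) \in idx /\ rk q = 1.
  move=> Ht Hi Hs; rewrite mem_iota => /andP[H1 H2].
  have Hs2 : s < 2 ^ s by apply: ltn_expl.
  have Hq : q < blk_size.
    have := exp_gap s.+1 (rounds - s.+1); rewrite subnKC // -/blk_size expnS; lia.
  rewrite mem_idx Ht Hi small //; split=> //.
  by rewrite /rk /isGuard /isTile /isElt modn_small // !ifF //; lia.
have Alog t i : t < N -> i < N -> size (A t i) = blk_size /\ rounds <= size (glog sc rounds (A t i)).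
  move=> Ht Hi; have [Hs1 Hs2] := Hsel _ _ Ht Hi; have HT := Tin _ _ _ Ht Hi Hs1.
  suff H k : k < rounds -> [/\ size (fil t i k) = (2 ^ k).-1, elt t i k < code (t, i, sel t i * blk_size),
      forall y, y \in fil t i k -> y < elt t i k
      & sc (code (t, i, sel t i * blk_size)) (elt t i k) k.+1] by have [] := star_log H.
  move=> Hk; have [t' [i' [u' [-> Eu Hin Hcov]]]] := eltP _ _ _ Ht Hi Hk.
  split; first by rewrite size_map size_iota.
  - by apply: codeL => //; rewrite rkT rkE'.
  - by move=> y /mapP[q /(filP _ _ _ _ Ht Hi Hk)[Hq1 Hq2] ->]; apply: codeL; rewrite ?Hq2 ?rkE'.
  - rewrite /sc /scores !codeK //= isT_mul Eu Hk mulnK ?expn_gt0 // Hcov orbT //.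
have Blog t i j : t < N -> i < N -> j \in iota 1 C.-1 ->
    size (blk t i j) = blk_size /\ 0 < size (glog sc rounds (blk t i j)).
  move=> Ht Hi; rewrite mem_iota add1n prednK // => /andP[Hj0 HjC].
  have Hpi : ppi t i j < C by rewrite /ppi; case: ifP.
  have sz : size (blk t i j) = blk_size by rewrite /= size_map size_iota; lia.
  split=> //; have mm0 : rounds = 1 + rounds.-1 by rewrite /rounds; lia.
  rewrite mm0; apply: leq_trans (glog_prefix _ _); last by rewrite -mm0 sz.
  rewrite /= take0 /maxs !big_seq1 ifT // /sc.
  have HG : (t, i, j * blk_size + 1) \in idx by rewrite mem_idx Ht Hi /cell_size /=; nia.
  by rewrite !codeK ?Tin // /scores /= isG_mul // isT_mul eqxx.
have allbl : all (fun b => size b == 2 ^ rounds) bl.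
  apply/allP => b /flattenP[l /mapP[c /cellP[Ht Hi] ->]].
  rewrite inE => /orP[/eqP->|/mapP[j Hj ->]].
    by have [->] := Alog _ _ Ht Hi.
  by have [->] := Blog _ _ _ Ht Hi Hj.
have szbl : size bl = N * N * C.
  have -> : N * N = size cells by rewrite size_allpairs size_iota.
  rewrite /bl; elim: (cells) => //= c cs IH.
  by rewrite size_cat IH size_map size_iota mulSn -addSn prednK.
have [k Ek] : exists k, e = rounds + k.
  exists (e - rounds); rewrite subnKC // -(leq_exp2l (m := 2)) // -sizeE /cell_size.
  have N0 : 0 < N * N * C by have := expn_gt0 2 e; rewrite -sizeE /cell_size mulnA muln_gt0 => /andP[].
  by rewrite mulnA leq_pmull.
have szk : size bl = 2 ^ k.
  have B0 : 0 < blk_size by lia.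
  apply/eqP; rewrite -(eqn_pmul2r B0) szbl -mulnA -/cell_size sizeE Ek expnD mulnC //.
pose p := flatten bl.
have szp : size p = 2 ^ e.
  have : size p = size bl * blk_size.
    rewrite /p; elim: (bl) allbl => //= b l IH /andP[/eqP Hb Hl].
    by rewrite size_cat IH // Hb mulSn.
  by rewrite szbl -mulnA sizeE.
have inA t i y : t < N -> i < N -> y \in A t i -> y \in p.
  move=> Ht Hi Hy; apply/flattenP; exists (A t i) => //.
  apply/flattenP; exists (lay (t, i)); last by rewrite mem_head.
  by apply: map_f; apply: cellI.
have inB t i j y : t < N -> i < N -> j \in iota 1 C.-1 -> y \in blk t i j -> y \in p.
  move=> Ht Hi Hj Hy; apply/flattenP; exists (blk t i j) => //.
  apply/flattenP; exists (lay (t, i)); last by rewrite inE (map_f _ Hj) orbT.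
  by apply: map_f; apply: cellI.
have inS t i s : t < N -> i < N -> s < rounds -> elt t i s \in p /\ {subset fil t i s <= p}.
  move=> Ht Hi Hs; have H y : y \in elt t i s :: fil t i s -> y \in p.
    move=> Hy; apply: (inA t i) => //; rewrite inE; apply/orP; right.
    apply/flattenP; exists (elt t i s :: fil t i s) => //.
    by apply/mapP; exists s; rewrite ?mem_iota.
  by split=> [|y Hy]; apply: H; rewrite inE ?eqxx // Hy orbT.
(* Both lists have [2 ^ e] entries and [plist] has no repetition, so inclusion makes [p] a
   permutation. *)
have sub : {subset plist <= p}.
  move=> _ /mapP[[[t i] u] + ->]; rewrite mem_idx => /and3P[Ht Hi Hu].
  have B0 : 0 < blk_size by lia.
  have Hj : u %/ blk_size < C by rewrite ltn_divLR.
  have Hq : u %% blk_size < blk_size by rewrite ltn_pmod.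
  have [Hs1 Hs2] := Hsel _ _ Ht Hi.
  have jin j : 0 < j -> j < C -> j \in iota 1 C.-1 by rewrite mem_iota; lia.
  have [q0|q0] := posnP (u %% blk_size).
    have -> : u = u %/ blk_size * blk_size by rewrite {1}(divn_eq u blk_size) q0 addn0.
    move: (u %/ blk_size) Hj => j Hj {u Hu Hq q0}.
    have [->|ne] := eqVneq j (sel t i); first by apply: (inA t i) => //; rewrite mem_head.
    have [j0|j0] := posnP j.
      have s0 : 0 < sel t i by rewrite lt0n; apply: contra ne => /eqP->; rewrite j0.
      apply: (inB t i (sel t i)) => //; first exact: jin.
      by rewrite /blk /ppi eqxx j0 !inE eqxx orbT.
    apply: (inB t i j) => //; first exact: jin.
    by rewrite /blk /ppi (negbTE ne) !inE eqxx orbT.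
  have [j0|j0] := posnP (u %/ blk_size).
    have uB : u < blk_size by move: (divn_eq u blk_size); rewrite j0; lia.
    have u0 : 0 < u by rewrite modn_small in q0.
    have [um|um] := leqP u rounds.
      have Hc : u.-1./2 < D by move: um; rewrite /rounds; lia.
      have Eu : u = (u.-1./2.*2 + odd u.-1).+1.
        by rewrite -{1}(prednK u0) -{1}(odd_double_half u.-1) addnC.
      have := Hcsp t i _ Ht Hi Hc; set c := u.-1./2 in Hc Eu *; rewrite Eu.
      move: (odd u.-1) => b {Eu u0 um uB q0 Hq Hj j0 Hu}.
      (* An element whose bit is [~~ ob] sits in the bracket of its own cell. The other one carries
         [ob], which the constraint makes equal to [ib] of the successor, so it sits in the
         successor's bracket. *)
      have [Eb|Eb] := eqVneq b (~~ ob c t i (sel t i)).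
        move=> _; have Hs : c.*2 < rounds by rewrite ltn_double.
        have [+ _] := inS t i _ Ht Hi Hs.
        by rewrite /elt odd_double doubleK -Eb.
      have {}Eb : b = ob c t i (sel t i) by case: (b) Eb; case: (ob _ _ _ _).
      rewrite -Eb; set n := nextc c (t, i) => Ei.
      have [Hn1 Hn2] : n.1 < N /\ n.2 < N.
        by rewrite /n /nextc; case: (dir c) => /=; rewrite ?nxt_lt.
      have Hs : c.*2.+1 < rounds by rewrite /rounds; lia.
      have [+ _] := inS _ _ _ Hn1 Hn2 Hs.
      rewrite /elt /= odd_double /= uphalf_double -Ei -surjective_pairing.
      suff -> : prevc c n = (t, i) by [].
      by rewrite /n /prevc /nextc; case: (dir c); rewrite /= nxtK.
    have [|s Hs Hus] := @discrete_ivt (fun s => rounds + 2 ^ s - s) rounds u.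
      by rewrite addKn -/blk_size uB; lia.
    have [_ H] := inS t i s Ht Hi Hs; apply: H; apply: map_f.
    have Hse : s < 2 ^ s by apply: ltn_expl.
    by rewrite mem_iota; move: Hus; rewrite expnS; lia.
  have Eu := divn_eq u blk_size.
  apply: (inB t i (u %/ blk_size)) => //; first exact: jin.
  have [q1|q1] := eqVneq (u %% blk_size) 1; first by rewrite /blk {1}Eu q1 mem_head.
  rewrite /blk !inE; apply/orP; right; apply/orP; right.
  by rewrite {1}Eu; apply/mapP; exists (u %% blk_size) => //; rewrite mem_iota; lia.
apply/(tvm_yesP (sc := sc) wf_inst (fun _ _ _ => erefl) erefl); exists p.
  have szle : size p <= size plist by rewrite szp size_map size_idx.
  have [_ E] := uniq_min_size uniq_plist sub szle.
  rewrite perm_sym; apply: uniq_perm => //; first exact: uniq_plist.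
  exact: leq_size_uniq uniq_plist sub szle.
rewrite /= Ek; apply: leq_trans (glog_blocks _ allbl szk).
have -> : N * N = size cells by rewrite size_allpairs size_iota.
have -> : sumn [seq size (glog sc rounds b) | b <- bl] =
    sumn [seq sumn [seq size (glog sc rounds b) | b <- lay c] | c <- cells].
  by rewrite /bl; elim: (cells) => //= c cs <-; rewrite map_cat sumn_cat addnA.
apply: leq_sumn_map => c /cellP[Ht Hi] /=.
rewrite addnC; apply: leq_add; first by have [] := Alog _ _ Ht Hi.
have := @leq_sumn_map _ (fun j => size (glog sc rounds (blk c.1 c.2 j))) 1 (iota 1 C.-1).
rewrite size_iota muln1 -map_comp; apply => j Hj.
by have [] := Blog _ _ _ Ht Hi Hj.
Qed.

End Instance.

(** * The computation tableau on a torus *)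

Section Tableau.

Variables (M : TM) (N : nat).
Notation state := 'I_(nst M).+1.
Definition same_move (m m' : move) : bool :=
  match m, m' with
  | MLeft, MLeft | MRight, MRight | MStay, MStay => true
  | _, _ => false
  end.

Definition written (x : sym * option state) : sym :=
  if x.2 is Some q then (if halting q then x.1 else (delta q x.1).1.2) else x.1.

(** A halted head counts as staying, so a halted configuration repeats its row. *)
Definition leaves (m : move) (x : sym * option state) : option state :=
  if x.2 is Some q then
    if halting q then (if same_move m MStay then Some q else None)
    else if same_move m (delta q x.1).2 then Some (delta q x.1).1.1 else None
  else None.

Definition next_val (l s r : sym * option state) : sym * option state :=
  (written s,
   if leaves MStay s is Some q then Some q
   else if leaves MRight l is Some q then Some q else leaves MLeft r).

Definition off (i pos : nat) : nat := if pos <= i then i - pos else i + N - pos.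

(* Contents at cyclic distance [z] to the right of the head: the right part of
   the tape grows from [z = 1] upwards, the left one from [z = N - 1] downwards. *)
Definition content (c : config M) (z : nat) : sym :=
  if z == 0 then chead c
  else if z <= size (cright c) then @nth sym None (cright c) z.-1
  else @nth sym None (cleft c) (N.-1 - z).

Definition row (c : config M) (pos i : nat) : sym * option state :=
  (content c (off i pos), if i == pos then Some (cstate c) else None).

Definition cmove (c : config M) : move :=
  if halting (cstate c) then MStay else (delta (cstate c) (chead c)).2.

Definition shift (m : move) (pos : nat) : nat :=
  match m with MStay => pos | MRight => nxt N true pos | MLeft => prv N pos end.

Definition used (c : config M) : nat := size (cleft c) + size (cright c).

Lemma used_step c : used (step c) <= (used c).+1.
Proof.
case: c => q l h r; rewrite /used /=; case: ifP => _ /=; first lia.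
by case: (delta q h) => [[q' a] []] /=; [case: l|case: r|]; move=> /= *; lia.
Qed.

(** The configuration is stored relative to the head, the row absolutely: a move shifts all cyclic
    distances by one. The bound on [used] leaves a free cell on the circle, so the two ends of the
    tape do not collide in the step. *)
Lemma row_step c pos i : 2 < N -> pos < N -> i < N -> (used c).+2 <= N ->
  row (step c) (shift (cmove c) pos) i =
  next_val (row c pos (prv N i)) (row c pos i) (row c pos (nxt N true i)).
Proof.
move=> HN Hp Hi Hu; rewrite /next_val; congr pair.
- case: c Hu => q l h r; rewrite /used /cmove /row /written /= => Hu.
  case: (boolP (halting q)) => Hq /=.
    by case: eqP => [->|_] //=; rewrite Hq.
  have Hw : (if (if i == pos then Some q else None) is Some q0 then
      if halting q0 then content (Config q l h r) (off i pos)
      else (delta q0 (content (Config q l h r) (off i pos))).1.2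
      else content (Config q l h r) (off i pos)) =
    if i == pos then (delta q h).1.2 else content (Config q l h r) (off i pos).
    by case: eqP => // ->; rewrite (negbTE Hq) /off leqnn subnn.
  rewrite {}Hw; case: (delta q h) => [[q' a] m] /=.
  have Hoff : off i pos < N by rewrite /off; case: ifP; lia.
  have Hoff0 : (i == pos) = (off i pos == 0) by rewrite /off; case: ifP; lia.
  case: m => /=.
  + have -> : match l with
              | [::] => Config q' [::] None (a :: r)
              | x :: l' => Config q' l' x (a :: r)
              end = Config q' (behead l) (head None l) (a :: r) by case: (l).
    have -> : off i (prv N pos) = if off i pos == N.-1 then 0 else (off i pos).+1.
      by rewrite /off /prv; do ?case: ifP; lia.
    rewrite Hoff0; move: (off i pos) Hoff => z Hz; rewrite /content /=.
    case: (z =P N.-1) => [->|Hz1] /=.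
      do 3! [rewrite ifF; last lia].
      by rewrite subnn nth0.
    case: (z =P 0) => [->|Hz0] //=.
    rewrite ltnS; case: leqP => Hzr; first by rewrite -(prednK (n := z)) //; lia.
    by rewrite nth_behead; congr nth; lia.
  + have -> : match r with
              | [::] => Config q' (a :: l) None [::]
              | x :: r' => Config q' (a :: l) x r'
              end = Config q' (a :: l) (head None r) (behead r) by case: (r).
    have -> : off i (nxt N true pos) = if off i pos == 0 then N.-1 else (off i pos).-1.
      by rewrite /off /nxt; do ?case: ifP; lia.
    rewrite Hoff0; move: (off i pos) Hoff => z Hz; rewrite /content /= size_behead.
    case: (z =P 0) => [_|Hz0] /=.
      do 2! [rewrite ifF; last lia].
      by rewrite subnn.
    case: (z.-1 =P 0) => [z1|z1].
      have -> : z = 1 by lia.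
      by rewrite /= -nth0; case: r Hu => //= Hu; rewrite nth_default //; lia.
    have -> : (z.-1 <= (size r).-1) = (z <= size r) by lia.
    case: leqP => Hzr; first by rewrite nth_behead; congr nth; lia.
    by have -> : N.-1 - z.-1 = (N.-1 - z).+1 by lia.
  + rewrite Hoff0 /content /=; case: eqP => //.
- have D1 : prv N i != i by rewrite /prv; case: ifP; lia.
  have D2 : nxt N true i != i by rewrite /nxt; case: ifP; lia.
  have D3 : prv N i != nxt N true i by rewrite /prv /nxt; do ?case: ifP; lia.
  have ch : content c (off pos pos) = chead c by rewrite /off leqnn subnn.
  have st : cstate (step c) = if halting (cstate c) then cstate c else (delta (cstate c) (chead c)).1.1.
    case: (c) => q l h r /=; case: ifP => // _.
    by case: (delta q h) => [[q' a] []] //=; [case: l|case: r].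
  have E2 : (i == nxt N true pos) = (prv N i == pos) by rewrite /prv /nxt; do ?case: ifP; lia.
  have E3 : (i == prv N pos) = (nxt N true i == pos) by rewrite /prv /nxt; do ?case: ifP; lia.
  rewrite /row st /cmove /leaves /=.
  have [Ei|Ei] := eqVneq i pos.
    subst i; rewrite (negbTE D1) (negbTE D2) /= ch.
    case: (halting (cstate c)) => /=; first by rewrite eqxx.
    case: (delta _ _) => [[q' a] []] /=; rewrite ?eqxx //.
      by rewrite E3 (negbTE D2).
    by rewrite E2 (negbTE D1).
  have [Ep|Ep] := eqVneq (prv N i) pos.
    rewrite Ep ch; have -> : (nxt N true i == pos) = false by rewrite -Ep eq_sym (negbTE D3).
    case: (halting (cstate c)) => /=; first by rewrite (negbTE Ei).
    case: (delta _ _) => [[q' a] []] /=; rewrite ?(negbTE Ei) //.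
      by rewrite E3 -Ep eq_sym (negbTE D3).
    by rewrite E2 Ep eqxx.
  have [En|En] := eqVneq (nxt N true i) pos.
    rewrite En ch; case: (halting (cstate c)) => /=; first by rewrite (negbTE Ei).
    case: (delta _ _) => [[q' a] []] /=; rewrite ?(negbTE Ei) //.
      by rewrite E3 En eqxx.
    by rewrite E2 (negbTE Ep).
  case: (halting (cstate c)) => /=; first by rewrite (negbTE Ei).
  case: (delta _ _) => [[q' a] []] /=; rewrite ?(negbTE Ei) //.
    by rewrite E3 (negbTE En).
  by rewrite E2 (negbTE Ep).
Qed.

Fixpoint pos (c : config M) (t : nat) : nat :=
  if t is t'.+1 then shift (cmove (run t' c)) (pos c t') else 0.

Lemma pos_lt c t : 0 < N -> pos c t < N.
Proof.
move=> HN; elim: t => //= t IH; rewrite /shift /nxt /prv.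
by case: cmove => //; case: ifP; lia.
Qed.

Lemma run_halted (c : config M) t : halting (cstate c) -> run t c = c.
Proof.
move=> Hh; elim: t => //= t IH; rewrite /run /= -/(run t c) IH.
by case: c Hh {IH} => q l h r /= ->.
Qed.

Lemma run_add t t' (c : config M) : run (t + t') c = run t (run t' c).
Proof. exact: iterD. Qed.

Lemma run_halting_le t t' (c : config M) : t <= t' -> halting (cstate (run t c)) ->
  run t' c = run t c.
Proof. by move=> Ht Hh; rewrite -(subnK Ht) run_add run_halted. Qed.

(** After halting nothing more is used, so the space stays bounded in all rows, including those
    beyond time [T]. *)
Lemma used_run (c : config M) t T : halting (cstate (run T c)) -> used (run t c) <= used c + T.
Proof.
have H k : used (run k c) <= used c + k.
  elim: k => [|k IH]; first by rewrite addn0.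
  by apply: leq_trans (used_step _) _; rewrite addnS ltnS.
move=> Hh; have [Ht|Ht] := leqP t T; first by apply: leq_trans (H t) _; lia.
by rewrite (run_halting_le (ltnW Ht) Hh).
Qed.

Lemma row_init (x : seq bool) i : i < N -> x != [::] -> size x <= N ->
  row (init M x) 0 i = (nth None (map Some x) i, if i == 0 then Some ord0 else None).
Proof.
case: x => // a x Hi _ Hx; rewrite /row /off subn0 /content /=; congr pair.
case: i Hi => [|i] Hi //=; rewrite size_map.
by case: leqP => // H; rewrite !nth_default // size_map.
Qed.

Lemma used_init (x : seq bool) : used (init M x) = (size x).-1.
Proof. by case: x => //= a x; rewrite /used /= size_map. Qed.

Variables (d0 d1 : nat -> bool).

Definition val0 : sym * option state := (None, None).
Definition vals : seq (sym * option state) := enum {: sym * option state}.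
Definition tiles := enum {: (sym * option state) * (sym * option state) * (sym * option state)}.
Definition tileof tau := nth (val0, val0, val0) tiles tau.
(** Rounded up to a power of two for the sake of the number of players; [alb] forbids the surplus
    indices. *)
Definition ntiles := 2 ^ size tiles.
(** Three agreements are needed: a cell's guess of its right neighbour, that neighbour's guess of
    the cell, and the next row. Each becomes one bit comparison per possible value. *)
Definition nconstr := 3 * size vals.
Definition vof c := nth val0 vals (c %% size vals).

Definition obb (c tau : nat) (lst : bool) : bool :=
  let: (l, s, r) := tileof tau in
  match c %/ size vals with
  | 0 => r == vof c
  | 1 => s == vof c
  | _ => ~~ lst && (next_val l s r == vof c)
  end.

Definition ibb (c tau : nat) (fst : bool) : bool :=
  let: (l, s, r) := tileof tau in
  match c %/ size vals with
  | 0 => s == vof c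
  | 1 => l == vof c
  | _ => ~~ fst && (s == vof c)
  end.

Definition dirc (c : nat) : bool := c %/ size vals == 2.

(** [b0] and [b1] say which bits a cell may hold; neither means blank, both mean a free witness
    cell. A free cell may be blank only if its right neighbour is, which makes the guessed contents
    a word followed by blanks. *)
Definition init_ok (s r : sym * option state) (i0 b0 b1 : bool) : bool :=
  (s.2 == if i0 then Some ord0 else None) &&
  match b0, b1 with
  | false, false => s.1 == None
  | true, false => s.1 == Some false
  | false, true => s.1 == Some true
  | true, true => (s.1 != None) || (r.1 == None)
  end.

Definition alb (tau : nat) (fst lst i0 b0 b1 : bool) : bool :=
  let: (l, s, r) := tileof tau in
  [&& tau < size tiles, fst ==> init_ok s r i0 b0 b1 &
      lst ==> (if s.2 is Some q then accepting q else true)].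

Definition alc t i tau := alb tau (t == 0) (nxt N true t == 0) (i == 0) (d0 i) (d1 i).
Definition obc c (t i : nat) tau := obb c tau (nxt N true t == 0).
Definition ibc c (t i : nat) tau := ibb c tau (t == 0).

Lemma vals_gt0 : 0 < size vals.
Proof. by rewrite -cardE; apply/card_gt0P; exists val0. Qed.

Lemma constraint_of k v : k < 3 -> exists c, [/\ c < nconstr, c %/ size vals = k & vof c = v].
Proof.
move=> Hk; have Hv : index v vals < size vals by rewrite index_mem mem_enum.
exists (k * size vals + index v vals); split.
- by rewrite /nconstr; nia.
- by rewrite divnMDl ?vals_gt0 // divn_small // addn0.
- by rewrite /vof modnMDl modn_small // nth_index // mem_enum.
Qed.

Lemma eq_of_tests (x y : sym * option state) : (forall v, (x == v) = (y == v)) -> x = y.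
Proof. by move/(_ y); rewrite eqxx => /eqP. Qed.

Lemma fall_out_word (s : seq sym) :
  (forall j, j.+1 < size s -> nth None s j = None -> nth None s j.+1 = None) ->
  forall j, nth None s j = nth None (map Some (out_word s)) j.
Proof.
elim: s => [|[b|] s IH] H j /=; first by rewrite !nth_nil.
- by case: j => //= j; apply: IH => k Hk Hn; apply: (H k.+1).
- rewrite nth_nil; elim: j => //= j Hj.
  have [Hs|Hs] := ltnP j (size s); last by rewrite nth_default.
  by apply: (H j).
Qed.

Lemma size_out_word s : size (out_word s) <= size s.
Proof. by elim: s => //= -[b|] s IH. Qed.

Lemma tableau_csp (u : seq bool) W T : u != [::] ->
  (forall i, d0 i = if i < size u then ~~ nth false u i else i < size u + W) ->
  (forall i, d1 i = if i < size u then nth false u i else i < size u + W) ->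
  2 < N -> T < N -> size u + W + T + 2 <= N ->
  (forall w : seq bool, size w <= W -> halting (cstate (run T (init M (u ++ w))))) ->
  (exists sel, csp N ntiles nconstr alc obc ibc dirc sel) <->
  (exists2 w : seq bool, size w <= W & accepting (cstate (run T (init M (u ++ w))))).
Proof.
move=> u0 Hd0 Hd1 HN HT Hsz Hhalt.
have prv_l i : i < N -> prv N i < N by apply: prv_lt.
have nxt_l i : i < N -> nxt N true i < N by apply: nxt_lt.
have last_row t : t < N -> (nxt N true t == 0) = (t == N.-1).
  by move=> Ht; rewrite /nxt; case: ifP; lia.
have rowS (w : seq bool) t i : size w <= W -> i < N ->
    row (run t.+1 (init M (u ++ w))) (pos (init M (u ++ w)) t.+1) i =
    next_val (row (run t (init M (u ++ w))) (pos (init M (u ++ w)) t) (prv N i))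
             (row (run t (init M (u ++ w))) (pos (init M (u ++ w)) t) i)
             (row (run t (init M (u ++ w))) (pos (init M (u ++ w)) t) (nxt N true i)).
  move=> Hw Hi; apply: (row_step (c := run t (init M (u ++ w)))) => //.
    by apply: pos_lt; lia.
  have := used_run t (Hhalt w Hw); rewrite used_init size_cat; lia.
have row0 (w : seq bool) i : size w <= W -> i < N -> row (init M (u ++ w)) 0 i =
    (nth None (map Some (u ++ w)) i, if i == 0 then Some ord0 else None).
  move=> Hw Hi; apply: row_init => //; last by rewrite size_cat; lia.
  by case: (u) u0.
split.
- move=> [sel [Hal Hc]].
  pose ti t i := tileof (sel t i); pose V t i := (ti t i).1.2.
  have HVr t i : t < N -> i < N -> (ti t i).2 = V t (nxt N true i).
    move=> Ht Hi; apply: eq_of_tests => v.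
    have [c [Hc1 Hk Ev]] := constraint_of v (isT : 0 < 3).
    have := Hc t i c Ht Hi Hc1; rewrite /nextc /dirc Hk /= /obc /ibc /obb /ibb Hk Ev.
    by rewrite /V /ti; case: (tileof _) => [[? ?] ?]; case: (tileof _) => [[? ?] ?].
  have HVl t i : t < N -> i < N -> V t i = (ti t (nxt N true i)).1.1.
    move=> Ht Hi; apply: eq_of_tests => v.
    have [c [Hc1 Hk Ev]] := constraint_of v (isT : 1 < 3).
    have := Hc t i c Ht Hi Hc1; rewrite /nextc /dirc Hk /= /obc /ibc /obb /ibb Hk Ev.
    by rewrite /V /ti; case: (tileof _) => [[? ?] ?]; case: (tileof _) => [[? ?] ?].
  have HVt t i : t.+1 < N -> i < N -> V t.+1 i = next_val (ti t i).1.1 (V t i) (ti t i).2.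
    move=> Ht Hi; apply: eq_of_tests => v.
    have [c [Hc1 Hk Ev]] := constraint_of v (isT : 2 < 3).
    have Hn : nxt N true t = t.+1 by rewrite /nxt ifF //; lia.
    have := Hc t i c (ltnW Ht) Hi Hc1; rewrite /nextc /dirc Hk /= /obc /ibc /obb /ibb Hk Ev Hn /=.
    by rewrite /V /ti; case: (tileof _) => [[? ?] ?]; case: (tileof _) => [[? ?] ?] /= ->.
  have HV t i : t.+1 < N -> i < N ->
      V t.+1 i = next_val (V t (prv N i)) (V t i) (V t (nxt N true i)).
    move=> Ht Hi; rewrite HVt // HVr ?(ltnW Ht) //; congr next_val.
    by rewrite HVl ?prvK ?prv_l // ltnW.
  have Hinit i : i < N -> init_ok (V 0 i) (V 0 (nxt N true i)) (i == 0) (d0 i) (d1 i).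
    move=> Hi; have [_] := Hal 0 i (ltnW (ltnW HN)) Hi.
    rewrite -HVr /V /ti /alc /alb //=; last lia.
    by case: (tileof _) => [[? ?] ?] /and3P[_ ->].
  (* The witness is read off the free cells of row 0. *)
  pose fs := [seq (V 0 (size u + j)).1 | j <- iota 0 W].
  pose w := out_word fs.
  have Hw : size w <= W by have := size_out_word fs; rewrite size_map size_iota.
  have fsE j : nth None fs j = nth None (map Some w) j.
    apply: fall_out_word => {}j; rewrite size_map size_iota => Hj.
    rewrite !(nth_map 0) ?size_iota ?nth_iota //; try lia.
    have Hi : size u + j < N by lia.
    have Hn : nxt N true (size u + j) = size u + j.+1 by rewrite /nxt ifF; lia.
    have H1 : (size u + j < size u) = false by lia.
    have H2 : size u + j < size u + W by lia.
    have := Hinit _ Hi; rewrite /init_ok Hd0 Hd1 Hn H1 H2.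
    by case/andP=> _ /orP[/eqP ne E|/eqP //].
  have HR t : t < N -> forall i, i < N ->
      V t i = row (run t (init M (u ++ w))) (pos (init M (u ++ w)) t) i.
    elim: t => [_ i Hi|t IH Ht i Hi]; last first.
      by rewrite rowS // HV // !IH ?prv_l ?nxt_l // ltnW.
    rewrite /= row0 //; have := Hinit i Hi; rewrite /init_ok Hd0 Hd1 => /andP[/eqP E2].
    rewrite [LHS]surjective_pairing E2 => E1; congr pair.
    rewrite map_cat nth_cat size_map; case: ltnP E1 => Hu.
      by rewrite (nth_map false) //; case: (nth false u i) => /= /eqP.
    have [HW|HW] := ltnP i (size u + W).
      move=> _; rewrite -fsE (nth_map 0) ?size_iota ?nth_iota; try lia.
      by rewrite add0n subnKC.
    by move=> /eqP->; rewrite nth_default // size_map; lia.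
  exists w => //.
  (* As [T < N] the machine has halted by the last row, whose acceptance test is read at the head
     position. *)
  have HN1 : N.-1 < N by lia.
  have Hpos : pos (init M (u ++ w)) N.-1 < N by apply: pos_lt; lia.
  have [_] := Hal _ _ HN1 Hpos; rewrite /alc /alb last_row // eqxx.
  have := HR _ HN1 _ Hpos; rewrite /V /ti; case: (tileof _) => [[l s] r] /= ->.
  case/and3P=> _ _; rewrite /row /= eqxx.
  by rewrite (@run_halting_le T) ?Hhalt //; lia.
- move=> [w Hw Hacc].
  pose V t i := row (run t (init M (u ++ w))) (pos (init M (u ++ w)) t) i.
  pose sel t i := index (V t (prv N i), V t i, V t (nxt N true i)) tiles.
  have selT t i : sel t i < size tiles by rewrite index_mem mem_enum.
  have tileE t i : tileof (sel t i) = (V t (prv N i), V t i, V t (nxt N true i)).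
    by rewrite /tileof nth_index // mem_enum.
  exists sel; split=> [t i Ht Hi|t i c Ht Hi Hc].
    split; first by apply: ltn_trans (selT t i) _; apply: ltn_expl.
    rewrite /alc /alb tileE selT /=; apply/andP; split; apply/implyP.
      move/eqP=> ->; rewrite /V /= !row0 ?nxt_l // /init_ok /= eqxx /= Hd0 Hd1.
      rewrite !map_cat !nth_cat !size_map; case: ltnP => Hu.
        by rewrite (nth_map false) //; case: (nth false u i).
      have [HW|HW] := ltnP i (size u + W); last by rewrite nth_default // size_map; lia.
      have [Hw1|Hw1] := ltnP (i - size u) (size w); first by rewrite (nth_map false).
      have Hn : nxt N true i = i.+1 by rewrite /nxt ifF //; lia.
      by rewrite Hn !nth_default ?size_map //= ?ifF // ?nth_default ?size_map //; lia.
    rewrite last_row // => /eqP->; rewrite /V /row /=; case: eqP => // _.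
    by rewrite (@run_halting_le T) ?Hhalt //; lia.
  rewrite /obc /ibc /obb /ibb /nextc /dirc !tileE.
  case E: (c %/ size vals) => [|[|k]] //=.
    by rewrite nxtK.
  have -> : k = 0.
    have : c %/ size vals < 3 by rewrite ltn_divLR ?vals_gt0.
    by rewrite E; lia.
  (* On the seam from the last row to row 0 both sides of the constraint are false. *)
  rewrite /= last_row //; case: (t =P N.-1) => [->|Hne] //=.
  have -> : nxt N true t = t.+1 by rewrite /nxt ifF //; lia.
  by rewrite /= /V rowS.
Qed.

End Tableau.

(** * The reduction as two comprehension programs *)

Definition dbl (s : seq bool) : seq bool := flatten [seq [:: b; b] | b <- s].

Lemma dbl_cat s1 s2 : dbl (s1 ++ s2) = dbl s1 ++ dbl s2.
Proof. by rewrite /dbl map_cat flatten_cat. Qed.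

Lemma dbl_nseq n b : dbl (nseq n b) = flatten (nseq n [:: b; b]).
Proof. by rewrite /dbl map_nseq. Qed.

Lemma map_const_nseq (T1 T2 : Type) (a : T2) (s : seq T1) : [seq a | _ <- s] = nseq (size s) a.
Proof. by elim: s => //= x s ->. Qed.

Lemma flatten_nseq_add (T : Type) m n (s : seq T) :
  flatten (nseq (m + n) s) = flatten (nseq m s) ++ flatten (nseq n s).
Proof. by rewrite nseqD flatten_cat. Qed.

Lemma flatten_nseq_mul (T : Type) m n (s : seq T) :
  flatten (nseq m (flatten (nseq n s))) = flatten (nseq (m * n) s).
Proof. by elim: m => //= m ->; rewrite mulSn flatten_nseq_add. Qed.

Lemma flatten_map_allpairs (T1 T2 T3 T4 : Type) (h : T1 -> T2 -> T3) (f : T3 -> seq T4) s1 s2 :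
  flatten [seq f x | x <- [seq h a b | a <- s1, b <- s2]] =
  flatten [seq flatten [seq f (h a b) | b <- s2] | a <- s1].
Proof. by elim: s1 => //= a s1 IH; rewrite map_cat flatten_cat IH -map_comp. Qed.

Definition lseqs (ps : seq lprog) : lprog := foldr LSeq LSkip ps.

(** A complete decision tree: each leaf knows all answers, so any Boolean function of them is
    evaluated while the program is built. *)
Fixpoint ltree (ts : seq (nat * bool * nat)) (acc : seq bool) (k : seq bool -> lprog) : lprog :=
  if ts is (j, s, q) :: ts' then
    LIf j s q (ltree ts' (rcons acc true) k) (ltree ts' (rcons acc false) k)
  else k acc.

(** On a track marking a prefix this repeats [p] as often as the prefix is long: the way to count to
    something other than the number of blocks. *)
Definition ploop (l q : nat) (p : lprog) : lprog := LFor (LIf l false q p LSkip).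

Fixpoint lout (N : nat) (p : lprog) : nat :=
  match p with
  | LSkip => 0
  | LEmit s => size s
  | LSeq p1 p2 | LIf _ _ _ p1 p2 => lout N p1 + lout N p2
  | LFor p1 => N * lout N p1
  end.

Section Sem.

Variables (d N : nat) (st : nat -> nat -> bool).

Lemma lsem_for l env p : lsem d N st l env (LFor p) =
  flatten [seq lsem d N st l.+1 (upd env l v) p | v <- iota 0 N].
Proof. by []. Qed.

Lemma lsem_lseqs l env ps :
  lsem d N st l env (lseqs ps) = flatten [seq lsem d N st l env p | p <- ps].
Proof. by elim: ps => //= p ps ->. Qed.

Lemma lok_lseqs w l ps : lok d w l (lseqs ps) = all (lok d w l) ps.
Proof. by elim: ps => //= p ps ->. Qed.

Lemma lsem_ltree l env ts acc k :
  lsem d N st l env (ltree ts acc k) = lsem d N st l env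
    (k (acc ++ [seq trk d st env t.2 (nxt N t.1.2 (env t.1.1)) | t <- ts])).
Proof.
elim: ts acc => [|[[j s] q] ts IH] acc /=; first by rewrite cats0.
by case: trk; rewrite IH cat_rcons.
Qed.

Lemma lok_ltree w l ts acc k : all (fun t => (t.1.1 < l) && (t.2 < w)) ts ->
  (forall bs, lok d w l (k bs)) -> lok d w l (ltree ts acc k).
Proof.
move=> + Hk; elim: ts acc => [|[[j s] q] ts IH] acc //= /andP[/andP[-> ->] Hts] /=.
by rewrite !IH.
Qed.

Lemma lsem_ploop l env q p n : n <= N ->
  (forall v, v < N -> trk d st (upd env l v) q v = (v < n)) ->
  lsem d N st l env (ploop l q p) =
  flatten [seq lsem d N st l.+1 (upd env l v) p | v <- iota 0 n].
Proof.
move=> Hn Hq; rewrite /= -(subnKC Hn) iotaD map_cat flatten_cat add0n.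
set F := fun v => _.
have -> : [seq F v | v <- iota n (N - n)] = [seq [::] | v <- iota n (N - n)].
  apply/eq_in_map => v; rewrite mem_iota => Hv; rewrite /F {2}/upd eqxx /nxt Hq; last lia.
  by rewrite ifF //; lia.
rewrite map_const_nseq (_ : flatten (nseq _ _) = [::]); last by elim: (size _).
rewrite cats0; congr flatten; apply/eq_in_map => v; rewrite mem_iota /= => Hv.
by rewrite /F {2}/upd eqxx /nxt Hq ?Hv //; lia.
Qed.

Lemma size_lsem l env p : size (lsem d N st l env p) <= lout N p.
Proof.
elim: p l env => //= [p1 IH1 p2 IH2|j s q p1 IH1 p2 IH2|p IH] l env.
- by rewrite size_cat leq_add.
- by case: ifP => _; [apply: leq_trans (IH1 _ _) _|apply: leq_trans (IH2 _ _) _]; lia.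
- rewrite size_flatten /shape -map_comp; rewrite -[X in X * _](size_iota 0 N).
  by elim: (iota 0 N) => //= v s IHs; rewrite mulSn leq_add.
Qed.

End Sem.

Lemma lout_mono N N' p : N <= N' -> lout N p <= lout N' p.
Proof. by move=> H; elim: p => //= [p1 ? p2 ?|_ _ _ p1 ? p2 ?|p IH]; rewrite ?leq_add ?leq_mul. Qed.

Lemma lout_polyb f p : polyb f -> polyb (fun n => lout (f n) p).
Proof.
move=> Hf; elim: p => [|s|p1 IH1 p2 IH2|_ _ _ p1 IH1 p2 IH2|p IH] /=;
  try exact: polyb_const; try exact: polyb_add; exact: polyb_mul.
Qed.

(** * The first pass: a template of the initial row *)

Section ReductionA.

Variables (c k cR kR : nat).

Definition fx (b : bool) : seq bool := [:: ~~ b; b].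
Definition free : seq bool := [:: true; true].
Definition blank : seq bool := [:: false; false].

Definition template (x : seq bool) (R : nat) : seq (seq bool) :=
  map fx (sd x) ++ nseq (pbound c k (size x)) free ++ nseq R blank.

Let d := maxn 1 (maxn k kR).

Fixpoint xpow (l e : nat) (s : seq bool) : lprog :=
  if e is e'.+1 then ploop l d (xpow l.+1 e' s) else LEmit s.
Fixpoint npow (e : nat) (s : seq bool) : lprog :=
  if e is e'.+1 then LFor (npow e' s) else LEmit s.

(** The number of free cells must be exactly the witness bound, so it is produced by loops over the
    input positions. The blank padding need only be large enough, so it loops over all blocks. *)
Definition progA : lprog := lseqs
  [:: ploop 0 d (LIf 0 false (d + 6) (LEmit (fx true ++ fx true)) (LEmit (fx false ++ fx false)));
      LEmit (fx false ++ fx true);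
      xpow 0 k (flatten (nseq c free));
      LEmit (flatten (nseq c free));
      npow kR (flatten (nseq cR.*2 blank))].

Lemma lok_progA : lok d (d + 6 + 1) 0 progA.
Proof.
have Hx e l s : l + e <= d -> lok d (d + 6 + 1) l (xpow l e s).
  elim: e l => //= e IH l H; rewrite IH; last lia.
  by rewrite ltnS leqnn !andbT /=; apply/andP; split; lia.
have Hn e l s : l + e <= d -> lok d (d + 6 + 1) l (npow e s).
  by elim: e l => //= e IH l H; rewrite IH; [rewrite andbT|]; lia.
rewrite lok_lseqs /= Hx; last by rewrite /d; lia.
rewrite Hn; last by rewrite /d; lia.
by rewrite !andbT /= /d; apply/andP; split; lia.
Qed.

Lemma tout_progA x :
  transduced d 0 progA [seq [:: b] | b <- x] =
  flatten (template x (cR.*2 * (2 ^ kap 0 (size x)) ^ kR)).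
Proof.
rewrite /transduced size_map; set kk := kap 0 (size x); set ds := [seq [:: b] | b <- x].
set st := stat _ _ _ _; set N := 2 ^ kk.
have szN : size x <= N := leq_exp_kap 0 (size x).
have pres env v : trk d st env d v = (v < size x).
  by rewrite /trk /st /stat ltnn eqxx size_map.
have Hx e l env s : lsem d N st l env (xpow l e s) = flatten (nseq (size x ^ e) s).
  elim: e l env => [|e IH] l env; first by rewrite /= cats0.
  rewrite [xpow _ _ _]/= (@lsem_ploop _ _ _ _ _ _ _ (size x)) //.
  rewrite (@eq_map _ _ _ (fun=> flatten (nseq (size x ^ e) s))); last by move=> v; apply: IH.
  by rewrite map_const_nseq size_iota flatten_nseq_mul -expnS.
have Hn e l env s : lsem d N st l env (npow e s) = flatten (nseq (N ^ e) s).
  elim: e l env => [|e IH] l env; first by rewrite /= cats0.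
  rewrite /= (@eq_map _ _ _ (fun=> flatten (nseq (N ^ e) s))); last by move=> v; apply: IH.
  by rewrite map_const_nseq size_iota flatten_nseq_mul -expnS.
rewrite lsem_lseqs !map_cons Hx Hn.
rewrite (@lsem_ploop _ _ _ _ _ _ _ (size x)) //.
rewrite /= cats0 /template !flatten_cat /sd map_cat flatten_cat -!catA /=.
rewrite !flatten_nseq_mul /pbound flatten_nseq_add -!catA.
congr (_ ++ _); last by rewrite mulnC [cR.*2 * _]mulnC.
have -> : flatten [seq fx i | i <- flatten [seq [:: b; b] | b <- x]] =
          flatten [seq fx b ++ fx b | b <- x].
  by elim: (x) => //= b s ->.
rewrite -[in RHS](mkseq_nth false x) /mkseq -map_comp; congr flatten; apply/eq_in_map => v.
rewrite mem_iota => /= Hv; rewrite /nxt.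
have -> : trk d st (upd (fun=> 0) 0 v) (d + 6) v = nth false x v.
  rewrite /trk (_ : d + 6 < d = false); last lia.
  rewrite /st /stat; do 6! [rewrite ifF; last lia].
  by rewrite subnn (nth_map false).
by case: (nth false x v).
Qed.

End ReductionA.

Arguments ltree : simpl never.

(** * The second pass: printing the tournament *)

Section ReductionB.

Variable M : TM.
Let C := ntiles M.
Let D := nconstr M.
Let m := rounds D.
Let U := cell_size C D.
(** There are [N * N * C * 2 ^ m] players with [N = 2 ^ kap] and [C = 2 ^ size (tiles M)], so the
    number of rounds exceeds [kap.*2] by this constant. *)
Definition numeral_offset : nat := size (tiles M) + m.

Definition enc_bit (b : bool) : seq bool := enc_int (Posz b).

(* With five variables the tracks are: 6 the prefix of length [kap], 7 and 8
   the ones and zeros of the numeral, 9 the mark on block 0, 11 and 12 the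
   input symbol. *)
Definition kloop (l : nat) (s : seq bool) : lprog := ploop l 6 (LEmit s).

(** Variables 0 to 3 are the cells [(t, i)] and [(t', i')] of the two players. The nine answers are
    all that [scores] depends on besides the constants [u], [u'] and [r]. *)
Definition cell_tests : seq (nat * bool * nat) :=
  [:: (0, false, 9); (0, true, 9); (1, false, 9); (1, false, 11); (1, false, 12);
      (0, false, 2); (1, false, 3); (2, true, 0); (3, true, 1)].

Definition scores_bits (u u' r : nat) (bs : seq bool) : bool :=
  let b := nth false bs in
  let tau := u %/ blk_size D in let v := u'.-1 in let s := r.-1 in
  [&& isGuard D u, isTile D u', r == 1, b 5 & b 6] ||
  [&& isTile D u, isElt D u', 0 < r <= m &
    [&& alb M tau (b 0) (b 1) (b 2) (b 3) (b 4), v./2 == s./2 &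
      if odd s then
        (if dirc M s./2 then b 7 && b 6 else b 5 && b 8) && (odd v == ibb M s./2 tau (b 0))
      else (b 5 && b 6) && (odd v == ~~ obb M s./2 tau (b 1))]].

(** Only rounds 1 to [m] can score. The values of the remaining [kap.*2 + size (tiles M)] rounds are
    zeros, printed by two loops over the prefix track and a constant word. *)
Definition cell_prog (u u' : nat) : lprog := lseqs
  [:: lseqs [seq ltree cell_tests [::] (fun bs => LEmit (enc_bit (scores_bits u u' r bs))) | r <- iota 1 m];
      kloop 4 (enc_bit false); kloop 4 (enc_bit false);
      LEmit (flatten (nseq (size (tiles M)) (enc_bit false)))].

Definition onehot_prog (j : nat) : lprog :=
  LFor (LIf 2 false j (LEmit [:: true; true]) (LEmit [:: false; false])).

Definition player_prog (u : nat) : lprog := lseqs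
  [:: onehot_prog 0; onehot_prog 1;
      LEmit (dbl (bin (rk D u * U + u)) ++ [:: false; true])].

(** The numeral of [2 ^ e] is [e] zeros and a one. That of the target is [kap.*2] zeros and a
    constant numeral, preceded by the doubled sign bit. *)
Definition progB : lprog := lseqs
  [:: LFor (LIf 0 false 7 (LEmit [:: true; true]) (LIf 0 false 8 (LEmit [:: false; false]) LSkip));
      LEmit [:: false; true];
      kloop 0 [:: false; false]; kloop 0 [:: false; false];
      LEmit (dbl (nseq numeral_offset false ++ [:: true]) ++ [:: false; true]);
      LFor (LFor (lseqs [seq player_prog u | u <- iota 0 U]));
      LFor (LFor (lseqs [seq LFor (LFor (lseqs [seq cell_prog u u' | u' <- iota 0 U])) | u <- iota 0 U]));
      LEmit [:: false; false];
      kloop 0 [:: false; false]; kloop 0 [:: false; false];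
      LEmit (dbl (bin (C.-1 + m)) ++ [:: false; true])].

Lemma lok_cell u u' : lok 5 13 4 (cell_prog u u').
Proof.
by rewrite lok_lseqs /= lok_lseqs andbT all_map; apply/allP => r _; apply: lok_ltree.
Qed.

Lemma lok_progB : lok 5 (5 + 6 + 2) 0 progB.
Proof.
rewrite lok_lseqs /= !lok_lseqs !andbT !all_map; apply/andP; split.
  by apply/allP.
apply/allP => u _ /=; rewrite lok_lseqs all_map.
by apply/allP => u' _; apply: lok_cell.
Qed.

Variable ds : seq (seq bool).
Let kk := kap numeral_offset (size ds).
Let N := 2 ^ kk.
Let e := kk.*2 + numeral_offset.
Let st := stat 5 kk ds (bin e).
Definition dbit (a i : nat) : bool := nth false (nth [::] ds i) a.

Definition instB : tvm_instance :=
  inst N C D e (alc M N (dbit 0) (dbit 1)) (obc M N) (ibc M) (dirc M).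

Lemma nconstr_gt0 : 0 < D.
Proof. by rewrite muln_gt0 vals_gt0. Qed.

Lemma ntiles_gt0 : 0 < C.
Proof. by rewrite expn_gt0. Qed.

Lemma sizeB : N * N * U = 2 ^ e.
Proof. by rewrite /N /U /cell_size /blk_size /C /ntiles -!expnD addnn. Qed.

Lemma kk_le : kk <= N.
Proof. exact: ltnW (ltn_expl _ _). Qed.

Lemma size_bin_e : size (bin e) <= N.
Proof. exact: leq_trans (size_bin _) (numeral_fits (kap_ge _ _)). Qed.

Lemma lsem_kloop l env s : l < 5 -> lsem 5 N st l env (kloop l s) = flatten (nseq kk s).
Proof.
move=> Hl; rewrite (@lsem_ploop _ _ _ _ _ _ _ kk) ?kk_le //.
by rewrite map_const_nseq size_iota.
Qed.

Lemma lsem_numeral env :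
  lsem 5 N st 0 env (LFor (LIf 0 false 7 (LEmit [:: true; true])
    (LIf 0 false 8 (LEmit [:: false; false]) LSkip))) = dbl (bin e).
Proof.
have -> : dbl (bin e) = flatten [seq (if v < size (bin e) then
    [:: nth false (bin e) v; nth false (bin e) v] else [::]) | v <- iota 0 N].
  rewrite -(subnKC size_bin_e) iotaD map_cat flatten_cat add0n.
  have -> : [seq (if v < size (bin e) then [:: nth false (bin e) v; nth false (bin e) v]
      else [::]) | v <- iota (size (bin e)) (N - size (bin e))] =
      [seq [::] | v <- iota (size (bin e)) (N - size (bin e))].
    by apply/eq_in_map => v; rewrite mem_iota => /andP[Hv _]; rewrite ltnNge Hv.
  rewrite map_const_nseq (_ : flatten (nseq _ _) = [::]); last by elim: (size (iota _ _)).
  rewrite cats0 /dbl -{1}(mkseq_nth false (bin e)) /mkseq -map_comp; congr flatten.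
  by apply/eq_in_map => v; rewrite mem_iota /= => ->.
congr flatten; apply: eq_map => v.
rewrite /lsem /trk /st /stat /upd /nxt /=.
by case: ltnP => Hv; [case: (nth _ _ _)|rewrite nth_default].
Qed.

Definition env2 t i := upd (upd (fun=> 0) 0 t) 1 i.
Definition env4 t i t' i' := upd (upd (env2 t i) 2 t') 3 i'.

Lemma lsem_onehot j t i : j < 2 ->
  lsem 5 N st 2 (env2 t i) (onehot_prog j) = dbl (onehot N (env2 t i j)).
Proof.
move=> Hj; rewrite /dbl /onehot -map_comp; congr flatten; apply: eq_map => v /=.
have -> : trk 5 st (upd (env2 t i) 2 v) j (nxt N false (upd (env2 t i) 2 v 2)) = (env2 t i j == v).
  by case: j Hj => [|[|]].
by case: eqP.
Qed.

Lemma lsem_player t i u :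
  lsem 5 N st 2 (env2 t i) (player_prog u) = sd (label N C D (t, i, u)).
Proof.
rewrite lsem_lseqs !map_cons !lsem_onehot //= cats0 /sd -/(dbl _) /label !dbl_cat /=.
by rewrite -!catA.
Qed.

Lemma lsem_cell t i t' i' u u' :
  lsem 5 N st 4 (env4 t i t' i') (cell_prog u u') =
  flatten [seq enc_bit (scores N D (alc M N (dbit 0) (dbit 1)) (obc M N) (ibc M) (dirc M)
                           (t, i, u) (t', i', u') r) | r <- iota 1 e].
Proof.
set G := scores N D _ _ _ _ _ _.
have -> : e = m + (kk.*2 + size (tiles M)) by rewrite /e /numeral_offset; lia.
rewrite iotaD map_cat flatten_cat lsem_lseqs !map_cons !lsem_kloop // lsem_lseqs.
rewrite [flatten (_ :: _)]/=; congr (_ ++ _).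
  rewrite -map_comp; congr flatten; apply/eq_in_map => r; rewrite mem_iota => Hr.
  rewrite /comp lsem_ltree cat0s -[LHS]/(enc_bit _); congr enc_bit.
  have -> : [seq trk 5 st (env4 t i t' i') x.2 (nxt N x.1.2 (env4 t i t' i' x.1.1)) | x <- cell_tests]
    = [:: t == 0; nxt N true t == 0; i == 0; dbit 0 i; dbit 1 i; t' == t; i' == i;
          t == nxt N true t'; i == nxt N true i'].
    by rewrite /cell_tests /= /trk /st /stat /=.
  rewrite /G /scores /scores_bits /cov /nextc /alc /obc /ibc -/m /=; congr orb.
    by rewrite xpair_eqE [t' == t]eq_sym [i' == i]eq_sym.
  congr (_ && (_ && (_ && (_ && (_ && _))))); case: odd; congr andb.
    by case: (dirc _ _); rewrite xpair_eqE; congr andb; rewrite eq_sym.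
have -> : [seq enc_bit (G r) | r <- iota (1 + m) (kk.*2 + size (tiles M))] =
    [seq enc_bit false | r <- iota (1 + m) (kk.*2 + size (tiles M))].
  apply/eq_in_map => r; rewrite mem_iota => /andP[Hr _]; congr enc_bit.
  have m2 : 1 < m by have := nconstr_gt0; rewrite /m /rounds; lia.
  rewrite /G /scores /= (_ : r == 1 = false); last lia.
  by rewrite (_ : 0 < r <= m = false) ?andbF //; apply/andP; lia.
rewrite map_const_nseq size_iota cats0 -addnn !flatten_nseq_add -!catA.
by congr (_ ++ (_ ++ _)); elim: (size (tiles M)).
Qed.

Lemma flat_idx (F : nat * nat * nat -> seq bool) :
  flatten [seq F x | x <- idx N C D] =
  flatten [seq flatten [seq flatten [seq F (t, i, u) | u <- iota 0 U] | i <- iota 0 N] | t <- iota 0 N].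
Proof. by rewrite flatten_map_allpairs flatten_map_allpairs. Qed.

Lemma tout_progB : transduced 5 numeral_offset progB ds = enc_instance instB.
Proof.
rewrite /transduced -/kk -/e -/N -/st lsem_lseqs !map_cons lsem_numeral !lsem_kloop //.
have D0 := nconstr_gt0; have C0 := ntiles_gt0; have sz := sizeB.
have szp : size (plist N C D) = 2 ^ e by rewrite size_map (size_idx sz).
have Hplayers : lsem 5 N st 0 (fun=> 0) (LFor (LFor (lseqs [seq player_prog u | u <- iota 0 U])))
    = flatten [seq enc_nat a | a <- plist N C D].
  rewrite -map_comp flat_idx lsem_for; congr flatten; apply: eq_map => t.
  rewrite lsem_for; congr flatten; apply: eq_map => i; rewrite lsem_lseqs -map_comp; congr flatten.
  apply: eq_map => u; rewrite [LHS]lsem_player /= /enc_nat.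
  by rewrite (bin_code D0 C0 sz).
have Hmatrix : lsem 5 N st 0 (fun=> 0) (LFor (LFor (lseqs
      [seq LFor (LFor (lseqs [seq cell_prog u u' | u' <- iota 0 U])) | u <- iota 0 U])))
   = flatten [seq flatten [seq flatten [seq enc_int (gval instB a b r) | r <- iota 1 e]
       | b <- plist N C D] | a <- plist N C D].
  pose g := scores N D (alc M N (dbit 0) (dbit 1)) (obc M N) (ibc M) (dirc M).
  have -> : [seq flatten [seq flatten [seq enc_int (gval instB a b r) | r <- iota 1 e]
       | b <- plist N C D] | a <- plist N C D] =
     [seq flatten [seq flatten [seq enc_bit (g x y r) | r <- iota 1 e]
       | y <- idx N C D] | x <- idx N C D].
    rewrite -map_comp; apply/eq_in_map => x Hx /=; rewrite -map_comp; congr flatten.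
    apply/eq_in_map => y Hy /=; congr flatten; apply: eq_map => r.
    by rewrite /sc !(codeK D0 C0 sz).
  rewrite flat_idx lsem_for; congr flatten; apply: eq_map => t.
  rewrite lsem_for; congr flatten; apply: eq_map => i; rewrite lsem_lseqs -map_comp; congr flatten.
  apply: eq_map => u; rewrite flat_idx /comp lsem_for; congr flatten; apply: eq_map => t'.
  rewrite lsem_for; congr flatten; apply: eq_map => i'; rewrite lsem_lseqs -map_comp; congr flatten.
  by apply: eq_map => u'; apply: lsem_cell.
rewrite Hplayers Hmatrix {Hplayers Hmatrix}.
have shift n : dbl (nseq n false) = flatten (nseq n [:: false; false]) by exact: dbl_nseq.
rewrite /enc_instance /= szp /enc_nat /sd -/(dbl (bin e)) -/(dbl (bin (2 ^ e))).
rewrite -(muln1 (2 ^ e)) bin_shift // /e -addnn !nseqD !dbl_cat -!shift.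
have -> : N * N * (C.-1 + m) = 2 ^ (kk + kk) * (C.-1 + m) by rewrite expnD.
have Cm : 0 < C.-1 + m by rewrite /m /rounds; lia.
rewrite /enc_int /sd /= -/(dbl _) bin_shift // nseqD !dbl_cat.
by rewrite cats0 -!catA /= -?catA.
Qed.

End ReductionB.

(** * Composition of the two passes and the reduction *)

Lemma size_sd x : size (sd x) = (size x).*2 + 2.
Proof. by rewrite /sd size_cat; congr addn; elim: x => //= b s ->. Qed.

Lemma leq_pbound c k n n' : n <= n' -> pbound c k n <= pbound c k n'.
Proof. by move=> H; rewrite /pbound leq_add2r leq_mul2l; case: k => [|k]; rewrite ?leqnn ?orbT // leq_exp2r // H orbT. Qed.

Lemma pbound_exp c k n m : n <= m -> 0 < m -> pbound c k n <= c.*2 * m ^ k.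
Proof.
move=> H Hm; rewrite /pbound -addnn mulnDl; apply: leq_add.
  by rewrite leq_mul2l; case: k => [|k]; rewrite ?leqnn ?orbT // leq_exp2r // H orbT.
by rewrite leq_pmulr // expn_gt0 Hm.
Qed.

Lemma template_size c k x R :
  size (template c k x R) = size (sd x) + pbound c k (size x) + R.
Proof. by rewrite size_cat size_map size_cat !size_nseq addnA. Qed.

Lemma template_width c k x R : all (fun v => size v == 2) (template c k x R).
Proof. by rewrite !all_cat all_map !all_nseq !orbT !andbT; apply/allP. Qed.

Lemma template_bits c k x R a i :
  dbit (template c k x R) a i =
  if i < size (sd x) then nth false (fx (nth false (sd x) i)) a
  else (i < size (sd x) + pbound c k (size x)) && (a < 2).
Proof.
rewrite /dbit nth_cat size_map; case: ltnP => H1; first by rewrite (nth_map false).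
rewrite nth_cat size_nseq !nth_nseq ltn_subLR //; case: ltnP => H2 /=.
  by case: a => [|[|a]] //=; rewrite nth_nil.
by case: ifP => _; case: a => [|[|a]] //=; rewrite nth_nil.
Qed.

Lemma size_tout d d0 p ds :
  size (transduced d d0 p ds) <= lout (2 ^ (d0 + 4) + (size ds).*2) p.
Proof. exact: leq_trans (size_lsem _ _ _ _ _ _) (lout_mono _ (exp_kap_leq _ _)). Qed.

(** Each pass is polynomial in the lengths of its input and output. [lout] bounds the template by
    [YA] and the instance by [YB], both polynomial in the original input. *)
Lemma reduction_computable M c k cR kR :
  poly_computable (fun x => enc_instance
    (instB M (template c k x (cR.*2 * (2 ^ kap 0 (size x)) ^ kR)))).
Proof.
set dA := maxn 1 (maxn k kR); set pA := progA c k cR kR; set pB := progB M.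
set off := numeral_offset M.
have [fA [ca [ka HfA]] HA] := runs_transducer 0 (isT : 0 < 1) (lok_progA c k cR kR).
have [fB [cb [kb HfB]] HB] := runs_transducer off (isT : 0 < 2) (lok_progB M).
pose YA n := lout (2 ^ (0 + 4) + n.*2) pA.
pose YB n := lout (2 ^ (off + 4) + (YA n).*2) pB.
pose F n := ca * (n + YA n).+1 ^ ka + cb * (YA n + YB n).+1 ^ kb.
have pD f : polyb f -> polyb (fun n => (f n).*2).
  move=> Hf; apply: (@polyb_le _ (fun n => f n + f n)) => [n|]; first by rewrite addnn.
  exact: polyb_add.
have pS f : polyb f -> polyb (fun n => (f n).+1).
  move=> Hf; apply: (@polyb_le _ (fun n => f n + 1)) => [n|]; first by rewrite addn1.
  exact: polyb_add Hf (polyb_const _).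
have pYA : polyb YA by apply: lout_polyb; apply: polyb_add (polyb_const _) (pD _ polyb_id).
have pYB : polyb YB by apply: lout_polyb; apply: polyb_add (polyb_const _) (pD _ pYA).
have pF : polyb F.
  apply: polyb_add; apply: polyb_mul (polyb_const _) _; apply: polyb_exp; apply: pS.
    exact: polyb_add polyb_id pYA.
  exact: polyb_add pYA pYB.
have [cF [kF HF]] := polyb_leq_pbound pF.
apply: (@exec_poly_computable _ (Sq (Transducer dA 1 0 pA) (Transducer 5 2 off pB)) cF kF) => x.
set R := cR.*2 * _; set ds := template c k x R.
have Eflat : flatten [seq [:: b] | b <- x] = x by elim: (x) => //= b s ->.
have hA := tout_progA c k cR kR x; rewrite -/dA -/pA -/R -/ds in hA.
have hB := tout_progB M ds; rewrite -/off -/pB in hB.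
have ne1 : flatten ds != [::].
  rewrite /ds /template /sd; case: (x) => //=.
have ne2 : enc_instance (instB M ds) != [::].
  by rewrite /enc_instance /enc_nat /sd; case: (flatten _).
have szA : size (flatten ds) <= YA (size x).
  by rewrite -hA; apply: leq_trans (size_tout _ _ _ _) _; rewrite size_map.
have szds : size ds <= size (flatten ds).
  have := template_width c k x R; rewrite -/ds; elim: (ds) => //= v s IH /andP[/eqP Hv Hs].
  by rewrite size_cat Hv; have := IH Hs; lia.
have szB : size (enc_instance (instB M ds)) <= YB (size x).
  rewrite -hB; apply: leq_trans (size_tout _ _ _ _) _; apply: lout_mono.
  by rewrite leq_add2l leq_double; apply: leq_trans szds szA.
have [] := HA [seq [:: b] | b <- x].
- by rewrite all_map; apply/allP.
- by rewrite hA.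
rewrite hA Eflat size_map => nA HnA eA.
have [] := HB ds (template_width _ _ _ _).
- by rewrite hB.
rewrite hB => nB HnB eB.
exists (word_tape (enc_instance (instB M ds))), (nA + nB); split=> //.
  exact: exec_sq eA eB.
apply: leq_trans (HF _); apply: leq_add.
  apply: leq_trans HnA (leq_trans (HfA _) _); rewrite leq_mul2l; apply/orP; right.
  by case: (ka) => // e; rewrite leq_exp2r // ltnS leq_add2l szA.
apply: leq_trans HnB (leq_trans (HfB _) _); rewrite leq_mul2l; apply/orP; right.
case: (kb) => // e; rewrite leq_exp2r // ltnS; apply: leq_add => //.
exact: leq_trans szds szA.
Qed.

(* NP-hardness of Tournament Value Maximization restricted to 0/1 game
   values: every NP language many-one reduces in polynomial time to
   (encoded) well-formed instances with v in {0,1}. *)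
Theorem theorem1 :
  forall L : language, in_NP L ->
  exists f : seq bool -> tvm_instance,
    poly_computable (fun x => enc_instance (f x)) /\
    forall x, wf_instance (f x) /\ zero_one (f x) /\ (L x <-> tvm_yes (f x)).
Proof.
move=> L [L' [c [k [[M [c' [k' HM]]] HL]]]].
(* The verifier's time on the longest pair: [sd x] has length [n.*2 + 2], the witness at most
   [pbound c k n]. *)
pose T n := pbound c' k' (n.*2 + 2 + pbound c k n).
have pT : polyb (fun n => T n + 2).
  apply: polyb_add (polyb_const _); apply: polyb_comp (polyb_pbound _ _) _.
  apply: polyb_add (polyb_pbound _ _); apply: polyb_add (polyb_const _).
  apply: (@polyb_le _ (fun n => n + n)) => [n|]; first by rewrite addnn.
  exact: polyb_add polyb_id polyb_id.
have [cR [kR HR]] := polyb_leq_pbound pT.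
exists (fun x => instB M (template c k x (cR.*2 * (2 ^ kap 0 (size x)) ^ kR))).
split; first exact: reduction_computable.
move=> x; set R := cR.*2 * _; set ds := template c k x R.
have D0 := nconstr_gt0 M; have C0 := ntiles_gt0 M; have szE := sizeB M ds.
split; first exact: wf_inst D0 C0 szE.
split; first by move=> a b r _ _ /=; case: (sc _ _ _ _ _ _ _ _ _ _); [right|left].
set N := 2 ^ kap (numeral_offset M) (size ds) in szE.
set u := sd x; set W := pbound c k (size x).
have szu : size u = (size x).*2 + 2 := size_sd x.
(* The bound in terms of [size x] is enlarged to a power of the number of blocks in the first pass;
   doubling [cR] absorbs the additive constant of [pbound]. *)
have RT : T (size x) + 2 <= R.
  apply: leq_trans (HR _) _; apply: pbound_exp; last by rewrite expn_gt0.
  exact: leq_exp_kap.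
(* The second pass keeps one template cell per block, so the side of the torus is at least the
   template's length. The padding thereby provides both space and time for the verifier. *)
have NR : size u + W + R <= N.
  by rewrite -template_size; apply: leq_exp_kap.
have N2 : 2 < N.
  apply: (@leq_trans (2 ^ 4)) => //; rewrite leq_exp2l //.
  by apply: leq_trans (kap_ge _ _); rewrite leq_addl.
have runT w : size w <= W -> let cf := run (T (size x)) (init M (u ++ w)) in
    halting (cstate cf) /\ (accepting (cstate cf) <-> L' (u ++ w)).
  move=> Hw; have [Hh Ha] := HM (u ++ w).
  have Hle : pbound c' k' (size (u ++ w)) <= T (size x).
    by apply: leq_pbound; rewrite size_cat szu; lia.
  by rewrite /= (run_halting_le Hle Hh).
have u0 : u != [::] by rewrite -size_eq0 szu; lia.
have b0 i : dbit ds 0 i = if i < size u then ~~ nth false u i else i < size u + W.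
  by rewrite template_bits andbT.
have b1 i : dbit ds 1 i = if i < size u then nth false u i else i < size u + W.
  by rewrite template_bits andbT.
have tab := @tableau_csp M N (dbit ds 0) (dbit ds 1) u W (T (size x)) u0 b0 b1 N2
  ltac:(lia) ltac:(lia) (fun w Hw => proj1 (runT w Hw)).
rewrite HL; split.
- move=> [w [Hw Hx]]; have Hw2 : exists2 w, size w <= W &
      accepting (cstate (run (T (size x)) (init M (u ++ w)))).
    by exists w => //; apply/(proj2 (runT w Hw)).
  have [sel Hsel] := tab.2 Hw2; exact: (csp_inst D0 C0 szE Hsel).
- move=> /(inst_csp D0 C0 szE) /tab.1 [w Hw Hacc].
  by exists w; split=> //; apply/(proj2 (runT w Hw)).
Qed.
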